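(* Let $m\ge1$ and let $t_1,\dots,t_m$ be non-zero complex numbers such that $1+t_j^2+t_j^4+\cdots+t_j^{2n}\ne0$ for all $n\ge1$ and all $j$. Let $\mathcal{C}=\mathcal{C}(t_1)*\cdots*\mathcal{C}(t_m)$, let $A_n$ be the planar diagram algebras, $W_n$ the objects of $\mathcal{C}$, and $\phi:\bigcup_{n\ge1}A_n\to\bigcup_{n\ge1}\mathrm{End}(W_n)$ the algebra homomorphism, all defined in the context. Then $\phi$ is bijective. Thus the Bisch–Jones planar algebra $FC(t_1+t_1^{-1},\dots,t_m+t_m^{-1})=\bigcup_{n\ge1}FC_n(t_1+t_1^{-1},\dots,t_m+t_m^{-1})$ is identified with the inductive limit of the ascending sequence of algebras $$\mathrm{End}(X)\subset\mathrm{End}(X\otimes X^* )\subset\mathrm{End}(X\otimes X^*\otimes X)\subset\cdots$$ associated to the simple object $X=X_1\otimes X_2\otimes\cdots\otimes X_m$ of the free product tensor category $\mathcal{C}$.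
   Context: Tensor categories $\mathcal{C}(t)$. For $t\in\mathbb{C}^\times$ with $1+t^2+\dots+t^{2n}\neq0$ for all $n\ge1$, $\mathcal{C}(t)$ is the rigid semisimple tensor category over $\mathbb{C}$ with the fusion rules of $SU(2)$ (simple objects $y_0=1,y_1,y_2,\dots$ with $y_ky_1=y_1y_k=y_{k-1}+y_{k+1}$ for $k\ge1$) which is determined up to equivalence by $t$ (Kazhdan–Wenzl) as follows: let $X=y_1$, let $e\in\mathrm{End}(X\otimes X)$ be the idempotent onto the unit component, $q=t^2$, $g=q(1-e)-e$, $g_1=g\otimes1_X$, $g_2=1_X\otimes g$; then $e_1=e\otimes 1_X$, $e_2=1_X\otimes e$ satisfy $e_1e_2e_1=(q+q^{-1}+2)^{-1}e_1$, $e_2e_1e_2=(q+q^{-1}+2)^{-1}e_2$, and $g_2g_1(1_X\otimes\delta)=t^3(\delta\otimes1_X)$ for $\delta\in\mathrm{Hom}(1,X\otimes X)$. Equivalently, $\mathcal{C}(t)$ is the tensor category generated by the two-dimensional fundamental representation of the quantum group $SL_t(2,\mathbb{C})$. The generator $X$ has a dual object $X^*$ (isomorphic to $X$) and morphisms $\epsilon_X:X\otimes X^*\to1$, $\epsilon_{X^*}:X^*\otimes X\to1$, ${}^t\epsilon_X:1\to X\otimes X^*$, ${}^t\epsilon_{X^*}:1\to X^*\otimes X$ satisfying the hook (zig-zag) identities and $\epsilon_X{}^t\epsilon_X=\epsilon_{X^*}{}^t\epsilon_{X^*}=t+t^{-1}$. Free product. $\mathcal{C}=\mathcal{C}(t_1)*\cdots*\mathcal{C}(t_m)$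 is the semisimple tensor category generated by (full tensor subcategories identified with) $\mathcal{C}(t_1),\dots,\mathcal{C}(t_m)$, whose simple objects are, up to isomorphism and without repetition, the tensor products $s_1\otimes\cdots\otimes s_r$ ($r\ge0$) of non-unit simple objects $s_i\in\mathcal{C}(t_{j_i})$ with $j_i\ne j_{i+1}$; its spectrum set is the set $S=S_1*\cdots*S_m$ of such reduced words, $S_j$ the spectrum of $\mathcal{C}(t_j)$. $X_j$ denotes the fundamental generator of $\mathcal{C}(t_j)$, with class $x_j\in S_j$. Planar algebras. Consider the infinite periodic coloring $x_1x_2\cdots x_mx_m^*\cdots x_1^*x_1\cdots x_m\cdots$ (as colors $x_j=x_j^*$; the star records the parity of the occurrence), let $w_n$ be its initial subword of length $n$ and $W_n$ the corresponding tensor product in $\mathcal{C}$: $W_1=X_1$, $W_2=X_1\otimes X_2$, $W_{m+1}=X_1\otimes\cdots\otimes X_m\otimes X_m^*$, etc. $A_n$ is the complex vector space with basis the planar string diagrams in a rectangle with $n$ top (source) points and $n$ bottom (target) points, each row colored in order by $w_n$: non-crossing perfect matchings of the $2n$ boundary points connecting points of the same color. The product $ab$ is given by stacking (with $b$ on top of $a$, diagrams read from top to bottom), each closed loop of color $x_j$ being replaced by the scalar $t_j+t_j^{-1}$. $A_n\subset A_{n+1}$ by adding a vertical string at the right. $FC_n(t_1+t_1^{-1},\dots,t_m+t_m^{-1})=A_{mn}$. Also $\mathrm{End}(W_n)\subset\mathrm{End}(W_{n+1})$ by $f\mapsto f\otimes1$. Map $\phi$. In a diagram of $A_n$, pairings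 among source points or among target points join $x_j$ to $x_j^*$, and through strings join $x_j$ to $x_j$ or $x_j^*$ to $x_j^*$. $\phi$ sends a diagram to the morphism $W_n\to W_n$ obtained by reading it from top to bottom, replacing pairings of source points by $\epsilon_{X_j}$ or $\epsilon_{X_j^*}$, pairings of target points by ${}^t\epsilon_{X_j}$ or ${}^t\epsilon_{X_j^*}$, and through strings by identities; it is an algebra homomorphism with $\phi(A_n)\subset\mathrm{End}(W_n)$. *)

(* Defs.v *)
From HB Require Import structures.
From mathcomp Require Import all_boot all_order all_algebra.
From mathcomp Require Import boolp reals.
From mathcomp Require Import complex.

Set Implicit Arguments.
Unset Strict Implicit.
Unset Printing Implicit Defensive.

Import GRing.Theory.
Local Open Scope ring_scope.
Local Open Scope quotient_scope.

(** * Linear and tensor categories *)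

Record linear_category (K : fieldType) := LinearCategory {
  obj :> Type;
  hom : obj -> obj -> lmodType K;
  idm : forall x, hom x x;
  comp : forall x y z, hom y z -> hom x y -> hom x z;
  comp_linearl : forall x y z (f : hom x y) (a : K) (g h : hom y z),
    comp (a *: g + h) f = a *: comp g f + comp h f;
  comp_linearr : forall x y z (f : hom y z) (a : K) (g h : hom x y),
    comp f (a *: g + h) = a *: comp f g + comp f h;
  compA : forall x y z w (f : hom z w) (g : hom y z) (h : hom x y),
    comp f (comp g h) = comp (comp f g) h;
  comp1m : forall x y (f : hom x y), comp (idm y) f = f;
  compm1 : forall x y (f : hom x y), comp f (idm x) = f
}.

Arguments hom {K l}.
Arguments idm {K l}.
Arguments comp {K l x y z}.

Declare Scope cat_scope.
Delimit Scope cat_scope with cat.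
Local Open Scope cat_scope.
Notation "g ∘ f" := (comp g f) (at level 40, left associativity) : cat_scope.

(* Not assumed strict: the associativity and unit constraints are explicit. *)
Record tensor_category (K : fieldType) := TensorCategory {
  lincat :> linear_category K;
  tob : lincat -> lincat -> lincat;
  tunit : lincat;
  tmor : forall x y x' y' : lincat,
    hom x y -> hom x' y' -> hom (tob x x') (tob y y');
  tmor_linearl : forall (x y x' y' : lincat) (f : hom x' y') (a : K)
    (g h : hom x y), tmor (a *: g + h) f = a *: tmor g f + tmor h f;
  tmor_linearr : forall (x y x' y' : lincat) (f : hom x y) (a : K)
    (g h : hom x' y'), tmor f (a *: g + h) = a *: tmor f g + tmor f h;
  tmor1 : forall x y : lincat, tmor (idm x) (idm y) = idm (tob x y);
  tmor_comp : forall (x y z x' y' z' : lincat) (g : hom y z) (f : hom x y)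
    (g' : hom y' z') (f' : hom x' y'),
    tmor (g ∘ f) (g' ∘ f') = tmor g g' ∘ tmor f f';
  asc : forall x y z : lincat, hom (tob (tob x y) z) (tob x (tob y z));
  ascV : forall x y z : lincat, hom (tob x (tob y z)) (tob (tob x y) z);
  lun : forall x : lincat, hom (tob tunit x) x;
  lunV : forall x : lincat, hom x (tob tunit x);
  run : forall x : lincat, hom (tob x tunit) x;
  runV : forall x : lincat, hom x (tob x tunit);
  ascK : forall x y z, ascV x y z ∘ asc x y z = idm _;
  ascVK : forall x y z, asc x y z ∘ ascV x y z = idm _;
  lunK : forall x, lunV x ∘ lun x = idm _;
  lunVK : forall x, lun x ∘ lunV x = idm _;
  runK : forall x, runV x ∘ run x = idm _;
  runVK : forall x, run x ∘ runV x = idm _;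
  asc_natural : forall (x y x' y' x'' y'' : lincat) (f : hom x y)
    (f' : hom x' y') (f'' : hom x'' y''),
    asc _ _ _ ∘ tmor (tmor f f') f'' = tmor f (tmor f' f'') ∘ asc _ _ _;
  lun_natural : forall (x y : lincat) (f : hom x y),
    lun y ∘ tmor (idm tunit) f = f ∘ lun x;
  run_natural : forall (x y : lincat) (f : hom x y),
    run y ∘ tmor f (idm tunit) = f ∘ run x;
  pentagon : forall x y z w : lincat,
    asc x y (tob z w) ∘ asc (tob x y) z w =
    tmor (idm x) (asc y z w) ∘ asc x (tob y z) w ∘ tmor (asc x y z) (idm w);
  triangle : forall x y : lincat,
    tmor (idm x) (lun y) ∘ asc x tunit y = tmor (run x) (idm y)
}.

Arguments tob {K t}.
Arguments tunit {K t}.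
Arguments tmor {K t x y x' y'}.
Arguments asc {K t}.
Arguments ascV {K t}.
Arguments lun {K t}.
Arguments lunV {K t}.
Arguments run {K t}.
Arguments runV {K t}.

Notation "x ⊗ y" := (tob x y) (at level 40, left associativity) : cat_scope.
Notation "f ⊠ g" := (tmor f g) (at level 38, left associativity) : cat_scope.
Notation "'𝟙'" := tunit (at level 0) : cat_scope.

Section LinearCategoryNotions.
Variables (K : fieldType) (C : linear_category K).
Implicit Types x y z : C.

Record iso x y := Iso {
  fwd : hom x y;
  bwd : hom y x;
  fwdK : bwd ∘ fwd = idm x;
  bwdK : fwd ∘ bwd = idm y
}.

Definition isomorphic x y : Prop := inhabited (iso x y).

Definition simple x : Prop :=
  idm x != 0 /\ forall f : hom x x, exists a : K, f = a *: idm x.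

(* For n = 0 this says that z is a zero object. *)
Definition direct_sum n (s : 'I_n -> C) z : Prop :=
  exists (i : forall k, hom (s k) z) (p : forall k, hom z (s k)),
    [/\ forall k, p k ∘ i k = idm (s k),
        forall k l, k != l -> p k ∘ i l = 0
      & \sum_k (i k ∘ p k) = idm z].

Definition semisimple : Prop :=
  [/\ forall n (s : 'I_n -> C), exists z, direct_sum s z,
      forall x (e : hom x x), e ∘ e = e ->
        exists y (i : hom y x) (p : hom x y), p ∘ i = idm y /\ i ∘ p = e,
      forall x, exists n (s : 'I_n -> C),
        (forall k, simple (s k)) /\ direct_sum s x
    & forall x y, simple x -> simple y -> ~ isomorphic x y ->
        forall f : hom x y, f = 0].

Definition iso_refl x : iso x x :=
  Iso (comp1m (idm x)) (comp1m (idm x)).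

Lemma iso_trans_proof x y z (f : iso x y) (g : iso y z) :
  (bwd f ∘ bwd g) ∘ (fwd g ∘ fwd f) = idm x.
Proof. by rewrite compA -(compA (bwd f)) fwdK compm1 fwdK. Qed.

Definition iso_sym x y (f : iso x y) : iso y x := Iso (bwdK f) (fwdK f).

Definition iso_trans x y z (f : iso x y) (g : iso y z) : iso x z :=
  Iso (iso_trans_proof f g) (iso_trans_proof (iso_sym g) (iso_sym f)).

Definition iso_eq x y (e : x = y) : iso x y :=
  ecast w (iso x w) e (iso_refl x).

End LinearCategoryNotions.

Section TensorCategoryNotions.
Variables (K : fieldType) (C : tensor_category K).
Implicit Types x y z : C.

Lemma iso_tensor_proof x y x' y' (f : iso x y) (g : iso x' y') :
  (bwd f ⊠ bwd g) ∘ (fwd f ⊠ fwd g) = idm (x ⊗ x').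
Proof. by rewrite -tmor_comp !fwdK tmor1. Qed.

Definition iso_tensor x y x' y' (f : iso x y) (g : iso x' y') :
  iso (x ⊗ x') (y ⊗ y') :=
  Iso (iso_tensor_proof f g) (iso_tensor_proof (iso_sym f) (iso_sym g)).

Definition iso_asc x y z : iso ((x ⊗ y) ⊗ z) (x ⊗ (y ⊗ z)) :=
  Iso (ascK x y z) (ascVK x y z).

Definition iso_runV x : iso x (x ⊗ 𝟙) := Iso (runVK x) (runK x).

(* The two hook identities for a pair of morphisms between a and b. *)
Definition hooks (a b : C) (ev : hom (a ⊗ b) 𝟙) (coev : hom 𝟙 (b ⊗ a)) : Prop :=
  lun a ∘ (ev ⊠ idm a) ∘ ascV a b a ∘ (idm a ⊠ coev) ∘ runV a = idm a /\
  run b ∘ (idm b ⊠ ev) ∘ asc b a b ∘ (coev ⊠ idm b) ∘ lunV b = idm b.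

Definition rigid : Prop := forall x : C,
  (exists y (ev : hom (x ⊗ y) 𝟙) (coev : hom 𝟙 (y ⊗ x)), hooks ev coev) /\
  (exists y (ev : hom (y ⊗ x) 𝟙) (coev : hom 𝟙 (x ⊗ y)), hooks ev coev).

(* Full tensor subcategory on the objects satisfying P. *)
Section FullSubcategory.
Variable P : C -> Prop.
Hypothesis P1 : P 𝟙.
Hypothesis PM : forall x y, P x -> P y -> P (x ⊗ y).

Definition full_lincat : linear_category K :=
  @LinearCategory K {x : C | P x} (fun a b => hom (sval a) (sval b))
    (fun a => idm (sval a)) (fun a b c => @comp K C _ _ _)
    (fun a b c => @comp_linearl K C _ _ _) (fun a b c => @comp_linearr K C _ _ _)
    (fun a b c d => @compA K C _ _ _ _)
    (fun a b => @comp1m K C _ _) (fun a b => @compm1 K C _ _).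

Definition full_tob (a b : full_lincat) : full_lincat :=
  exist P (sval a ⊗ sval b) (PM (svalP a) (svalP b)).

Definition full_subcat : tensor_category K :=
  @TensorCategory K full_lincat full_tob (exist P 𝟙 P1)
    (fun a b a' b' => @tmor K C _ _ _ _)
    (fun a b a' b' => @tmor_linearl K C _ _ _ _)
    (fun a b a' b' => @tmor_linearr K C _ _ _ _)
    (fun a b => @tmor1 K C _ _)
    (fun a b c a' b' c' => @tmor_comp K C _ _ _ _ _ _)
    (fun a b c => asc (sval a) (sval b) (sval c))
    (fun a b c => ascV (sval a) (sval b) (sval c))
    (fun a => lun (sval a)) (fun a => lunV (sval a))
    (fun a => run (sval a)) (fun a => runV (sval a))
    (fun a b c => @ascK K C _ _ _) (fun a b c => @ascVK K C _ _ _)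
    (fun a => @lunK K C _) (fun a => @lunVK K C _)
    (fun a => @runK K C _) (fun a => @runVK K C _)
    (fun a b a' b' a'' b'' => @asc_natural K C _ _ _ _ _ _)
    (fun a b => @lun_natural K C _ _) (fun a b => @run_natural K C _ _)
    (fun a b c d => @pentagon K C _ _ _ _) (fun a b => @triangle K C _ _).
End FullSubcategory.

(* The left-nested tensor product (..((1 ⊗ y_0) ⊗ y_1) ..) ⊗ y_(n-1). *)
Fixpoint tprod (y : nat -> C) (n : nat) : C :=
  if n is n'.+1 then tprod y n' ⊗ y n' else 𝟙.

Lemma eq_tprod (y z : nat -> C) n :
  (forall i, (i < n)%N -> y i = z i) -> tprod y n = tprod z n.
Proof.
elim: n => //= n IHn yz.
by rewrite yz // IHn // => i lt_in; apply/yz/ltnW.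
Qed.

Fixpoint tprod_cat (y : nat -> C) (n k : nat) :
  iso (tprod y (k + n)) (tprod y n ⊗ tprod (fun i => y (i + n)%N) k) :=
  if k is k'.+1 then
    iso_trans (iso_tensor (tprod_cat y n k') (iso_refl (y (k' + n)%N)))
              (iso_asc _ _ _)
  else iso_runV _.

(* Rebracketing of km factors into k blocks of m factors. *)
Fixpoint tprod_block (m : nat) (y z : nat -> C)
    (yz : forall k, tprod (fun i => y (i + k * m)%N) m = z k) (k : nat) :
    iso (tprod y (k * m)) (tprod z k) :=
  if k is k'.+1 then
    iso_trans (tprod_cat y (k' * m) m)
              (iso_tensor (tprod_block yz k') (iso_eq (yz k')))
  else iso_refl _.

End TensorCategoryNotions.

(** * The categories C(t) and their free products *)

Section TL.
Variables (K : fieldType) (t : K) (D : tensor_category K).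

(* Here e is the idempotent onto the unit component of X ⊗ X, d spans
   Hom(1, X ⊗ X), and all words in g_1, g_2 act on (X ⊗ X) ⊗ X. *)
Section KazhdanWenzl.
Variables (X : D) (d : hom 𝟙 (X ⊗ X)) (d' : hom (X ⊗ X) 𝟙).

Definition kw_e : hom (X ⊗ X) (X ⊗ X) := d ∘ d'.
Definition kw_g : hom (X ⊗ X) (X ⊗ X) :=
  t ^+ 2 *: (idm (X ⊗ X) - kw_e) - kw_e.
Definition on_left (f : hom (X ⊗ X) (X ⊗ X)) : hom (X ⊗ X ⊗ X) (X ⊗ X ⊗ X) :=
  f ⊠ idm X.
Definition on_right (f : hom (X ⊗ X) (X ⊗ X)) : hom (X ⊗ X ⊗ X) (X ⊗ X ⊗ X) :=
  ascV X X X ∘ (idm X ⊠ f) ∘ asc X X X.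
Definition insert_left : hom X (X ⊗ X ⊗ X) := (d ⊠ idm X) ∘ lunV X.
Definition insert_right : hom X (X ⊗ X ⊗ X) :=
  ascV X X X ∘ (idm X ⊠ d) ∘ runV X.

Definition kazhdan_wenzl : Prop :=
  let e1 := on_left kw_e in let e2 := on_right kw_e in
  let g1 := on_left kw_g in let g2 := on_right kw_g in
  let c := (t ^+ 2 + t ^- 2 + 2)^-1 in
  [/\ d' ∘ d = idm 𝟙,
      e1 ∘ e2 ∘ e1 = c *: e1,
      e2 ∘ e1 ∘ e2 = c *: e2
    & g2 ∘ g1 ∘ insert_right = t ^+ 3 *: insert_left].
End KazhdanWenzl.

(* "D is C(t)", with y the list of its simple objects. *)
Record is_TL (y : nat -> D) : Prop := IsTL {
  TL_semisimple : semisimple D;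
  TL_rigid : rigid D;
  TL_simple : forall k, simple (y k);
  TL_inj : forall k l, isomorphic (y k) (y l) -> k = l;
  TL_all : forall x, simple x -> exists k, isomorphic x (y k);
  TL_unit : isomorphic (y 0%N) 𝟙;
  TL_fusionr : forall k,
    direct_sum (tnth [tuple y k; y k.+2]) (y k.+1 ⊗ y 1%N);
  TL_fusionl : forall k,
    direct_sum (tnth [tuple y k; y k.+2]) (y 1%N ⊗ y k.+1);
  TL_kw : exists (d : hom 𝟙 (y 1%N ⊗ y 1%N)) (d' : hom (y 1%N ⊗ y 1%N) 𝟙),
    kazhdan_wenzl d d'
}.
End TL.

(* Words in S_1 * ... * S_m: the letter (j, k) stands for the simple object y_k
   of C(t_j); no letter is a unit and neighbours come from distinct factors. *)
Definition reduced m (w : seq ('I_m * nat)) : bool :=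
  all (fun s => (0 < s.2)%N) w && sorted (fun s s' => s.1 != s'.1) w.

(* "C is C(t_1) * ... * C(t_m)", with the full subcategories C(t_j). *)
Record free_product (K : fieldType) m (t : 'I_m -> K) (C : tensor_category K) :=
  FreeProduct {
    fp_in : 'I_m -> C -> Prop;
    fp_in1 : forall j, fp_in j 𝟙;
    fp_inM : forall j x y, fp_in j x -> fp_in j y -> fp_in j (x ⊗ y);
    fp_spec : forall j, nat -> full_subcat (fp_in1 j) (@fp_inM j);
    fp_factor : forall j, is_TL (t j) (fp_spec j);
    fp_word : seq ('I_m * nat) -> C :=
      foldr (fun s x => sval (fp_spec s.1 s.2) ⊗ x) 𝟙;
    fp_semisimple : semisimple C;
    fp_simple : forall w, reduced w -> simple (fp_word w);
    fp_inj : forall w w', reduced w -> reduced w' ->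
      isomorphic (fp_word w) (fp_word w') -> w = w';
    fp_all : forall x, simple x ->
      exists2 w, reduced w & isomorphic x (fp_word w)
  }.

Definition fp_gen (K : fieldType) m (t : 'I_m -> K) C (F : free_product t C) (j : 'I_m) : C :=
  sval (fp_spec F j 1%N).

(* A dual X^* of X with epsilon_X, epsilon_{X^*} and their transposes, both
   loops being equal to c. *)
Record dual_data (K : fieldType) (C : tensor_category K) (X : C) (c : K) :=
  DualData {
    dual : C;
    eps : hom (X ⊗ dual) 𝟙;
    eps' : hom (dual ⊗ X) 𝟙;
    teps : hom 𝟙 (X ⊗ dual);
    teps' : hom 𝟙 (dual ⊗ X);
    dual_hooks : hooks eps teps';
    dual_hooks' : hooks eps' teps;
    dual_loop : eps ∘ teps = c *: idm 𝟙;
    dual_loop' : eps' ∘ teps' = c *: idm 𝟙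
  }.

(** * Increasing sequences of algebras and their inductive limits *)

Record tower (K : fieldType) := Tower {
  tow :> nat -> lmodType K;
  tow_one : forall n, tow n;
  tow_mul : forall n, tow n -> tow n -> tow n;
  tow_inc : forall n, tow n -> tow n.+1
}.

Arguments tow_one {K}.
Arguments tow_mul {K t n}.
Arguments tow_inc {K t n}.

Section Limit.
Variables (K : fieldType) (A : tower K).

Definition germ := {n : nat & A n}.

(* The image of x in A_N; meaningful when tag x <= N. *)
Fixpoint lift_to (N : nat) (x : germ) : A N :=
  if N is N'.+1 then
    untag (T_ := fun n => A n) (tow_inc (lift_to N' x)) id x
  else untag (T_ := fun n => A n) 0 id x.

Definition germ_eq (x y : germ) : bool :=
  `[< exists N, [/\ (tag x <= N)%N, (tag y <= N)%N & lift_to N x = lift_to N y] >].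

Lemma lift_toS N x : (tag x <= N)%N -> lift_to N.+1 x = tow_inc (lift_to N x).
Proof. by move=> le_xN /=; rewrite untag_dflt // neq_ltn ltnS le_xN. Qed.

Lemma lift_to_eq N M x y : (N <= M)%N -> (tag x <= N)%N -> (tag y <= N)%N ->
  lift_to N x = lift_to N y -> lift_to M x = lift_to M y.
Proof.
move=> leNM xN yN eqN; elim: M leNM => [|M IHM].
  by rewrite leqn0 => /eqP N0; rewrite N0 in eqN.
rewrite leq_eqVlt => /orP[/eqP<- //|]; rewrite ltnS => leNM.
by rewrite !lift_toS ?(leq_trans _ leNM) // IHM.
Qed.

Lemma germ_eq_refl : reflexive germ_eq.
Proof. by move=> x; apply/asboolP; exists (tag x). Qed.

Lemma germ_eq_sym : symmetric germ_eq.
Proof.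
by move=> x y; apply/asboolP/asboolP => -[N [? ? /esym]]; exists N.
Qed.

Lemma germ_eq_trans : transitive germ_eq.
Proof.
move=> y x z /asboolP[N [xN yN xy]] /asboolP[M [yM zM yz]].
apply/asboolP; exists (maxn N M).
rewrite !leq_max xN zM orbT; split=> //.
rewrite (lift_to_eq (leq_maxl N M) xN yN xy).
exact: lift_to_eq (leq_maxr N M) yM zM yz.
Qed.

Canonical germ_equiv := EquivRel germ_eq germ_eq_refl germ_eq_sym germ_eq_trans.

Definition lim := {eq_quot germ_equiv}.
Definition in_lim n (a : A n) : lim := \pi_lim (Tagged (fun n => A n) a).

Definition lim_one : lim := in_lim (tow_one A 0%N).
Definition lim_scale (c : K) (x : lim) : lim := in_lim (c *: tagged (repr x)).
Definition lim_op (op : forall n, A n -> A n -> A n) (x y : lim) : lim :=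
  let N := maxn (tag (repr x)) (tag (repr y)) in
  in_lim (op N (lift_to N (repr x)) (lift_to N (repr y))).
Definition lim_add : lim -> lim -> lim := lim_op (fun n a b => a + b).
Definition lim_mul : lim -> lim -> lim := lim_op (fun n => tow_mul).

Fixpoint inc_by k n (a : A n) : A (k + n)%N :=
  if k is k'.+1 then tow_inc (inc_by k' a) else a.

(* The subsequence A_0 ⊂ A_m ⊂ A_(2m) ⊂ ... *)
Definition subtower (m : nat) : tower K :=
  @Tower K (fun k => A (k * m)%N) (fun k => tow_one A (k * m)%N)
    (fun k => @tow_mul K A (k * m)%N) (fun k => @inc_by m (k * m)%N).

End Limit.

Section TowerMorphisms.
Variables (K : fieldType) (A B : tower K) (f : forall n, A n -> B n).

Definition tower_morphism : Prop := forall n,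
  [/\ linear (@f n), f (tow_one A n) = tow_one B n,
      forall a b : A n, f (tow_mul a b) = tow_mul (f a) (f b)
    & forall a : A n, f (tow_inc a) = tow_inc (f a)].

Definition lim_map (x : lim A) : lim B := in_lim (f (tagged (repr x))).

(* f is a morphism of increasing sequences of algebras, bijective at each level,
   and the map it induces on the unions is an isomorphism of algebras. *)
Definition limit_isomorphism : Prop :=
  [/\ tower_morphism, (forall n, bijective (@f n)) &
   [/\ forall n (a : A n), lim_map (in_lim a) = in_lim (f a),
       forall x y, lim_map (lim_add x y) = lim_add (lim_map x) (lim_map y),
       forall c x, lim_map (lim_scale c x) = lim_scale c (lim_map x),
       lim_map (lim_one A) = lim_one B /\
       forall x y, lim_map (lim_mul x y) = lim_mul (lim_map x) (lim_map y)
     & bijective lim_map]].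
End TowerMorphisms.

(* End(1) ⊂ End(y_0) ⊂ End(y_0 ⊗ y_1) ⊂ ..., where f is sent to f ⊗ 1. *)
Definition end_tower (K : fieldType) (C : tensor_category K) (y : nat -> C) :
    tower K :=
  @Tower K (fun n => hom (tprod y n) (tprod y n)) (fun n => idm (tprod y n))
    (fun n f g => f ∘ g) (fun n f => f ⊠ idm (y n)).

(** * Planar diagrams *)

(* A letter (j, s) is the color x_j, or x_j^* when s = true. *)
Definition letter (m : nat) : Type := ('I_m * bool)%type.

Section Coloring.
Variables (m : nat) (hm : (0 < m)%N).

(* x_1 ... x_m for s = false, and x_m^* ... x_1^* for s = true. *)
Definition block_letter (s : bool) (i : nat) : letter m :=
  let r := Ordinal (ltn_pmod i hm) in (if s then rev_ord r else r, s).

Definition coloring (i : nat) : letter m := block_letter (odd (i %/ m)) i.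

Lemma coloring_block k i : (i < m)%N ->
  coloring (i + k * m)%N = block_letter (odd k) i.
Proof.
move=> lt_im; rewrite /coloring addnC divnMDl // (divn_small lt_im) addn0.
rewrite /block_letter; congr (if _ then rev_ord _ else _, _).
all: by apply/val_inj; rewrite /= modnMDl.
Qed.
End Coloring.

Section Diagrams.
Variables (m : nat) (hm : (0 < m)%N) (n : nat).

(* inl i is the i-th top (source) point, inr i the i-th bottom (target) point. *)
Definition point : finType := ('I_n + 'I_n)%type.
Definition pairing : finType := {ffun point -> point}.

Definition point_color (u : point) : 'I_m :=
  match u with inl i => (coloring hm i).1 | inr i => (coloring hm i).1 end.

(* The rank of a point when the boundary of the rectangle is followed clockwise
   from the top left corner. *)
Definition boundary_rank (u : point) : nat :=
  match u with inl i => i | inr i => n + (n - i.+1) end%N.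

Definition is_diagram (d : pairing) : bool :=
  [&& [forall u, (d (d u) == u) && (d u != u)],
      [forall u, point_color (d u) == point_color u]
    & [forall u, forall v,
        ~~ [&& boundary_rank u < boundary_rank v,
               boundary_rank v < boundary_rank (d u)
             & boundary_rank (d u) < boundary_rank (d v)]%N]].

Definition diagram := {d : pairing | is_diagram d}.

Definition id_pairing : pairing :=
  [ffun u => match u with inl i => inr i | inr i => inl i end].

(* Stacking x below y: the bottom points of y are identified with the top points
   of x, and are called inl (inr i). *)
Section Stacking.
Variables x y : pairing.
Definition level_point : finType := ('I_n + 'I_n + 'I_n)%type.
Definition in_upper (u : point) : level_point := inl u.
Definition in_lower (u : point) : level_point :=
  match u with inl i => inl (inr i) | inr i => inr i end.
Definition outer (u : point) : level_point :=
  match u with inl i => inl (inl i) | inr i => inr i end.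
Definition middle (i : 'I_n) : level_point := inl (inr i).

Definition strand : rel level_point := fun v w =>
  [exists u, (v == in_upper u) && (w == in_upper (y u))] ||
  [exists u, (v == in_lower u) && (w == in_lower (x u))].

Definition stack : pairing :=
  [ffun u => odflt u
     [pick v | (v != u) && connect strand (outer u) (outer v)]].

(* The middle points representing the closed loops, one for each loop. *)
Definition is_loop (i : 'I_n) : bool :=
  (fingraph.root strand (middle i) == middle i) &&
  [forall u, ~~ connect strand (middle i) (outer u)].
End Stacking.

End Diagrams.

Section DiagramAlgebra.
Variables (K : fieldType) (m : nat) (hm : (0 < m)%N) (delta : 'I_m -> K).

Definition diag_space (n : nat) : lmodType K := {ffun diagram hm n -> K^o}.

(* The basis vector of the diagram d (0 when d is not a diagram, which does not
   occur below: identities, stackings and extensions of diagrams are diagrams). *)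
Definition diag_vec n (d : pairing n) : diag_space n :=
  [ffun b : diagram hm n => ((val b == d)%:R : K^o)].

Definition loop_factor n (x y : pairing n) : K :=
  \prod_(i < n | is_loop x y i) delta (coloring hm i).1.

Definition diag_mul n (a b : diag_space n) : diag_space n :=
  \sum_(x : diagram hm n) \sum_(y : diagram hm n)
     ((a x * b y) * loop_factor (val x) (val y))
       *: diag_vec (stack (val x) (val y)).

Definition widen_point n (u : point n) : point n.+1 :=
  match u with
  | inl i => inl (widen_ord (leqnSn n) i)
  | inr i => inr (widen_ord (leqnSn n) i)
  end.

Definition narrow_point n (u : point n.+1) : option (point n) :=
  match u with
  | inl i => omap inl (unlift ord_max i)
  | inr i => omap inr (unlift ord_max i)
  end.

(* d with a vertical string added at the right. *)
Definition add_string n (d : pairing n) : pairing n.+1 :=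
  [ffun u => if narrow_point u is Some v then widen_point (d v)
             else id_pairing n.+1 u].

Definition diag_inc n (a : diag_space n) : diag_space n.+1 :=
  \sum_(x : diagram hm n) a x *: diag_vec (add_string (val x)).

Definition diag_tower : tower K :=
  @Tower K diag_space (fun n => diag_vec (id_pairing n)) diag_mul diag_inc.

(* The algebras FC_k = A_(mk). *)
Definition FC_tower : tower K := subtower diag_tower m.

End DiagramAlgebra.

(** * From diagrams to morphisms *)

Section Reading.
Variables (K : fieldType) (C : tensor_category K) (m : nat) (delta : 'I_m -> K).
Variables (hm : (0 < m)%N) (X : 'I_m -> C).
Variable X' : forall j, dual_data (X j) (delta j).

Definition letter_obj (a : letter m) : C := if a.2 then dual (X' a.1) else X a.1.

(* The morphisms attached to a pair of neighbouring letters x_j x_j^* or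
   x_j^* x_j; pairs of another kind are never joined, and are sent to 0. *)
Definition cap (a b : letter m) : hom (letter_obj a ⊗ letter_obj b) 𝟙 :=
  match a, b return hom (letter_obj a ⊗ letter_obj b) 𝟙 with
  | (j, s), (k, s') =>
    match j =P k with
    | ReflectT e =>
      match e in _ = k
        return hom (letter_obj (j, s) ⊗ letter_obj (k, s')) 𝟙 with
      | erefl =>
        match s, s' return hom (letter_obj (j, s) ⊗ letter_obj (j, s')) 𝟙 with
        | false, true => eps (X' j)
        | true, false => eps' (X' j)
        | _, _ => 0
        end
      end
    | ReflectF _ => 0
    end
  end.

Definition cup (a b : letter m) : hom 𝟙 (letter_obj a ⊗ letter_obj b) :=
  match a, b return hom 𝟙 (letter_obj a ⊗ letter_obj b) with
  | (j, s), (k, s') =>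
    match j =P k with
    | ReflectT e =>
      match e in _ = k
        return hom 𝟙 (letter_obj (j, s) ⊗ letter_obj (k, s')) with
      | erefl =>
        match s, s' return hom 𝟙 (letter_obj (j, s) ⊗ letter_obj (j, s')) with
        | false, true => teps (X' j)
        | true, false => teps' (X' j)
        | _, _ => 0
        end
      end
    | ReflectF _ => 0
    end
  end.

Definition W_factor (i : nat) : C := letter_obj (coloring hm i).

(* A row of open strings, listed from right to left. *)
Fixpoint strings_obj (s : seq (letter m)) : C :=
  if s is a :: s' then strings_obj s' ⊗ letter_obj a else 𝟙.

(* A row of points is read from left to right: a point that closes an arc is
   joined to the rightmost open string, the other ones (left ends of arcs and
   through strings) remain open. At the end exactly the through strings are
   left. Here closes i means that the i-th point is the right end of an arc. *)
Definition top_reading n :=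
  {s : seq (letter m) & hom (tprod W_factor n) (strings_obj s)}.
Definition TopReading n s (f : hom (tprod W_factor n) (strings_obj s)) :
  top_reading n := existT _ s f.

Definition top_close n s :
    hom (tprod W_factor n) (strings_obj s) -> top_reading n.+1 :=
  match s with
  | a :: s' => fun f => @TopReading n.+1 s'
      (run (strings_obj s') ∘ (idm (strings_obj s') ⊠ cap a (coloring hm n))
         ∘ asc (strings_obj s') (letter_obj a) (W_factor n)
         ∘ (f ⊠ idm (W_factor n)))
  | [::] => fun _ => @TopReading n.+1 [::] 0
  end.

Fixpoint read_top (closes : nat -> bool) (n : nat) : top_reading n :=
  if n is n'.+1 then
    let: existT s f := read_top closes n' in
    if closes n' then top_close f
    else @TopReading n'.+1 (coloring hm n' :: s) (f ⊠ idm (W_factor n'))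
  else @TopReading 0 [::] (idm 𝟙).

Definition bottom_reading n :=
  {s : seq (letter m) & hom (strings_obj s) (tprod W_factor n)}.
Definition BottomReading n s (g : hom (strings_obj s) (tprod W_factor n)) :
  bottom_reading n := existT _ s g.

Definition bottom_close n s :
    hom (strings_obj s) (tprod W_factor n) -> bottom_reading n.+1 :=
  match s with
  | a :: s' => fun g => @BottomReading n.+1 s'
      ((g ⊠ idm (W_factor n))
         ∘ ascV (strings_obj s') (letter_obj a) (W_factor n)
         ∘ (idm (strings_obj s') ⊠ cup a (coloring hm n)) ∘ runV (strings_obj s'))
  | [::] => fun _ => @BottomReading n.+1 [::] 0
  end.

Fixpoint read_bottom (closes : nat -> bool) (n : nat) : bottom_reading n :=
  if n is n'.+1 then
    let: existT s g := read_bottom closes n' in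
    if closes n' then bottom_close g
    else @BottomReading n'.+1 (coloring hm n' :: s) (g ⊠ idm (W_factor n'))
  else @BottomReading 0 [::] (idm 𝟙).

Definition closes_top n (d : pairing n) (i : nat) : bool :=
  [exists k : 'I_n, exists l : 'I_n,
     [&& k < l, val l == i & d (inl l) == inl k]%N].

Definition closes_bottom n (d : pairing n) (i : nat) : bool :=
  [exists k : 'I_n, exists l : 'I_n,
     [&& k < l, val l == i & d (inr l) == inr k]%N].

(* For a diagram d both rows leave the same sequence of through strings, so that
   the last case does not occur. *)
Definition read n (d : pairing n) :
    hom (tprod W_factor n) (tprod W_factor n) :=
  let: existT s f := read_top (closes_top d) n in
  let: existT s' g := read_bottom (closes_bottom d) n in
  match s =P s' with
  | ReflectT e => g ∘ ecast s' (hom (tprod W_factor n) (strings_obj s')) e f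
  | ReflectF _ => 0
  end.

Definition phi n (a : diag_tower hm delta n) : end_tower W_factor n :=
  \sum_(x : diagram hm n) a x *: read (val x).

(* X = X_1 ⊗ ... ⊗ X_m and X^* = X_m^* ⊗ ... ⊗ X_1^*. *)
Definition genX : C := tprod (fun i => letter_obj (block_letter hm false i)) m.
Definition genX' : C := tprod (fun i => letter_obj (block_letter hm true i)) m.

Definition P_factor (k : nat) : C := if odd k then genX' else genX.

Lemma W_block k :
  tprod (fun i => W_factor (i + k * m)%N) m = P_factor k.
Proof.
rewrite /P_factor /genX /genX'.
case: (odd k) (@coloring_block m hm k) => Wk; apply: eq_tprod => i lt_im.
all: by rewrite /W_factor Wk.
Qed.

(* phi on FC_k = A_(km), with W_(km) rebracketed as X ⊗ X^* ⊗ X ⊗ ... *)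
Definition FC_phi k (a : FC_tower hm delta k) : end_tower P_factor k :=
  let c := tprod_block W_block k in
  fwd c ∘ phi (a : diag_tower hm delta (k * m)%N) ∘ bwd c.

End Reading.

(* Main.v *)
Require Import Defs.
From HB Require Import structures.
From mathcomp Require Import all_boot all_order all_algebra.
From mathcomp Require Import boolp reals.
From mathcomp Require Import complex zify.
Require Import Defs.

(* Reading a bent diagram (target row folded to the right of the source row)
   from right to left with a stack of pending arcs turns it into a morphism
   from a word of letters to the unit. Such readings are indexed by the boolean
   sequences telling right ends of arcs from left ends.

   Basis: for each word v let P_v be the leading simple summand of the tensor
   product of v. Since P_v ⊗ X_a is P_(va), plus P_(v-) when the last letter of v
   has the color of a, transposing the last letter of s shows by induction on s
   that the half diagrams from s to v, composed with the projection onto P_v,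
   form a basis of Hom(s, P_v): the system is triangular. For v empty this is
   the bijectivity of phi on bent diagrams.

   Product: stacking means plugging cups into the juxtaposition of two bent
   diagrams. A non-crossing matching has an arc joining two neighbours, so the
   effect of one cup follows by induction from the zigzag and loop identities.
   All rows are handled through the functors [- ⊗ a], which form a strict
   setting where the associativity constraints disappear. *)

Set Implicit Arguments.
Unset Strict Implicit.
Unset Printing Implicit Defensive.

Import GRing.Theory.
Local Open Scope ring_scope.
Local Open Scope quotient_scope.
Local Open Scope cat_scope.

(** The triangular system is invertible because of one scalar. Transposing the last letter turns a
    string left open into a cup, which maps [P v] into [P (a :: v) ⊗ L (flip a)]. The leading
    summand of that object belongs to a word longer than [v] by two letters and receives nothing
    from [P v], so the cup is a multiple of the inclusion of the other summand, and the multiple is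
    non-zero because transposition is injective. Fusion and Schur's lemma thus replace explicit
    Jones-Wenzl projections. Transposition lengthens the target, hence the induction over all [v]. A
    diagram only respects colors, while caps and cups need opposite letters. Bent rows are
    alternating words, in which the star of a letter is the parity of the earlier occurrences of its
    color; neighbours of equal color are then opposite, and alternation survives the removal of such
    a pair. Diagrams are defined by ranks and stacking by connectivity, but the inductions remove
    one arc at a time; translating between these descriptions is the combinatorial bulk of the
    proof. *)

Lemma addr_idem_eq0 (V : zmodType) (x : V) : x = x + x -> x = 0.
Proof. by move=> xx; apply: (addrI x); rewrite addr0 -xx. Qed.

(** * Bilinearity and coherence in tensor categories *)

Section LinearCategory.
Variables (K : fieldType) (C : linear_category K).
Implicit Types x y z w u : C.

Lemma compE2 x y z w (f : hom z w) (g : hom y z) (h : hom x y) (k : hom x z) :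
  g ∘ h = k -> f ∘ g ∘ h = f ∘ k.
Proof. by rewrite -compA => ->. Qed.

Lemma compE3 x y z w u (f : hom w u) (g : hom z w) (h : hom y z) (k : hom x y)
    (l : hom x w) :
  g ∘ h ∘ k = l -> f ∘ g ∘ h ∘ k = f ∘ l.
Proof. by move=> <-; rewrite !compA. Qed.

Lemma compDl x y z (f : hom x y) (g h : hom y z) :
  (g + h) ∘ f = g ∘ f + h ∘ f.
Proof. by have:= comp_linearl f 1 g h; rewrite !scale1r. Qed.

Lemma compDr x y z (f : hom y z) (g h : hom x y) :
  f ∘ (g + h) = f ∘ g + f ∘ h.
Proof. by have:= comp_linearr f 1 g h; rewrite !scale1r. Qed.

Lemma comp0m x y z (f : hom x y) : (0 : hom y z) ∘ f = 0.
Proof. by apply: addr_idem_eq0; have := compDl f (0 : hom y z) 0; rewrite addr0. Qed.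

Lemma compm0 x y z (f : hom y z) : f ∘ (0 : hom x y) = 0.
Proof. by apply: addr_idem_eq0; have := compDr f (0 : hom x y) 0; rewrite addr0. Qed.

Lemma compZl x y z (f : hom x y) (a : K) (g : hom y z) :
  (a *: g) ∘ f = a *: (g ∘ f).
Proof. by have:= comp_linearl f a g 0; rewrite comp0m !addr0. Qed.

Lemma compZr x y z (f : hom y z) (a : K) (g : hom x y) :
  f ∘ (a *: g) = a *: (f ∘ g).
Proof. by have:= comp_linearr f a g 0; rewrite compm0 !addr0. Qed.

Lemma comp_suml x y z (f : hom x y) I (r : seq I) (P : pred I) (F : I -> hom y z) :
  (\sum_(i <- r | P i) F i) ∘ f = \sum_(i <- r | P i) (F i ∘ f).
Proof.
by elim/big_ind2: _ => [|g1 h1 g2 h2 <- <-|//]; rewrite ?comp0m ?compDl.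
Qed.

Lemma comp_sumr x y z (f : hom y z) I (r : seq I) (P : pred I) (F : I -> hom x y) :
  f ∘ (\sum_(i <- r | P i) F i) = \sum_(i <- r | P i) (f ∘ F i).
Proof.
by elim/big_ind2: _ => [|g1 h1 g2 h2 <- <-|//]; rewrite ?compm0 ?compDr.
Qed.

End LinearCategory.

Section TensorCategory.
Variables (K : fieldType) (C : tensor_category K).
Implicit Types x y z w : C.

Lemma tmorDl x y x' y' (f : hom x' y') (g h : hom x y) :
  (g + h) ⊠ f = g ⊠ f + h ⊠ f.
Proof. by have:= tmor_linearl f 1 g h; rewrite !scale1r. Qed.

Lemma tmorDr x y x' y' (f : hom x y) (g h : hom x' y') :
  f ⊠ (g + h) = f ⊠ g + f ⊠ h.
Proof. by have:= tmor_linearr f 1 g h; rewrite !scale1r. Qed.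

Lemma tmor0m x y x' y' (f : hom x' y') : (0 : hom x y) ⊠ f = 0.
Proof. by apply: addr_idem_eq0; have := tmorDl f (0 : hom x y) 0; rewrite addr0. Qed.

Lemma tmorm0 x y x' y' (f : hom x y) : f ⊠ (0 : hom x' y') = 0.
Proof. by apply: addr_idem_eq0; have := tmorDr f (0 : hom x' y') 0; rewrite addr0. Qed.

Lemma tmorZl x y x' y' (f : hom x' y') (a : K) (g : hom x y) :
  (a *: g) ⊠ f = a *: (g ⊠ f).
Proof. by have:= tmor_linearl f a g 0; rewrite tmor0m !addr0. Qed.

Lemma tmorZr x y x' y' (f : hom x y) (a : K) (g : hom x' y') :
  f ⊠ (a *: g) = a *: (f ⊠ g).
Proof. by have:= tmor_linearr f a g 0; rewrite tmorm0 !addr0. Qed.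

Lemma tmor_suml x y x' y' (f : hom x' y') I (r : seq I) (P : pred I)
    (F : I -> hom x y) :
  (\sum_(i <- r | P i) F i) ⊠ f = \sum_(i <- r | P i) (F i ⊠ f).
Proof.
by elim/big_ind2: _ => [|g1 h1 g2 h2 <- <-|//]; rewrite ?tmor0m ?tmorDl.
Qed.

Lemma whisk_comp x y z w (f : hom y z) (g : hom x y) :
  (f ∘ g) ⊠ idm w = (f ⊠ idm w) ∘ (g ⊠ idm w).
Proof. by rewrite -tmor_comp comp1m. Qed.

Lemma lwhisk_comp x y z w (f : hom y z) (g : hom x y) :
  idm w ⊠ (f ∘ g) = (idm w ⊠ f) ∘ (idm w ⊠ g).
Proof. by rewrite -tmor_comp comp1m. Qed.

Lemma exchange x y x' y' (f : hom x y) (g : hom x' y') :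
  (f ⊠ idm y') ∘ (idm x ⊠ g) = (idm y ⊠ g) ∘ (f ⊠ idm x').
Proof. by rewrite -!tmor_comp !comp1m !compm1. Qed.

Lemma ascV_natural x y x' y' x'' y'' (f : hom x y) (f' : hom x' y')
    (f'' : hom x'' y'') :
  ascV _ _ _ ∘ (f ⊠ (f' ⊠ f'')) = ((f ⊠ f') ⊠ f'') ∘ ascV _ _ _.
Proof.
by rewrite -[LHS]compm1 -(ascVK x) !compA (compE2 _ (esym (asc_natural f f' f'')))
  !compA ascK comp1m.
Qed.

Lemma runV_natural x y (f : hom x y) : (f ⊠ idm 𝟙) ∘ runV x = runV y ∘ f.
Proof.
by rewrite -[LHS]comp1m -(runK y) !compA (compE2 _ (run_natural f)) !compA
  (compE2 _ (runVK x)) compm1.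
Qed.

Lemma lwhisk1_inj x y : injective (fun f : hom x y => idm 𝟙 ⊠ f).
Proof.
move=> f g fg; have E (h : hom x y) : h = lun y ∘ (idm 𝟙 ⊠ h) ∘ lunV x.
  by rewrite lun_natural (compE2 _ (lunVK x)) compm1.
by rewrite (E f) (E g) fg.
Qed.

Lemma whisk1_inj x y : injective (fun f : hom x y => f ⊠ idm 𝟙).
Proof.
move=> f g fg; have E (h : hom x y) : h = run y ∘ (h ⊠ idm 𝟙) ∘ runV x.
  by rewrite run_natural (compE2 _ (runVK x)) compm1.
by rewrite (E f) (E g) fg.
Qed.

(** Kelly's argument: tensoring with [𝟙] on the right is faithful, and after it the identity follows
    from the pentagon, the triangle and naturality. *)
Lemma run_tensor x y : run (x ⊗ y) = (idm x ⊠ run y) ∘ asc x y 𝟙.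
Proof.
apply: whisk1_inj; set z : C := 𝟙.
rewrite -[LHS]comp1m -[RHS]comp1m -(ascK x y z) -!compA; congr (_ ∘ _).
rewrite whisk_comp !compA asc_natural -triangle -(tmor1 x y) !compA asc_natural.
rewrite (compE2 _ (pentagon x y z z)) !compA -[in RHS]triangle lwhisk_comp.
by rewrite -!compA.
Qed.

Lemma runV_tensor x y : runV (x ⊗ y) = ascV x y 𝟙 ∘ (idm x ⊠ runV y).
Proof.
rewrite -[RHS]comp1m -(runK (x ⊗ y)) run_tensor !compA (compE2 _ (ascVK x y 𝟙)).
by rewrite compm1 (compE2 _ (esym (lwhisk_comp _ _ _))) runVK tmor1 compm1.
Qed.

Lemma triangleV x y : asc x 𝟙 y ∘ (runV x ⊠ idm y) = idm x ⊠ lunV y.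
Proof.
rewrite -[LHS]comp1m -(tmor1 x) -(lunK y) lwhisk_comp -!compA.
by rewrite [(idm x ⊠ lun y) ∘ _]compA triangle -whisk_comp runVK tmor1 compm1.
Qed.

Lemma triangleV' x y : (run x ⊠ idm y) ∘ ascV x 𝟙 y = idm x ⊠ lun y.
Proof. by rewrite -triangle (compE2 _ (ascVK x 𝟙 y)) compm1. Qed.

Lemma pentagonV x y z w :
  (asc x y z ⊠ idm w) ∘ ascV (x ⊗ y) z w ∘ ascV x y (z ⊗ w) =
  ascV x (y ⊗ z) w ∘ (idm x ⊠ ascV y z w).
Proof.
set F := _ ∘ (idm x ⊠ _).
have FK : F ∘ (idm x ⊠ asc y z w) ∘ asc x (y ⊗ z) w = idm _.
  by rewrite (compE2 _ (esym (lwhisk_comp _ _ _))) ascK tmor1 compm1 ascK.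
rewrite -[LHS]comp1m -FK !compA -3!(compA F) compA -pentagon !compA.
by rewrite (compE2 _ (ascVK _ _ _)) compm1 (compE2 _ (ascVK _ _ _)) compm1.
Qed.

Lemma pentagonV' x y z w :
  asc x y (z ⊗ w) ∘ asc (x ⊗ y) z w ∘ (ascV x y z ⊠ idm w) =
  (idm x ⊠ asc y z w) ∘ asc x (y ⊗ z) w.
Proof.
by rewrite pentagon (compE2 _ (esym (whisk_comp _ _ _))) ascVK tmor1 compm1.
Qed.

(** * Duality, as an adjunction between the functors [- ⊗ a] and [- ⊗ b] *)

Section CapCup.
Variables (a b : C).

(** Whiskered by [Z], the pairing becomes a transformation from [[- ⊗ a ⊗ b]] to the identity
    functor, natural in [Z]. The lock keeps the associator out of sight. *)
Definition capZ (Z : C) (ev : hom (a ⊗ b) 𝟙) : hom ((Z ⊗ a) ⊗ b) Z :=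
  locked (run Z ∘ (idm Z ⊠ ev) ∘ asc Z a b).

Definition cupZ (Z : C) (coev : hom 𝟙 (a ⊗ b)) : hom Z ((Z ⊗ a) ⊗ b) :=
  locked (ascV Z a b ∘ (idm Z ⊠ coev) ∘ runV Z).

Lemma capZ_natural x y (f : hom x y) ev :
  capZ y ev ∘ ((f ⊠ idm a) ⊠ idm b) = f ∘ capZ x ev.
Proof.
rewrite /capZ -!lock (compE2 _ (asc_natural _ _ _)) tmor1 !compA.
by rewrite (compE2 _ (esym (exchange _ _))) !compA run_natural.
Qed.

Lemma cupZ_natural x y (f : hom x y) coev :
  ((f ⊠ idm a) ⊠ idm b) ∘ cupZ x coev = cupZ y coev ∘ f.
Proof.
rewrite /cupZ -!lock !compA -ascV_natural tmor1 (compE2 _ (exchange _ _)) !compA.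
by rewrite (compE2 _ (runV_natural f)) !compA.
Qed.

Lemma cap_cup_loop Z ev coev (c : K) :
  ev ∘ coev = c *: idm 𝟙 -> capZ Z ev ∘ cupZ Z coev = c *: idm Z.
Proof.
move=> evc; rewrite /capZ /cupZ -!lock !compA (compE2 _ (ascVK _ _ _)) compm1.
rewrite (compE2 _ (esym (lwhisk_comp _ _ _))) evc tmorZr tmor1 compZr compm1.
by rewrite compZl runVK.
Qed.

End CapCup.

(* The composite is whiskered by [Z], hence independent of it: this is what
   makes the associators disappear from all later computations. *)
Lemma hook_left a b Z (ev : hom (a ⊗ b) 𝟙) (coev : hom 𝟙 (b ⊗ a)) :
  (capZ Z ev ⊠ idm a) ∘ cupZ (Z ⊗ a) coev =
  idm Z ⊠ (lun a ∘ (ev ⊠ idm a) ∘ ascV a b a ∘ (idm a ⊠ coev) ∘ runV a).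
Proof.
rewrite /capZ /cupZ -!lock runV_tensor !whisk_comp !compA -(tmor1 Z a).
rewrite (compE2 _ (esym (ascV_natural _ _ _))) !compA.
rewrite (compE3 _ (pentagonV _ _ _ _)) !compA.
rewrite (compE2 _ (esym (ascV_natural _ _ _))) !compA.
by rewrite triangleV' -!lwhisk_comp.
Qed.

Lemma hook_right a b Z (ev : hom (a ⊗ b) 𝟙) (coev : hom 𝟙 (b ⊗ a)) :
  capZ (Z ⊗ b) ev ∘ (cupZ Z coev ⊠ idm b) =
  idm Z ⊠ (run b ∘ (idm b ⊠ ev) ∘ asc b a b ∘ (coev ⊠ idm b) ∘ lunV b).
Proof.
rewrite /capZ /cupZ -!lock run_tensor !whisk_comp !compA -(tmor1 Z b).
rewrite (compE2 _ (asc_natural _ _ _)) !compA.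
rewrite (compE3 _ (pentagonV' _ _ _ _)) !compA.
rewrite (compE2 _ (asc_natural _ _ _)) !compA.
by rewrite (compE2 _ (triangleV _ _)) -!lwhisk_comp.
Qed.

End TensorCategory.

(** * Words of letters and codes of half diagrams *)

Section Words.
Variable m : nat.
Implicit Types (a b : letter m) (s v : seq (letter m)).

Definition flip a : letter m := (a.1, ~~ a.2).

Arguments flip : simpl never.

Definition opp a b := (a.1 == b.1) && (a.2 != b.2).

Lemma flipK : involutive flip.
Proof. by move=> [j s]; rewrite /flip /= negbK. Qed.

Lemma opp_flipr a : opp a (flip a).
Proof. by rewrite /opp eqxx /=; case: a.2. Qed.

Lemma opp_flipl a : opp (flip a) a.
Proof. by rewrite /opp eqxx /=; case: a.2. Qed.

Definition parity (j : 'I_m) s : bool := odd (count (fun a => a.1 == j) s).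

(** Heads are rightmost letters, so the star of [a] is the parity of the occurrences of its color to
    its left. Equal colors and equal parities then give equal letters. *)
Fixpoint alternating s : bool :=
  if s is a :: s' then (a.2 == parity a.1 s') && alternating s' else true.

Lemma parity_cons j a s : parity j (a :: s) = (a.1 == j) (+) parity j s.
Proof. by rewrite /parity /= oddD; case: (_ == _). Qed.

Lemma parity_cat j s v : parity j (s ++ v) = parity j s (+) parity j v.
Proof. by rewrite /parity count_cat oddD. Qed.

(* A half diagram from the word s to the word v is coded by the sequence of
   booleans telling which points of s are right ends of arcs; the heads of s
   and v are their rightmost letters. *)
Fixpoint half_codes s v : seq (seq bool) :=
  if s is a :: s' then
    [seq true :: c | c <- half_codes s' (flip a :: v)] ++
    (if v is b :: v' then
       if b == a then [seq false :: c | c <- half_codes s' v'] else [::]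
     else [::])
  else if v is [::] then [:: [::]] else [::].

Lemma half_codes_uniq s v : uniq (half_codes s v).
Proof.
elim: s v => [|a s IHs] [|b v] //=; first by rewrite cats0 map_inj_uniq // => c c' [].
have inj d : injective (cons d : seq bool -> seq bool) by move=> c c' [].
rewrite cat_uniq map_inj_uniq // IHs /=; case: ifP => _; rewrite ?andbT //.
rewrite map_inj_uniq // IHs andbT; apply/hasPn => _ /mapP[c _ ->].
by apply/negP => /mapP[].
Qed.

Lemma mem_half_codes_true a s v c :
  (true :: c \in half_codes (a :: s) v) = (c \in half_codes s (flip a :: v)).
Proof.
rewrite /= mem_cat mem_map; last by move=> ? ? [].
case: v => [|b v]; first by rewrite in_nil orbF.
case: ifP => _; rewrite ?in_nil ?orbF //; set A := _ \in map _ _.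
by have -> : A = false; [apply/negbTE/mapP => -[] | rewrite orbF].
Qed.

Lemma mem_half_codes_false a s v c :
  (false :: c \in half_codes (a :: s) v) =
  (ohead v == Some a) && (c \in half_codes s (behead v)).
Proof.
rewrite /= mem_cat; set A := _ \in map _ _; have -> : A = false.
  by apply/negbTE/mapP => -[].
case: v {A} => [|b v] //=; rewrite (inj_eq (@Some_inj _)).
by case: ifP => // _; rewrite mem_map // => ? ? [].
Qed.

Lemma half_codes_nil s v : [::] \in half_codes s v -> s = [::] /\ v = [::].
Proof.
case: s v => [|a s] [|b v] //=; rewrite ?cats0 ?mem_cat; first by move/mapP=> -[].
by case: ifP => _; case/orP => // /mapP[].
Qed.

End Words.

Arguments cap : simpl never.
Arguments cup : simpl never.
Arguments letter_obj : simpl never.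

(** * Zigzags, transposition and half diagrams *)

Section Letters.
Variables (K : fieldType) (C : tensor_category K) (m : nat) (delta : 'I_m -> K).
Variables (X : 'I_m -> C).
Variable X' : forall j, dual_data (X j) (delta j).
Implicit Types (a b : letter m) (s v w : seq (letter m)) (x y Y Z : C).
Local Notation L := (letter_obj X').
Local Notation capL Z a b := (capZ Z (cap X' a b)).
Local Notation cupL Z a b := (cupZ Z (cup X' a b)).

Lemma zigzag_left Z a b : opp a b ->
  (capL Z a b ⊠ idm (L a)) ∘ cupL (Z ⊗ L a) b a = idm (Z ⊗ L a).
Proof.
case: a b => [j s] [k s']; move=> /andP[/= /eqP jk ss'].
subst k; rewrite -tmor1 hook_left.
congr (_ ⊠ _); rewrite /cap /cup.
case: eqP => // e; rewrite (eq_axiomK e) /=.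
case: s s' ss' => [] [] //= _.
  by case: (dual_hooks' (X' j)).
by case: (dual_hooks (X' j)).
Qed.

Lemma zigzag_right Z a b : opp a b ->
  capL (Z ⊗ L b) a b ∘ (cupL Z b a ⊠ idm (L b)) = idm (Z ⊗ L b).
Proof.
case: a b => [j s] [k s']; move=> /andP[/= /eqP jk ss'].
subst k; rewrite -tmor1 hook_right.
congr (_ ⊠ _); rewrite /cap /cup.
case: eqP => // e; rewrite (eq_axiomK e) /=.
case: s s' ss' => [] [] //= _.
  by case: (dual_hooks' (X' j)).
by case: (dual_hooks (X' j)).
Qed.

Lemma loopL Z a b : opp a b -> capL Z a b ∘ cupL Z a b = delta a.1 *: idm Z.
Proof.
move=> ab; apply: cap_cup_loop; case: a b ab => [j s] [k s'].
move=> /andP[/= /eqP jk ss']; subst k; rewrite /cap /cup.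
case: eqP => // e; rewrite (eq_axiomK e) /=.
case: s s' ss' => [] [] //= _; [exact: dual_loop' | exact: dual_loop].
Qed.

Definition transpose Z Y a (f : hom (Z ⊗ L a) Y) : hom Z (Y ⊗ L (flip a)) :=
  (f ⊠ idm _) ∘ cupL Z a (flip a).

Lemma transpose_inj Z Y a : injective (@transpose Z Y a).
Proof.
move=> f g; rewrite /transpose => fg.
suff E (h : hom (Z ⊗ L a) Y) :
    h = capL Y (flip a) a ∘ (((h ⊠ idm _) ∘ cupL Z a (flip a)) ⊠ idm (L a)).
  by rewrite (E f) fg -E.
rewrite whisk_comp !compA capZ_natural (compE2 _ (zigzag_right _ (opp_flipl a))).
by rewrite compm1.
Qed.

Lemma transposeD Z Y a (f g : hom (Z ⊗ L a) Y) :
  transpose (f + g) = transpose f + transpose g.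
Proof. by rewrite /transpose tmorDl compDl. Qed.

Lemma transposeZ Z Y a c (f : hom (Z ⊗ L a) Y) :
  transpose (c *: f) = c *: transpose f.
Proof. by rewrite /transpose tmorZl compZl. Qed.

Lemma transpose_sum Z Y a I (r : seq I) (F : I -> hom (Z ⊗ L a) Y) :
  transpose (\sum_(i <- r) F i) = \sum_(i <- r) transpose (F i).
Proof. by rewrite /transpose tmor_suml comp_suml. Qed.

Section Row.
Variable Z : C.
Fixpoint row s : C := if s is a :: s' then row s' ⊗ L a else Z.
End Row.

Fixpoint row_map Z Y (f : hom Z Y) s : hom (row Z s) (row Y s) :=
  if s is a :: s' then row_map f s' ⊠ idm (L a) else f.

(** Total in both letters, with value 0 when they differ, so that [half_diagram] is defined for
    every code, valid or not. *)
Definition open_string x a b y (f : hom x y) : hom (x ⊗ L a) (y ⊗ L b) :=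
  match a =P b with
  | ReflectT e =>
    match e in _ = c return hom (x ⊗ L a) (y ⊗ L c) with
    | erefl => f ⊠ idm (L a)
    end
  | ReflectF _ => 0
  end.

Lemma open_stringE x a y (f : hom x y) : open_string a a f = f ⊠ idm (L a).
Proof. by rewrite /open_string; case: eqP => // e; rewrite (eq_axiomK e). Qed.

Lemma open_string_neq x a b y (f : hom x y) : a != b -> open_string a b f = 0.
Proof. by rewrite /open_string; case: eqP. Qed.

(** The target [v] is the stack of the reading: a right end [a] pushes the letter [flip a] awaited
    further to the left. The boolean [false] pops the stack and covers both left ends and through
    strings, which are not told apart here. *)
Fixpoint half_diagram s (c : seq bool) v : hom (row 𝟙 s) (row 𝟙 v) :=
  match s, v return hom (row 𝟙 s) (row 𝟙 v) with
  | [::], [::] => idm 𝟙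
  | [::], _ => 0
  | a :: s', v =>
    if head false c then
      capL (row 𝟙 v) (flip a) a ∘ (half_diagram s' (behead c) (flip a :: v) ⊠ idm _)
    else
      match v return hom (row 𝟙 (a :: s')) (row 𝟙 v) with
      | b :: v' => open_string a b (half_diagram s' (behead c) v')
      | [::] => 0
      end
  end.

(** * Half diagrams composed with simple quotients are bases *)

Section Basis.
Variables (P : seq (letter m) -> C) (theta : forall v a, hom (P v ⊗ L a) (P (a :: v))).
Variable p0 : iso 𝟙 (P [::]).
Hypothesis P_simple : forall v, simple (P v).
Hypothesis P_zero : forall v w, size v != size w -> forall f : hom (P v) (P w), f = 0.

Definition fusion_same v a v' : Prop :=
  exists (i1 : hom (P (a :: v)) (P v ⊗ L a)) (kappa : hom (P v ⊗ L a) (P v'))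
    (i2 : hom (P v') (P v ⊗ L a)),
  [/\ theta v a ∘ i1 = idm _, kappa ∘ i2 = idm _, theta v a ∘ i2 = 0,
      kappa ∘ i1 = 0 & i1 ∘ theta v a + i2 ∘ kappa = idm _].

Definition fusion_other v a : Prop :=
  exists i1, theta v a ∘ i1 = idm _ /\ i1 ∘ theta v a = idm _.

Hypothesis fusion : forall v a,
  if v is b :: v' then
    if b.1 == a.1 then fusion_same v a v' else fusion_other v a
  else fusion_other v a.

Fixpoint proj v : hom (row 𝟙 v) (P v) :=
  if v is a :: v' then theta v' a ∘ (proj v' ⊠ idm (L a)) else fwd p0.

Lemma theta_neq0 v a : theta v a != 0.
Proof.
have [i1 thi] : exists i1, theta v a ∘ i1 = idm _.
  have := fusion v a; case: v => [|b v]; first by case=> i1 [? _]; exists i1.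
  by case: ifP => _ [i1]; [case=> ? [? [? _ _ _ _]] | case=> ? _]; exists i1.
apply/eqP => th0; case: (P_simple (a :: v)) => /eqP[].
by rewrite -thi th0 comp0m.
Qed.

Local Notation hd s c v := (proj v ∘ half_diagram s c v).

Lemma transpose_close a s c v :
  transpose (Z := row 𝟙 s) (hd (a :: s) (true :: c) v) =
  (proj v ⊠ idm _) ∘ half_diagram s c (flip a :: v).
Proof.
rewrite /transpose /= !compA !whisk_comp. rewrite (compE2 _ (cupZ_natural _ _)) !compA.
rewrite (compE2 _ (zigzag_left _ (opp_flipl a))).
by rewrite compm1.
Qed.

Definition theta_cup v a : hom (P v) (P (a :: v) ⊗ L (flip a)) :=
  transpose (theta v a).

Lemma transpose_open a s c v :
  transpose (Z := row 𝟙 s) (hd (a :: s) (false :: c) (a :: v)) = theta_cup v a ∘ hd s c v.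
Proof.
rewrite /theta_cup /transpose /= open_stringE.
have -> : theta v a ∘ (proj v ⊠ idm (L a)) ∘ (half_diagram s c v ⊠ idm (L a)) =
  theta v a ∘ (hd s c v ⊠ idm (L a)) by rewrite -compA -whisk_comp.
by rewrite whisk_comp (compE2 _ (cupZ_natural _ _)) compA.
Qed.

(** The two words differ in length by two. This vanishing is the zero block of the triangular
    system. *)
Lemma theta_theta_cup v a : theta (a :: v) (flip a) ∘ theta_cup v a = 0.
Proof. by apply: P_zero; rewrite /= neq_ltn ltnS leqnSn. Qed.

(** After transposition of the last letter [a] of the source, the target is [P v ⊗ L (flip a)]. Its
    leading component turns the codes closing an arc at [a] into the basis for [flip a :: v] and
    kills the codes leaving [a] open. The latter exist only if [v] ends in [a], and the other
    component turns them into [lam] times the basis for [v] without that letter. *)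
Lemma half_diagram_basis s v : alternating s -> alternating v ->
    (forall j, parity j s = parity j v) ->
  (forall f, exists x : seq bool -> K,
     f = \sum_(c <- half_codes s v) x c *: hd s c v) /\
  (forall x : seq bool -> K, \sum_(c <- half_codes s v) x c *: hd s c v = 0 ->
     forall c, c \in half_codes s v -> x c = 0).
Proof.
elim: s v => [|a s IHs] v.
  move=> _ _ _; case: v => [|b v] /=; split=> [f|x].
  - have [_ /(_ (f ∘ bwd p0)) [x fx]] := P_simple [::]; exists (fun=> x).
    by rewrite big_seq1 compm1 -[f]compm1 -(fwdK p0) compA fx compZl comp1m.
  - rewrite big_seq1 compm1 => /eqP; rewrite scaler_eq0 => /orP[/eqP x0|/eqP p00].
      by move=> c; rewrite mem_seq1 => /eqP->.
    case: (P_simple [::]) => /eqP[].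
    by rewrite -(bwdK p0) p00 comp0m.
  - exists (fun=> 0); rewrite big_nil -[f]compm1 -(fwdK p0) compA.
    by rewrite (P_zero _ (f ∘ bwd p0)) ?comp0m.
  - by rewrite big_nil.
case/andP => /eqP a_par alt_s alt_v par.
have par_s j : parity j s = (a.1 == j) (+) parity j v.
  by rewrite -par parity_cons addKb.
have alt_fv : alternating (flip a :: v).
  by rewrite /= alt_v andbT /flip /= a_par par_s eqxx addTb negbK.
have par_fv j : parity j s = parity j (flip a :: v) by rewrite parity_cons par_s.
have [span1 free1] := IHs (flip a :: v) alt_s alt_fv par_fv.
have thE c : theta v (flip a) ∘ transpose (Z := row 𝟙 s) (hd (a :: s) (true :: c) v) =
    hd s c (flip a :: v) by rewrite transpose_close compA.
set V1 := half_codes s (flip a :: v).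
have other (f : hom (row 𝟙 (a :: s)) (P v)) : fusion_other v (flip a) ->
    exists x : seq bool -> K, f = \sum_(c <- V1) x c *: hd (a :: s) (true :: c) v.
  case=> i1 [_ ith]; have [x fx] := span1 (theta v (flip a) ∘ transpose (Z := row 𝟙 s) f).
  exists x; apply: transpose_inj; rewrite -[LHS]comp1m -ith -compA fx.
  rewrite comp_sumr transpose_sum; apply: eq_bigr => c _.
  by rewrite transposeZ compZr -thE compA ith comp1m.
have other_free (x : seq bool -> K) : \sum_(c <- V1) x c *: hd (a :: s) (true :: c) v = 0 ->
    forall c, c \in V1 -> x c = 0.
  move=> sum0; apply: free1; rewrite -[RHS](compm0 _ (theta v (flip a))).
  transitivity (theta v (flip a) ∘
    transpose (Z := row 𝟙 s) (0 : hom (row 𝟙 (a :: s)) (P v))).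
    rewrite -sum0 transpose_sum comp_sumr; apply: eq_bigr => c _.
    by rewrite transposeZ compZr thE.
  by rewrite /transpose tmor0m comp0m.
have := fusion v (flip a).
case: v => [|b v] in par alt_v par_s alt_fv par_fv span1 free1 thE V1 other other_free *.
  move=> fo; rewrite /= cats0; split=> [f|x].
    by have [x ->] := other f fo; exists (fun c => x (behead c)); rewrite big_map.
  by rewrite big_map => /other_free x0 _ /mapP[c cV ->]; exact: x0.
rewrite -[(flip a).1]/a.1; case: eqP => [ba fs|ba fo]; last first.
  have ba' : (b == a) = false by apply/eqP => ba'; rewrite ba' in ba.
  rewrite /= ba' cats0; split=> [f|x].
    by have [x ->] := other f fo; exists (fun c => x (behead c)); rewrite big_map.
  by rewrite big_map => /other_free x0 _ /mapP[c cV ->]; exact: x0.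
(* Equal colors force equal letters: both stars are parities of this color, in words where these
   parities agree. *)
have {}ba : b = a.
  rewrite [a]surjective_pairing -ba [b]surjective_pairing; congr (_, _) => /=.
  case/andP: alt_v => /eqP -> _; rewrite a_par par_s parity_cons ba eqxx.
  by rewrite addbA addbb.
move: ba => ba; subst b.
have [||span2 free2] := IHs v alt_s.
- by case/andP: alt_v.
- by move=> j; rewrite par_s parity_cons addbA addbb.
case: fs => i1 [kappa [i2 [thi1 kai2 thi2 kai1 sum1]]].
have [lam lamE] : exists lam, theta_cup v a = lam *: i2.
  have [_ /(_ (kappa ∘ theta_cup v a)) [lam ktc]] := P_simple v.
  exists lam; rewrite -[LHS]comp1m -sum1 compDl -!compA theta_theta_cup compm0.
  by rewrite add0r ktc compZr compm1.
have lam0 : lam != 0.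
  apply: contraNneq (theta_neq0 v a) => lam0; apply/eqP/transpose_inj.
  by rewrite -[transpose _]/(theta_cup v a) lamE lam0 scale0r /transpose tmor0m comp0m.
have opE c : transpose (Z := row 𝟙 s) (hd (a :: s) (false :: c) (a :: v)) =
    lam *: (i2 ∘ hd s c v) by rewrite transpose_open lamE compZl.
rewrite /= eqxx; split=> [f|x].
  (* Back substitution: [x] matches the leading component of [f]; the remainder [f - g] lies in the
     other summand, where [y] matches it up to the factor [lam]. *)
  have [x fx] := span1 (theta (a :: v) (flip a) ∘ transpose (Z := row 𝟙 s) f).
  set g := \sum_(c <- V1) x c *: hd (a :: s) (true :: c) (a :: v).
  have thg : theta (a :: v) (flip a) ∘ transpose (Z := row 𝟙 s) (f - g) = 0.
    rewrite transposeD compDr fx -(scaleN1r g) transposeZ compZr scaleN1r.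
    rewrite transpose_sum comp_sumr; apply/eqP; rewrite subr_eq0; apply/eqP.
    by apply: eq_bigr => c _; rewrite transposeZ compZr thE.
  have [y ky] := span2 (kappa ∘ transpose (Z := row 𝟙 s) (f - g)).
  exists (fun c => if head false c then x (behead c) else lam^-1 * y (behead c)).
  rewrite big_cat !big_map /=; apply/eqP; rewrite addrC -subr_eq; apply/eqP.
  rewrite -/g; apply: transpose_inj.
  rewrite -[LHS]comp1m -sum1 compDl -!compA thg compm0 add0r ky comp_sumr.
  rewrite transpose_sum; apply: eq_bigr => c _.
  by rewrite transposeZ opE compZr scalerA mulrAC mulVf // mul1r.
rewrite big_cat !big_map /= => sum0.
have x1 c : c \in V1 -> x (true :: c) = 0.
  move: c; apply: free1.
  transitivity (theta (a :: v) (flip a) ∘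
    transpose (Z := row 𝟙 s) (0 : hom (row 𝟙 (a :: s)) (P (a :: v)))).
    rewrite -sum0 transposeD compDr !transpose_sum !comp_sumr.
    rewrite [X in _ + X]big1 ?addr0 => [|c _]; last first.
      by rewrite transposeZ opE !compZr compA thi2 comp0m !scaler0.
    by apply: eq_bigr => c _; rewrite transposeZ compZr thE.
  by rewrite /transpose tmor0m comp0m compm0.
have x2 c : c \in half_codes s v -> x (false :: c) = 0.
  move: c; apply: free2; apply: (scalerI lam0); rewrite scaler0.
  transitivity (kappa ∘
    transpose (Z := row 𝟙 s) (0 : hom (row 𝟙 (a :: s)) (P (a :: v)))).
    rewrite -sum0 [X in _ = _ ∘ transpose (X + _)]big_seq.
    rewrite [X in _ = _ ∘ transpose (X + _)]big1 ?add0r => [|c cV]; last first.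
      by rewrite x1 ?scale0r.
    rewrite scaler_sumr transpose_sum comp_sumr; apply: eq_bigr => c _.
    by rewrite transposeZ opE !compZr compA kai2 comp1m !scalerA mulrC.
  by rewrite /transpose tmor0m comp0m compm0.
by move=> c; rewrite mem_cat => /orP[] /mapP[c' c'V ->]; [exact: x1 | exact: x2].
Qed.

End Basis.
End Letters.

(** * Bending, and plugging cups into rows *)

Section Plugging.
Variables (K : fieldType) (C : tensor_category K) (m : nat) (delta : 'I_m -> K).
Variables (X : 'I_m -> C).
Variable X' : forall j, dual_data (X j) (delta j).
Implicit Types (a b : letter m) (s v w : seq (letter m)) (x y Y Z : C).
Local Notation L := (letter_obj X').
Local Notation row := (row X').
Local Notation capL Z a b := (capZ Z (cap X' a b)).
Local Notation cupL Z a b := (cupZ Z (cup X' a b)).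
Local Notation half_diagram := (half_diagram X').

(** * Bending the target of a morphism to its right *)

Fixpoint bend Z Y w : forall s, hom (row Z s) (row Y w) ->
    hom (row Z (catrev (map (@flip m) w) s)) Y :=
  match w with
  | [::] => fun s h => h
  | a :: w' => fun s h =>
      @bend Z Y w' (flip a :: s) (capL (row Y w') a (flip a) ∘ (h ⊠ idm (L (flip a))))
  end.

Fixpoint unbend Z Y w : forall s, hom (row Z (catrev (map (@flip m) w) s)) Y ->
    hom (row Z s) (row Y w) :=
  match w with
  | [::] => fun s g => g
  | a :: w' => fun s g =>
      (@unbend Z Y w' (flip a :: s) g ⊠ idm (L a)) ∘ cupL (row Z s) (flip a) a
  end.

Lemma bendK Z Y w s : cancel (@bend Z Y w s) (@unbend Z Y w s).
Proof.
elim: w s => [|a w IHw] s h //=; rewrite IHw whisk_comp.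
rewrite (compE2 _ (cupZ_natural _ _)) !compA.
by rewrite (zigzag_left X' _ (opp_flipr a)) comp1m.
Qed.

Lemma bendD Z Y w s (f g : hom (row Z s) (row Y w)) :
  bend (f + g) = bend f + bend g.
Proof.
by elim: w s f g => [|a w IHw] s f g //=; rewrite tmorDl compDr IHw.
Qed.

Lemma bendZ Z Y w s c (f : hom (row Z s) (row Y w)) :
  bend (c *: f) = c *: bend f.
Proof.
by elim: w s f => [|a w IHw] s f //=; rewrite tmorZl compZr IHw.
Qed.

Lemma bend0 Z Y w s : bend (0 : hom (row Z s) (row Y w)) = 0.
Proof. by have := bendZ 0 (0 : hom (row Z s) (row Y w)); rewrite !scale0r. Qed.

Lemma bend_sum Z Y w s I (r : seq I) (F : I -> hom (row Z s) (row Y w)) :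
  bend (\sum_(i <- r) F i) = \sum_(i <- r) bend (F i).
Proof. by elim/big_rec2: _ => [|i g f _ <-]; rewrite ?bend0 ?bendD. Qed.

(** * Functionals on rows *)

(* Pairing a morphism with its source word turns equations between morphisms
   whose sources are only provably equal into plain equalities. *)
Definition functional Z Y := {w : seq (letter m) & hom (row Z w) Y}.
Definition Fun Z Y w (f : hom (row Z w) Y) : functional Z Y := existT _ w f.

Lemma Fun_inj Z Y w (f g : hom (row Z w) Y) : Fun f = Fun g -> f = g.
Proof. by move=> e; have := projT2_eq e; rewrite (eq_axiomK (projT1_eq e)). Qed.

Definition post Z Y Y' (g : hom Y Y') (F : functional Z Y) : functional Z Y' :=
  Fun (g ∘ projT2 F).

Definition fscale Z Y (c : K) (F : functional Z Y) : functional Z Y :=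
  Fun (c *: projT2 F).

Definition whisk Z Y b (F : functional Z Y) : functional Z (Y ⊗ L b) :=
  @Fun Z (Y ⊗ L b) (b :: projT1 F) (projT2 F ⊠ idm (L b)).

(** Positions count from the right end of the row. Out of range the word is left alone, in step with
    the identities in [cup_at]. *)
Fixpoint remove2 (i : nat) s {struct s} :=
  match i, s with
  | 0, _ :: _ :: s' => s'
  | i'.+1, a :: s' => a :: remove2 i' s'
  | _, _ => s
  end.

Fixpoint cup_at Z (i : nat) s {struct s} : hom (row Z (remove2 i s)) (row Z s) :=
  match s, i return hom (row Z (remove2 i s)) (row Z s) with
  | b :: s0, 0 =>
    match s0 return hom (row Z (remove2 0 (b :: s0))) (row Z (b :: s0)) with
    | a :: s' => cupL (row Z s') a b
    | [::] => idm _
    end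
  | a :: s', i'.+1 => cup_at Z i' s' ⊠ idm (L a)
  | [::], 0 => idm _
  | [::], _.+1 => idm _
  end.

Fixpoint insert2 (i : nat) a s {struct i} :=
  match i, s with
  | 0, _ => flip a :: a :: s
  | i'.+1, b :: s' => b :: insert2 i' a s'
  | _.+1, [::] => [::]
  end.

Fixpoint cap_at Z (i : nat) a s {struct i} : hom (row Z (insert2 i a s)) (row Z s) :=
  match i, s return hom (row Z (insert2 i a s)) (row Z s) with
  | 0, s => capL (row Z s) a (flip a)
  | i'.+1, b :: s' => cap_at Z i' a s' ⊠ idm (L b)
  | _.+1, [::] => idm _
  end.

Definition plug Z Y i (F : functional Z Y) : functional Z Y :=
  Fun (projT2 F ∘ cup_at Z i (projT1 F)).

Definition unplug Z Y i a (F : functional Z Y) : functional Z Y :=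
  Fun (projT2 F ∘ cap_at Z i a (projT1 F)).

Definition idF Z w : functional Z (row Z w) := Fun (idm (row Z w)).

(** All operations on functionals commute with [post], so their relations need only be checked on
    [idF], where an induction on the position meets no morphism. *)
Lemma FunE Z Y (F : functional Z Y) : F = post (projT2 F) (idF Z (projT1 F)).
Proof. by case: F => w f; rewrite /post /= compm1. Qed.

Lemma plug_post Z Y Y' i (g : hom Y Y') (F : functional Z Y) :
  plug i (post g F) = post g (plug i F).
Proof. by rewrite /plug /post /= compA. Qed.

Lemma unplug_post Z Y Y' i a (g : hom Y Y') (F : functional Z Y) :
  unplug i a (post g F) = post g (unplug i a F).
Proof. by rewrite /unplug /post /= compA. Qed.

Lemma fscale_post Z Y Y' c (g : hom Y Y') (F : functional Z Y) :
  fscale c (post g F) = post g (fscale c F).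
Proof. by rewrite /fscale /post /= compZr. Qed.

Lemma plug_fscale Z Y i c (F : functional Z Y) :
  plug i (fscale c F) = fscale c (plug i F).
Proof. by rewrite /plug /fscale /= compZl. Qed.

Lemma unplug_fscale Z Y i a c (F : functional Z Y) :
  unplug i a (fscale c F) = fscale c (unplug i a F).
Proof. by rewrite /unplug /fscale /= compZl. Qed.

Lemma fscaleA Z Y c d (F : functional Z Y) : fscale c (fscale d F) = fscale (c * d) F.
Proof. by rewrite /fscale /= scalerA. Qed.

Lemma fscale1 Z Y (F : functional Z Y) : fscale 1 F = F.
Proof. by case: F => w f; rewrite /fscale /= scale1r. Qed.

Lemma plug_whisk Z Y i b (F : functional Z Y) :
  plug i.+1 (whisk b F) = whisk b (plug i F).
Proof. by rewrite /plug /whisk /= whisk_comp. Qed.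

Lemma unplug_whisk Z Y i a b (F : functional Z Y) :
  unplug i.+1 a (whisk b F) = whisk b (unplug i a F).
Proof. by rewrite /unplug /whisk /= whisk_comp. Qed.

Lemma fscale_whisk Z Y c b (F : functional Z Y) :
  fscale c (whisk b F) = whisk b (fscale c F).
Proof. by rewrite /fscale /whisk /= tmorZl. Qed.

Lemma whisk_idF Z b w : whisk b (idF Z w) = idF Z (b :: w).
Proof. by rewrite /whisk /idF /= tmor1. Qed.

(** As for the relations that follow, position 0 is an identity between caps and cups, and [whisk]
    shifts positions by one. *)
Lemma plug_loop Z Y i a (F : functional Z Y) : (i <= size (projT1 F))%N ->
  plug i (unplug i a F) = fscale (delta a.1) F.
Proof.
case: F => w f; rewrite (FunE (existT _ w f)).
rewrite unplug_post plug_post fscale_post => /= le_i; congr post.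
elim: i w {f} le_i => [|i IHi] [|b w] // le_i.
- by rewrite /plug /unplug /fscale /idF /= comp1m (loopL X' _ (opp_flipr a)).
- by rewrite /plug /unplug /fscale /idF /= comp1m (loopL X' _ (opp_flipr a)).
by rewrite -whisk_idF unplug_whisk plug_whisk IHi // fscale_whisk.
Qed.

Lemma plug_zigzag_right Z Y i a (F : functional Z Y) :
  ohead (drop i (projT1 F)) = Some a -> plug i (unplug i.+1 a F) = F.
Proof.
case: F => w f; rewrite (FunE (existT _ w f)) unplug_post plug_post /= => nth_i; congr post.
elim: i w {f} nth_i => [|i IHi] [|b w] //.
  rewrite drop0 /= => -[->]; rewrite /plug /unplug /idF /= comp1m.
  by rewrite (zigzag_left X' _ (opp_flipr a)).
by rewrite /= => w_i; rewrite -whisk_idF unplug_whisk plug_whisk IHi.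
Qed.

Lemma plug_zigzag_left Z Y i a (F : functional Z Y) :
  ohead (drop i (projT1 F)) = Some (flip a) -> plug i.+1 (unplug i a F) = F.
Proof.
case: F => w f; rewrite (FunE (existT _ w f)) unplug_post plug_post /= => nth_i; congr post.
elim: i w {f} nth_i => [|i IHi] [|b w] //.
  rewrite drop0 /= => -[->]; rewrite /plug /unplug /idF /= comp1m.
  by rewrite (zigzag_right X' _ (opp_flipr a)).
by rewrite /= => w_i; rewrite -whisk_idF unplug_whisk plug_whisk IHi.
Qed.

Lemma plug_unplug_left Z Y i j a (F : functional Z Y) : (j <= i)%N ->
  plug i.+2 (unplug j a F) = unplug j a (plug i F).
Proof.
case: F => w f; rewrite (FunE (existT _ w f)).
rewrite !(unplug_post, plug_post) => /= le_ji; congr post.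
elim: j i w {f} le_ji => [|j IHj] i w.
  by move=> _; rewrite /plug /unplug /idF /= !comp1m capZ_natural.
case: i w => [|i] [|b w] // le_ji.
by rewrite -whisk_idF !(unplug_whisk, plug_whisk) IHj.
Qed.

Lemma plug_unplug_right Z Y i j a (F : functional Z Y) : (i <= j)%N ->
  (j.+2 <= size (projT1 F))%N ->
  plug i (unplug j.+2 a F) = unplug j a (plug i F).
Proof.
case: F => w f; rewrite (FunE (existT _ w f)).
rewrite !(unplug_post, plug_post) => /= le_ij j_w; congr post.
elim: i j w {f} le_ij j_w => [|i IHi] j [|b w] //.
  case: w => [|b' w] // _ _.
  by rewrite /plug /unplug /idF /= !comp1m cupZ_natural.
case: j => // j le_ij j_w.
by rewrite -whisk_idF !(unplug_whisk, plug_whisk) IHi.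
Qed.

(** The cups are nested: the innermost pair sits at position [i + n'] and goes first, which makes
    the ends of the next pair adjacent. *)
Fixpoint plugs Z Y i n (F : functional Z Y) : functional Z Y :=
  if n is n'.+1 then plugs i n' (plug (i + n') F) else F.

Lemma plugsS Z Y i n (F : functional Z Y) :
  plugs i n.+1 F = plug i (plugs i.+1 n F).
Proof.
by elim: n F => [|n IHn] F; rewrite /= ?addn0 // -addSnnS -IHn /=.
Qed.

Lemma plugs_whisk Z Y i n b (F : functional Z Y) :
  plugs i.+1 n (whisk b F) = whisk b (plugs i n F).
Proof. by elim: n F => //= n IHn F; rewrite addSn plug_whisk IHn. Qed.

Definition fbend Z Y w (F : functional Z (row Y w)) : functional Z Y :=
  Fun (bend (projT2 F)).

Lemma plug_fbend Z Y w i (F : functional Z (row Y w)) :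
  plug (size w + i) (fbend F) = fbend (plug i F).
Proof.
elim: w i F => [|a w IHw] i F //=.
pose G := post (capL (row Y w) a (flip a)) (whisk (flip a) F).
by have := IHw i.+1 G; rewrite addnS addSn /G plug_post plug_whisk.
Qed.

Lemma plugs_fbend Z Y w i n (F : functional Z (row Y w)) :
  plugs (size w + i) n (fbend F) = fbend (plugs i n F).
Proof. by elim: n F => //= n IHn F; rewrite -addnA plug_fbend IHn. Qed.

Fixpoint row_cat Z s1 s2 : hom (row Z (s1 ++ s2)) (row (row Z s2) s1) :=
  if s1 is a :: s1' then row_cat Z s1' s2 ⊠ idm (L a) else idm _.

(** Nested cups between [w] and its bent copy straighten the latter by zigzags. This is how
    composition of morphisms appears as a contraction of bent rows. *)
Lemma plugs_unbend Z Y w s (g : hom (row Z (catrev (map (@flip m) w) s)) Y) :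
  plugs 0 (size w)
    (Fun (row_map X' g w ∘ row_cat Z w (catrev (map (@flip m) w) s))) =
  Fun (unbend g).
Proof.
elim: w s g => [|a w IHw] s g; first by rewrite /= compm1.
rewrite [size _]/= plugsS.
have -> : Fun (row_map X' g (a :: w) ∘
    row_cat Z (a :: w) (catrev (map (@flip m) (a :: w)) s)) =
  whisk a (Fun (row_map X' g w ∘ row_cat Z w (catrev (map (@flip m) w) (flip a :: s)))).
  by rewrite /whisk /= whisk_comp.
by rewrite plugs_whisk IHw.
Qed.

(** * Half diagrams as functionals *)

Lemma half_diagram_false a s c v :
  half_diagram (a :: s) (false :: c) (a :: v) = half_diagram s c v ⊠ idm _.
Proof. by rewrite /= open_stringE. Qed.

(** Validity of [c1] means that the stack is empty when the reading reaches [s2], which is therefore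
    read as a bent row of its own. *)
Lemma half_diagram_cat s1 s2 c1 c2 v : c1 \in half_codes s1 v ->
  half_diagram (s1 ++ s2) (c1 ++ c2) v =
  half_diagram s1 c1 v ∘ row_map X' (half_diagram s2 c2 [::]) s1 ∘ row_cat 𝟙 s1 s2.
Proof.
elim: s1 c1 v => [|a s1 IHs] c1 v.
  by case: v c1 => [|b v] [|d c1] //= _; rewrite comp1m compm1.
case: c1 => [|[] c1]; first by move=> /half_codes_nil[].
  rewrite mem_half_codes_true => /IHs E.
  by rewrite /= E !whisk_comp !compA.
rewrite mem_half_codes_false; case: v => [|b v] //= /andP[/eqP[<-] /IHs E].
by rewrite !open_stringE E !whisk_comp.
Qed.

Lemma insert2_cat s1 s2 a : insert2 (size s1) a (s1 ++ s2) = s1 ++ flip a :: a :: s2.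
Proof. by elim: s1 => //= b s1 ->. Qed.

Lemma unplug0 Z Y s1 s2 a : 
  unplug (size s1) a (Fun (0 : hom (row Z (s1 ++ s2)) Y)) =
  Fun (0 : hom (row Z (s1 ++ flip a :: a :: s2)) Y).
Proof. by rewrite /unplug /= comp0m insert2_cat. Qed.

Lemma half_diagram_insert s1 s2 c1 c2 a v : size c1 = size s1 ->
  Fun (half_diagram (s1 ++ flip a :: a :: s2) (c1 ++ true :: false :: c2) v) =
  unplug (size s1) a (Fun (half_diagram (s1 ++ s2) (c1 ++ c2) v)).
Proof.
elim: s1 c1 v => [|b s1 IHs] [|d c1] // v.
  rewrite /unplug /= => _; congr Fun.
  by case: a => j [] /=; rewrite open_stringE capZ_natural.
case=> /IHs{}IHs; case: d.
  have E s : Fun (half_diagram (b :: s) (true :: c1 ++ c2) v) =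
    post (capL (row 𝟙 v) (flip b) b)
      (whisk b (Fun (half_diagram s (c1 ++ c2) (flip b :: v)))).
    by [].
  transitivity (post (capL (row 𝟙 v) (flip b) b) (whisk b (Fun (half_diagram
      (s1 ++ flip a :: a :: s2) (c1 ++ true :: false :: c2) (flip b :: v))))) => //.
  by rewrite IHs -unplug_whisk -unplug_post.
case: v => [|b' v]; first by rewrite (unplug0 _ _ (b :: s1)).
have [->|bb'] := eqVneq b b'; last first.
  by rewrite /= !(open_string_neq _ _ bb') (unplug0 _ _ (b :: s1)).
rewrite /= !open_stringE.
transitivity (whisk b' (Fun (half_diagram
      (s1 ++ flip a :: a :: s2) (c1 ++ true :: false :: c2) v))) => //.
by rewrite IHs -unplug_whisk.
Qed.

End Plugging.

(** * Non-crossing matchings of labelled words *)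

(** The relative positions of two pairs of neighbours in one row: disjoint in either order, equal,
    or sharing one point in either way. Sharing a point will be a zigzag, equality a loop. *)
Lemma cat_cons2_cases (T : Type) (u v u1 v1 : seq T) p q x y :
    u ++ q :: p :: v = u1 ++ y :: x :: v1 ->
  [\/ exists2 w, u = u1 ++ y :: x :: w & v1 = w ++ q :: p :: v,
      [/\ u = rcons u1 y, x = q & v1 = p :: v],
      [/\ u = u1, y = q, x = p & v1 = v]
    | [/\ u1 = rcons u q, y = p & v = x :: v1] \/
      exists2 w, u1 = u ++ q :: p :: w & v = w ++ y :: x :: v1].
Proof.
elim: u u1 => [|z u IHu] [|z1 u1] /=.
- by case=> -> -> ->; constructor 3.
- case: u1 => [|z2 u1] /= [-> ]; first by case=> -> ->; constructor 4; left.
  by case=> -> ->; constructor 4; right; exists u1.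
- case: u {IHu} => [|z2 u] /= [-> ]; first by case=> -> <-; constructor 2.
  by case=> -> <-; constructor 1; exists u.
case=> -> /IHu[[w -> ->]|[-> -> ->]|[-> -> -> ->]|[[-> -> ->]|[w -> ->]]].
- by constructor 1; exists w.
- by constructor 2.
- by constructor 3.
- by constructor 4; left.
- by constructor 4; right; exists w.
Qed.

Lemma uniq_cat_cons2 (T : eqType) (u v : seq T) p q :
  uniq (u ++ q :: p :: v) =
  [&& q != p, q \notin u ++ v, p \notin u ++ v & uniq (u ++ v)].
Proof.
by rewrite -[q :: p :: v]/([:: q; p] ++ v) uniq_catCA /= inE negb_or -andbA.
Qed.

Section Matchings.
Variables (m : nat) (P : eqType) (lt : P -> letter m).
Implicit Types (d : P -> P) (b : P -> bool) (p q x y z : P) (ls u v w : seq P).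

(* A list of points is read from right to left along the row; [d] is the
   matching and [b] tells the right ends of arcs from the left ones. *)
Inductive noncrossing d b : seq P -> Prop :=
| noncrossing_nil : noncrossing d b [::]
| noncrossing_ins u v p q : noncrossing d b (u ++ v) -> d p = q -> d q = p ->
    lt q = flip (lt p) -> b q -> ~~ b p -> noncrossing d b (u ++ q :: p :: v).

End Matchings.

Lemma noncrossing_map m (P Q : eqType) (lt : P -> letter m) (lt' : Q -> letter m)
    (f : P -> Q) d d' b b' ls :
    {in ls, forall z, [/\ d' (f z) = f (d z), b' (f z) = b z & lt' (f z) = lt z]} ->
  noncrossing lt d b ls -> noncrossing lt' d' b' (map f ls).
Proof.
move=> fP nc; elim: nc fP => [|{ls}u v p q _ IH dp dq ltq bq bp] fP.
  exact: noncrossing_nil.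
have [|dp' bp' ltp'] := fP p; first by rewrite !(mem_cat, inE) eqxx !orbT.
have [|dq' bq' ltq'] := fP q; first by rewrite !(mem_cat, inE) eqxx !orbT.
rewrite map_cat; apply: noncrossing_ins; rewrite ?dp' ?dq' ?bp' ?bq' ?ltp' ?ltq' ?dp ?dq //.
rewrite -map_cat; apply: IH => z zuv; apply: fP.
by move: zuv; rewrite !(mem_cat, inE) => /orP[] ->; rewrite ?orbT.
Qed.

Section MatchingsTheory.
Variables (m : nat) (P : eqType) (lt : P -> letter m).
Implicit Types (d : P -> P) (b : P -> bool) (p q x y z : P) (ls u v w : seq P).
Local Notation noncrossing := (noncrossing lt).

Lemma eq_noncrossing d d' b b' ls :
  {in ls, d =1 d'} -> {in ls, b =1 b'} ->
  noncrossing d b ls -> noncrossing d' b' ls.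
Proof.
move=> dd' bb' nc; rewrite -[ls]map_id; apply: noncrossing_map nc => z zls.
by rewrite -dd' // -bb'.
Qed.

Lemma noncrossing_mem d b ls : noncrossing d b ls -> uniq ls ->
  {in ls, forall z, [/\ d z \in ls, d (d z) = z & d z != z]}.
Proof.
elim=> // {ls}u v p q _ IH dp dq _ _ _ Uls z.
move: Uls; rewrite uniq_cat_cons2 => /and4P[qp _ _ Uuv].
rewrite !(mem_cat, inE); case: (eqVneq z q) => [->|zq].
  by rewrite dq dp eqxx !orbT eq_sym.
case: (eqVneq z p) => [->|zp]; first by rewrite dp dq eqxx !orbT.
move=> zuv; have [|] := IH Uuv z; first by rewrite mem_cat.
by rewrite mem_cat => /orP[] -> -> ->; rewrite ?orbT.
Qed.

Local Arguments half_codes : simpl never.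

Lemma half_codes_insert (u v : seq (letter m)) a st (cu cv : seq bool) : size cu = size u ->
  cu ++ cv \in half_codes (u ++ v) st ->
  cu ++ true :: false :: cv \in half_codes (u ++ flip a :: a :: v) st.
Proof.
elim: u cu st => [|x u IHu] [|e cu] //= st.
  by rewrite mem_half_codes_true mem_half_codes_false /= flipK eqxx.
case=> /IHu{}IHu; case: e; rewrite ?mem_half_codes_true ?mem_half_codes_false.
  exact: IHu.
by case/andP=> -> /IHu.
Qed.

Lemma noncrossing_codes d b ls : noncrossing d b ls ->
  map b ls \in half_codes (map lt ls) [::].
Proof.
elim=> // {ls}u v p q _ IH _ _ ltq bq bp; rewrite !map_cat /= ltq bq (negbTE bp).
by apply: half_codes_insert; rewrite ?size_map // -!map_cat.
Qed.

(** The matching left when [p] and [q] are glued and removed: their former partners become partners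
    of each other. *)
Definition rewire d p q z :=
  if z == d p then d q else if z == d q then d p else d z.

Definition update b x (e : bool) z := if z == x then e else b z.

(** For zigzags: straightening removes [p] and leaves in its place the far end [x] of the arc glued
    to it, which carries the same letter. *)
Lemma noncrossing_relabel d b u v p x :
    noncrossing d b (u ++ p :: v) -> uniq (x :: u ++ p :: v) -> lt x = lt p ->
  noncrossing (fun z => if z == x then d p else if z == d p then x else d z)
    (update b x (b p)) (u ++ x :: v).
Proof.
move=> nc /= /andP[xuv Uuv] ltx; have nm := noncrossing_mem nc Uuv.
have puv : p \in u ++ p :: v by rewrite mem_cat inE eqxx orbT.
have [dp ddp dpp] := nm p puv.
pose f z := if z == p then x else z.
have -> : u ++ x :: v = map f (u ++ p :: v).
  have fid w : p \notin w -> map f w = w.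
    move=> pw; rewrite -[RHS]map_id; apply/eq_in_map => z zw.
    by rewrite /f; case: eqP => // zp; rewrite -zp zw in pw.
  move: Uuv; rewrite cat_uniq /= negb_or => /and3P[_ /andP[pu _] /andP[pv _]].
  by rewrite map_cat /= !fid // /f eqxx.
apply: noncrossing_map nc => z zuv; have [dz ddz dzz] := nm z zuv.
have zx : z != x by apply: contraNneq xuv => <-.
rewrite /f /update; case: (eqVneq z p) => [->|zp]; rewrite ?eqxx ?(negbTE dpp) //.
rewrite (negbTE zx); case: (eqVneq z (d p)) => [->|zdp]; first by rewrite ddp eqxx.
by rewrite ifN //; apply: contraNneq zdp => <-; rewrite ddz.
Qed.

End MatchingsTheory.

(** * The effect of one cup on a matching *)

Section MatchingFunctionals.
Variables (K : fieldType) (C : tensor_category K) (m : nat) (delta : 'I_m -> K).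
Variables (X : 'I_m -> C).
Variable X' : forall j, dual_data (X j) (delta j).
Variables (P : eqType) (lt : P -> letter m).
Implicit Types (d : P -> P) (b : P -> bool) (p q x y z : P) (ls u v w : seq P).

Definition matching_functional b ls : functional X' 𝟙 (row X' 𝟙 [::]) :=
  Fun (half_diagram X' (map lt ls) (map b ls) [::]).
Local Notation sem := matching_functional.

Lemma eq_matching_functional b b' ls : {in ls, b =1 b'} -> sem b ls = sem b' ls.
Proof. by move=> bb'; rewrite /matching_functional ((eq_in_map _ _ _).1 bb'). Qed.

Lemma matching_functional_insert b u v p q :
    lt q = flip (lt p) -> b q -> ~~ b p ->
  sem b (u ++ q :: p :: v) = unplug (size u) (lt p) (sem b (u ++ v)).
Proof.
move=> ltq bq bp; rewrite /matching_functional.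
have -> : map lt (u ++ q :: p :: v) = map lt u ++ flip (lt p) :: lt p :: map lt v.
  by rewrite map_cat /= ltq.
have -> : map b (u ++ q :: p :: v) = map b u ++ true :: false :: map b v.
  by rewrite map_cat /= bq (negbTE bp).
by rewrite !(map_cat _ u v) -(size_map lt u) half_diagram_insert // !size_map.
Qed.

Lemma eq_sem_maps b b' ls ls' : map lt ls = map lt ls' -> map b ls = map b' ls' ->
  sem b ls = sem b' ls'.
Proof. by rewrite /matching_functional => -> ->. Qed.

(* Whatever the matching is, some arc joins two neighbours, and it can be
   removed first; then only the cases of a loop, of two zigzags and of two
   disjoint arcs remain. *)
Lemma plug_matching d b u v p q :
    noncrossing lt d b (u ++ q :: p :: v) -> uniq (u ++ q :: p :: v) ->
    lt q = flip (lt p) ->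
  exists2 b', noncrossing lt (rewire d p q) b' (u ++ v) &
    plug (size u) (sem b (u ++ q :: p :: v)) =
    fscale (if d p == q then delta (lt p).1 else 1) (sem b' (u ++ v)).
Proof.
move E: (u ++ q :: p :: v) => ls nc Uls ltqp.
have := noncrossing_mem nc Uls.
elim: nc u v E Uls => [|{ls}u1 v1 x y nc IH dx dy ltyx by_ bx] u v.
  by case: u.
move=> E Uls nm.
have ncI := noncrossing_ins nc dx dy ltyx by_ bx.
have pls : p \in u1 ++ y :: x :: v1 by rewrite -E !(mem_cat, inE) eqxx !orbT.
have qls : q \in u1 ++ y :: x :: v1 by rewrite -E !(mem_cat, inE) eqxx !orbT.
have xls : x \in u1 ++ y :: x :: v1 by rewrite !(mem_cat, inE) eqxx !orbT.
have yls : y \in u1 ++ y :: x :: v1 by rewrite !(mem_cat, inE) eqxx !orbT.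
have [dpls ddp dpp] := nm p pls; have [dqls ddq dqq] := nm q qls.
have /and4P[yx yuv xuv Uuv1] :
    [&& y != x, y \notin u1 ++ v1, x \notin u1 ++ v1 & uniq (u1 ++ v1)].
  by rewrite -uniq_cat_cons2.
have xy : x != y by rewrite eq_sym.
have qp : q != p by move: Uls; rewrite -E uniq_cat_cons2 => /andP[].
have nm1 := noncrossing_mem nc Uuv1.
have rew_id : p \in u1 ++ v1 -> q \in u1 ++ v1 ->
    rewire d p q x = y /\ rewire d p q y = x.
  move=> puv quv.
  have nz z : z \in [:: x; y] -> d z \notin [:: p; q].
    rewrite !inE => /pred2P[] ->; rewrite ?dx ?dy negb_or.
      by apply/andP; split; apply: contraNneq yuv => ->.
    by apply/andP; split; apply: contraNneq xuv => ->.
  have ne z (w : P) : z \in [:: x; y] -> w \in [:: p; q] -> d (d w) = w -> (z == d w) = false.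
    by move=> /nz zn wpq ddw; apply: (contraNF _ zn) => /eqP->; rewrite ddw.
  by rewrite /rewire !ne ?inE ?eqxx ?orbT.
(* Puts back the arc between [x] and [y], disjoint from the glued pair, into the result of the
   induction. The values of [b'] at [x] and [y] are unknown there and must be reset. *)
have ins_upd b' u2 v2 : rewire d p q x = y /\ rewire d p q y = x ->
    x \notin u2 ++ v2 -> y \notin u2 ++ v2 ->
    noncrossing lt (rewire d p q) b' (u2 ++ v2) ->
    exists2 b'', noncrossing lt (rewire d p q) b'' (u2 ++ y :: x :: v2) &
      sem b'' (u2 ++ y :: x :: v2) = unplug (size u2) (lt x) (sem b' (u2 ++ v2)).
  case=> rx ry xuv2 yuv2 nc2.
  have bb : {in u2 ++ v2, b' =1 update (update b' y true) x false}.
    move=> z zuv; rewrite /update; case: eqP => [zx|_]; first by rewrite -zx zuv in xuv2.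
    by case: eqP => // zy; rewrite -zy zuv in yuv2.
  exists (update (update b' y true) x false).
    apply: noncrossing_ins => //; rewrite /update ?eqxx // ?(eq_sym y) ?(negbTE xy) //.
    exact: eq_noncrossing nc2.
  rewrite (eq_matching_functional bb) matching_functional_insert //.
    by rewrite /update eq_sym (negbTE xy) eqxx.
  by rewrite /update eqxx.
(* The cases come in the order: disjoint arcs, zigzag, loop, zigzag, disjoint arcs. *)
case: (cat_cons2_cases E) => [[w eu ev1]|[eu ex ev1]|[eu ey ex ev1]|[[eu1 ey ev]|[w eu1 ev]]].
- have [|b' nc' sem'] := IH (u1 ++ w) v _ Uuv1 nm1; first by rewrite ev1 -catA.
  have pq : (p \in u1 ++ v1) && (q \in u1 ++ v1).
    by rewrite ev1 !(mem_cat, inE) !eqxx !orbT.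
  have sub z : z \in u1 ++ w ++ v -> z \in u1 ++ v1.
    by rewrite ev1 !(mem_cat, inE) => /or3P[] ->; rewrite ?orbT.
  have [pu qu] := andP pq.
  have [|||b'' nc'' sem''] := ins_upd b' u1 (w ++ v) (rew_id pu qu).
  + by apply: contra xuv; apply: sub.
  + by apply: contra yuv; apply: sub.
  + by rewrite catA.
  exists b''; first by rewrite eu -catA.
  rewrite eu -!catA /= sem'' matching_functional_insert //.
  rewrite size_cat /= 2!addnS plug_unplug_left ?leq_addr //.
  by rewrite -size_cat sem' unplug_fscale -catA.
- have eU : u ++ v = u1 ++ y :: v by rewrite eu cat_rcons.
  have ltyp : lt y = lt p by rewrite ltyx ex ltqp flipK.
  have uvp : u1 ++ v1 = u1 ++ p :: v by rewrite ev1.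
  have ydp : (y == d p) = false.
    by apply: contra_neqF qp => /eqP ydp; rewrite -ex -dy ydp ddp.
  have pq : (d p == q) = false.
    apply/eqP => dpq; move: dx; rewrite ex -dpq ddp => py.
    by rewrite -py uvp mem_cat inE eqxx orbT in yuv.
  (* Here [x] is [q]: once the zigzag is straightened, [y] inherits the partner of [p], and so its
     type of end. *)
  exists (update b y (b p)).
    rewrite eU; apply: eq_noncrossing (noncrossing_relabel (x := y) _ _ ltyp) => //.
    - move=> z _; rewrite /rewire -ex dx; case: eqP => [->|//]; first by rewrite ydp.
    - by rewrite -uvp.
    - by rewrite -uvp /= yuv.
  rewrite pq fscale1 matching_functional_insert // eu size_rcons.
  rewrite plug_zigzag_left ?uvp.
    rewrite cat_rcons; apply: eq_sem_maps; rewrite !map_cat /= ?ltyp //.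
    have upd w : y \notin w -> map (update b y (b p)) w = map b w.
      move=> yw; apply/eq_in_map => z zw; rewrite /update.
      by case: eqP => // zy; rewrite -zy zw in yw.
    move: yuv; rewrite uvp mem_cat inE !negb_or => /and3P[yu _ yv].
    by rewrite !upd // /update eqxx.
  by rewrite /= map_cat drop_size_cat ?size_map //= ex ltqp flipK.
- exists b; last first.
    by rewrite matching_functional_insert // eu ev1 -ex -ey dx eqxx plug_loop //=
      size_map size_cat leq_addr.
  rewrite eu -ev1; apply: eq_noncrossing nc => // z zuv.
  rewrite /rewire -ex -ey dx dy.
  case: eqP => [zy|_]; first by rewrite -zy zuv in yuv.
  by case: eqP => // zx; rewrite -zx zuv in xuv.
- have ltxq : lt x = lt q by rewrite ltqp -ey ltyx flipK.
  have uvq : u1 ++ v1 = u ++ q :: v1 by rewrite eu1 cat_rcons.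
  have pq : (d p == q) = false.
    apply/eqP => dpq; move: dy; rewrite ey dpq => qx.
    by rewrite -qx uvq mem_cat inE eqxx orbT in xuv.
  exists (update b x (b q)).
    rewrite ev; apply: eq_noncrossing (noncrossing_relabel (x := x) _ _ ltxq) => //.
    - by move=> z _; rewrite /rewire -ey dy.
    - by rewrite -uvq.
    - by rewrite -uvq /= xuv.
  rewrite pq fscale1 matching_functional_insert // eu1 size_rcons.
  rewrite plug_zigzag_right cat_rcons.
    rewrite ev; apply: eq_sem_maps; rewrite !map_cat /= ?ltxq //.
    have upd w : x \notin w -> map (update b x (b q)) w = map b w.
      move=> yw; apply/eq_in_map => z zw; rewrite /update.
      by case: eqP => // zy; rewrite -zy zw in yw.
    move: xuv; rewrite uvq mem_cat inE !negb_or => /and3P[yu _ yv].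
    by rewrite !upd // /update eqxx.
  by rewrite /= map_cat drop_size_cat ?size_map //= ltxq.
- have [|b' nc' sem'] := IH u (w ++ v1) _ Uuv1 nm1; first by rewrite eu1 -catA.
  have pq : (p \in u1 ++ v1) && (q \in u1 ++ v1).
    by rewrite eu1 !(mem_cat, inE) !eqxx !orbT.
  have sub z : z \in (u ++ w) ++ v1 -> z \in u1 ++ v1.
    by rewrite eu1 !(mem_cat, inE) => /orP[/orP[]|] ->; rewrite ?orbT.
  have [pu qu] := andP pq.
  have [|||b'' nc'' sem''] := ins_upd b' (u ++ w) v1 (rew_id pu qu).
  + by apply: contra xuv; apply: sub.
  + by apply: contra yuv; apply: sub.
  + by rewrite -catA.
  exists b''; first by rewrite ev catA.
  rewrite ev catA sem'' matching_functional_insert // eu1 size_cat /= 2!addnS.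
  rewrite plug_unplug_right ?leq_addr //=; last first.
    by rewrite size_map !size_cat /=; clear; lia.
  by rewrite -eu1 sem' unplug_fscale catA size_cat.
Qed.

End MatchingFunctionals.

(** * Alternating words under removal of pairs and under bending *)

Section Alternating.
Variable m : nat.
Implicit Types (a b : letter m) (s u v w : seq (letter m)).

Lemma alternating_cons2 u v a b : a.1 = b.1 ->
  alternating (u ++ a :: b :: v) -> a = flip b /\ alternating (u ++ v).
Proof.
move=> ab; elim: u => [|x u IHu] /=.
  case/and3P=> /eqP a2 /eqP b2 ->; split=> //; rewrite [a]surjective_pairing.
  by rewrite /flip -ab; congr (_, _); rewrite a2 parity_cons b2 ab eqxx.
case/andP=> /eqP x2 /IHu[-> ->]; split=> //; rewrite andbT x2 !parity_cat !parity_cons.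
by rewrite ab addKb.
Qed.

Lemma parity_catrev_flip j w s :
  parity j (catrev (map (@flip m) w) s) = parity j w (+) parity j s.
Proof.
elim: w s => [|a w IHw] s //=; rewrite IHw !parity_cons /flip /=.
by rewrite addbCA addbA.
Qed.

(** The bent letter [flip a] follows a row in which its color has the parity of the whole word
    ending in [a]; the flip makes up for the occurrence of [a] itself. *)
Lemma alternating_catrev_flip w s : alternating w -> alternating s ->
  (forall j, parity j s = parity j w) -> alternating (catrev (map (@flip m) w) s).
Proof.
elim: w s => [|a w IHw] s //= /andP[/eqP a2 alt_w] alt_s par.
apply: IHw => //= [|j].
  by rewrite alt_s andbT /flip /= par parity_cons eqxx a2.
by rewrite parity_cons par parity_cons /flip /= addbA addbb.
Qed.

End Alternating.

(** * Non-crossing matchings and ranks *)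

Section Ranks.
Variables (m : nat) (P : eqType) (lt : P -> letter m) (rk : P -> nat).
Implicit Types (d : P -> P) (b : P -> bool) (p q x y z w : P) (ls u v : seq P).
Local Notation noncrossing := (noncrossing lt).
Local Notation decreasing := (pairwise (fun p q => rk q < rk p)%N).

Lemma decreasing_cons2 u v p q : decreasing (u ++ q :: p :: v) ->
  [/\ (rk p < rk q)%N, {in u, forall z, (rk q < rk z)%N},
      {in v, forall z, (rk z < rk p)%N} & decreasing (u ++ v)].
Proof.
rewrite !pairwise_cat /= => /and3P[].
move=> /allrelP uqv uu /and3P[/andP[pq /allP qv] /allP pv vv].
split=> // [z zu|]; first by rewrite uqv // inE eqxx.
rewrite uu vv !andbT; apply/allrelP => z w zu wv.
by rewrite uqv // !inE wv !orbT.
Qed.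

Lemma decreasing_inj ls : decreasing ls -> {in ls &, injective rk}.
Proof.
elim: ls => //= x ls IH /andP[/allP xls /IH{}IH] z w.
rewrite !inE => /predU1P[->|zls] /predU1P[->|wls] // E.
- by have := xls w wls; rewrite E ltnn.
- by have := xls z zls; rewrite E ltnn.
exact: IH.
Qed.

Definition crossless d ls := {in ls &, forall z w,
  ~~ [&& rk z < rk w, rk w < rk (d z) & rk (d z) < rk (d w)]%N}.

Definition involutive_on d ls :=
  {in ls, forall z, [/\ d z \in ls, d (d z) = z & d z != z]}.

Lemma noncrossing_rank d b ls : noncrossing d b ls -> uniq ls -> decreasing ls ->
  {in ls, forall z, b z = (rk (d z) < rk z)%N} /\ crossless d ls.
Proof.
move=> nc; elim: nc => [|{ls}u v p q nc IH dp dq _ bq bp]; first by [].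
rewrite uniq_cat_cons2 => /and4P[_ qs ps Uuv].
case/decreasing_cons2 => pq uq vp duv.
have [b_uv c_uv] := IH Uuv duv; have nm := noncrossing_mem nc Uuv.
(* No other point has its rank between those of the neighbours [p] and [q]. *)
have far z : z \in u ++ v -> (rk z < rk p)%N || (rk q < rk z)%N.
  by rewrite mem_cat => /orP[/uq|/vp] ->; rewrite ?orbT.
have cases z : z \in u ++ q :: p :: v -> [\/ z = q, z = p | z \in u ++ v].
  by rewrite !(mem_cat, inE) => /or4P[->|/eqP->|/eqP->|->]; rewrite ?orbT;
    [constructor 3|constructor 1|constructor 2|constructor 3].
split=> [z /cases[->|->|/b_uv //]|z w /cases[->|->|zuv] /cases[->|->|wuv]].
- by rewrite dq bq pq.
- by rewrite dp (negbTE bp) ltnNge ltnW.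
- by rewrite ltnn.
- by rewrite (ltnNge (rk q)) ltnW.
- by rewrite dq; apply/negP => /and3P[]; move: (far w wuv) pq; clear; lia.
- by rewrite dp ltnn andbF.
- by rewrite ltnn.
- by rewrite dp; apply/negP => /and3P[]; move: (far w wuv) pq; clear; lia.
- by rewrite dq; apply/negP => /and3P[]; move: pq; clear; lia.
- have [dz _ _] := nm z zuv.
  by rewrite dp; apply/negP => /and3P[]; move: (far _ dz) pq; clear; lia.
exact: c_uv.
Qed.

(** Descent on the rank difference of an arc: a point strictly beneath it belongs, by the absence of
    crossings, to a shorter arc nested inside. When nothing lies beneath, the ends are neighbours,
    since ranks decrease along the row. *)
Lemma adjacent_arc d ls : ls != [::] -> decreasing ls -> involutive_on d ls ->
  crossless d ls -> exists u v p q, [/\ ls = u ++ q :: p :: v, d p = q & d q = p].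
Proof.
move=> ls0 dls inv cr.
have [z zls zdz] : exists2 z, z \in ls & (rk (d z) < rk z)%N.
  case: ls ls0 dls inv {cr} => // x ls _ dls inv.
  have xx : x \in x :: ls by rewrite inE eqxx.
  have [dx ddx dxx] := inv x xx.
  have : rk (d x) != rk x by apply: contraNneq dxx => /(decreasing_inj dls)->.
  by rewrite neq_ltn => /orP[lt1|lt1]; [exists x | exists (d x); rewrite ?ddx].
have [k] := ubnP (rk z - rk (d z)); elim: k z zls zdz => // k IH q qls dqq ltk.
have [dq ddq _] := inv q qls; set p := d q in dq ddq dqq ltk *.
have [/hasP[w wls /andP[pw wq]]|/hasPn no] :=
    boolP (has (fun w => rk p < rk w < rk q)%N ls).
  have [dw ddw dww] := inv w wls.
  have dw_q : (rk (d w) < rk q)%N.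
    have := cr p w dq wls; rewrite ddq pw wq /= -leqNgt leq_eqVlt => /orP[/eqP|//].
    move/(decreasing_inj dls dw qls) => dwq.
    by rewrite -ddw dwq /= ltnn in pw.
  have p_dw : (rk p < rk (d w))%N.
    have := cr (d w) p dw dq; rewrite ddw ddq pw wq !andbT -leqNgt leq_eqVlt.
    case/orP=> [/eqP|//] /(decreasing_inj dls dq dw) pdw.
    by rewrite -ddw -pdw ddq ltnn in wq.
  have : rk (d w) != rk w by apply: contraNneq dww => /(decreasing_inj dls)->.
  rewrite neq_ltn => /orP[] lt1.
    by apply: (IH w) => //; move: ltk pw wq p_dw dw_q lt1; clear; lia.
  apply: (IH (d w)); rewrite ?ddw //.
  by move: ltk pw wq p_dw dw_q lt1; clear; lia.
case/splitPr: qls => u l in dls dq no *.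
move: dls; rewrite pairwise_cat /= => /and3P[/allrelP ul _ /andP[/allP ql lp]].
have pl : p \in l.
  move: dq; rewrite mem_cat inE => /or3P[pu|/eqP pq|//].
    by have := ul p q pu; rewrite inE eqxx => /(_ isT); rewrite ltnNge ltnW.
  by rewrite pq ltnn in dqq.
case: l => [|h l] in ls0 inv cr IH dq no ul ql lp pl * => //; exists u, l, p, q; split=> //.
congr (_ ++ _ :: _ :: _); move: pl; rewrite inE => /predU1P[//|pl].
case/andP: lp => /allP /(_ p pl) ph _.
have := no h; rewrite mem_cat !inE eqxx !orbT ph => /(_ isT).
by rewrite ql // inE eqxx.
Qed.

(** Arcs joining neighbours are peeled off. Alternation upgrades the equality of colors of their
    ends to opposite letters. *)
Lemma rank_noncrossing d b ls : uniq ls -> decreasing ls -> involutive_on d ls ->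
    crossless d ls -> {in ls, forall z, (lt (d z)).1 = (lt z).1} ->
    alternating (map lt ls) -> {in ls, forall z, b z = (rk (d z) < rk z)%N} ->
  noncrossing d b ls.
Proof.
have [k] := ubnP (size ls); elim: k ls => // k IH ls ltk Uls dls inv cr col alt bE.
have [->|ls0] := eqVneq ls [::]; first exact: noncrossing_nil.
have [u [v [p [q [E dp dq]]]]] := adjacent_arc ls0 dls inv cr.
move: ltk Uls dls inv cr col alt bE; rewrite {ls ls0}E => ltk.
rewrite uniq_cat_cons2 => /and4P[_ qs ps Uuv] dls inv cr col alt bE.
have [pq _ _ duv] := decreasing_cons2 dls.
have qin : q \in u ++ q :: p :: v by rewrite !(mem_cat, inE) eqxx !orbT.
have pin : p \in u ++ q :: p :: v by rewrite !(mem_cat, inE) eqxx !orbT.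
have sub : {subset u ++ v <= u ++ q :: p :: v}.
  by move=> z; rewrite !(mem_cat, inE) => /orP[]->; rewrite ?orbT.
have [ltq alt_uv] : lt q = flip (lt p) /\ alternating (map lt (u ++ v)).
  rewrite map_cat; apply: alternating_cons2; last by rewrite map_cat in alt.
  by rewrite -dq col.
apply: noncrossing_ins => //; last 2 first.
- by rewrite bE // dq.
- by rewrite bE // dp -leqNgt ltnW.
apply: IH => //.
- by move: ltk; rewrite !size_cat /= !addnS !ltnS; apply: leq_trans; rewrite leqnSn.
- move=> z zuv; have [dz ddz dzz] := inv z (sub z zuv); split=> //.
  move: dz; rewrite !(mem_cat, inE) => /or4P[->|/eqP dzq|/eqP dzp|->]; rewrite ?orbT //.
    by move: zuv; rewrite -ddz dzq dq (negbTE ps).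
  by move: zuv; rewrite -ddz dzp dp (negbTE qs).
- by move=> z w /sub zin /sub win; apply: cr.
- by move=> z /sub; apply: col.
by move=> z /sub; apply: bE.
Qed.

(** A matching is recovered from its right ends as parentheses are: a right end next to a left end
    can only be joined to it. *)
Lemma noncrossing_unique d d2 b ls : noncrossing d b ls -> uniq ls ->
    decreasing ls -> involutive_on d2 ls -> crossless d2 ls ->
    {in ls, forall z, b z = (rk (d2 z) < rk z)%N} -> {in ls, d =1 d2}.
Proof.
move=> nc; elim: nc => [|{ls}u v p q nc IH dp dq _ bq bp] //.
rewrite uniq_cat_cons2 => /and4P[_ qs ps Uuv] dls inv cr bE.
have [pq uq vp duv] := decreasing_cons2 dls.
have qin : q \in u ++ q :: p :: v by rewrite !(mem_cat, inE) eqxx !orbT.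
have pin : p \in u ++ q :: p :: v by rewrite !(mem_cat, inE) eqxx !orbT.
have [d2q dd2q d2qq] := inv q qin; have [d2p dd2p d2pp] := inv p pin.
have far z : z \in u ++ v -> (rk z < rk p)%N || (rk q < rk z)%N.
  by rewrite mem_cat => /orP[/uq|/vp] ->; rewrite ?orbT.
have cases z : z \in u ++ q :: p :: v -> [\/ z = q, z = p | z \in u ++ v].
  by rewrite !(mem_cat, inE) => /or4P[->|/eqP->|/eqP->|->]; rewrite ?orbT;
    [constructor 3|constructor 1|constructor 2|constructor 3].
(* The arc of [q] goes down in rank and cannot pass over [p], whose own arc goes up: if it did not
   end at [q], the two would cross. *)
have E : d2 q = p.
  case: (cases _ d2q) => // [/eqP|/far]; first by rewrite (negbTE d2qq).
  have := bE q qin; rewrite bq => /esym lt1.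
  case/orP=> lt2; last by move: lt1; rewrite ltnNge ltnW.
  case: (cases _ d2p) => [d2pq|/eqP|/far]; first by rewrite -d2pq.
    by rewrite (negbTE d2pp).
  have := bE p pin; rewrite (negbTE bp) => /esym/negbT; rewrite -leqNgt => le3.
  case/orP=> lt4; first by move: le3; rewrite leqNgt lt4.
  by have := cr _ _ d2q pin; rewrite dd2q lt2 pq lt4.
have E' : d2 p = q by rewrite -E.
have sub : {subset u ++ v <= u ++ q :: p :: v}.
  by move=> z; rewrite !(mem_cat, inE) => /orP[]->; rewrite ?orbT.
move=> z /cases[->|->|zuv]; rewrite ?dp ?dq ?E ?E' //.
apply: IH => // [w wuv|w w' /sub win /sub w'in|w /sub]; last exact: bE.
  have [dw ddw dww] := inv w (sub w wuv); split=> //.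
  case: (cases _ dw) => // dwE.
    by move: wuv; rewrite -ddw dwE E (negbTE ps).
  by move: wuv; rewrite -ddw dwE E' (negbTE qs).
exact: cr.
Qed.

(** The stack now holds the waiting points [sts] rather than letters, so that popping it names the
    partner; the matching is built on the row with these points put back. *)
Lemma half_codes_noncrossing ls sts c :
    c \in half_codes (map lt ls) [seq flip (lt z) | z <- sts] ->
    uniq (catrev sts ls) ->
  exists d b, [/\ noncrossing d b (catrev sts ls), {in sts, forall z, b z} &
                  map b ls = c].
Proof.
elim: ls sts c => [|p ls IH] sts c.
  case: sts => //= /[!inE] /eqP-> _; exists id, xpredT; split=> //.
  exact: noncrossing_nil.
case: c => [/half_codes_nil[]//|[] c].
  rewrite [map _ (_ :: _)]/= mem_half_codes_true => /(IH (p :: sts)) /= cin.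
  case/cin => d [b [nc bs bc]].
  exists d, b; split=> //; last by rewrite bs ?inE ?eqxx // bc.
  by move=> z zs; rewrite bs // inE zs orbT.
rewrite [map _ (_ :: _)]/= mem_half_codes_false; case: sts => [|q sts] //=.
case/andP=> /eqP[ltq] cin; rewrite catrevE uniq_cat_cons2 -catrevE => /and4P[qp qs ps U].
have [d [b [nc bs bc]]] := IH sts c cin U.
have ltq' : lt q = flip (lt p) by rewrite -ltq flipK.
pose d' z := if z == p then q else if z == q then p else d z.
pose b' := update (update b q true) p false.
have bb : {in catrev sts ls, b =1 b'}.
  move=> z zs; rewrite /b' /update; case: eqP => [zp|_]; first by rewrite -zp zs in ps.
  by case: eqP => // zq; rewrite -zq zs in qs.
exists d', b'; split.
- apply: noncrossing_ins => //; rewrite /d' /b' /update ?(negbTE qp) ?eqxx //.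
  rewrite -catrevE; apply: eq_noncrossing nc => // z zs.
  case: eqP => [zp|_]; first by rewrite -zp zs in ps.
  by case: eqP => // zq; rewrite -zq zs in qs.
- move=> z; rewrite inE => /predU1P[->|zs]; first by rewrite /b' /update (negbTE qp) eqxx.
  by rewrite -bb ?bs // catrevE mem_cat mem_rev zs.
rewrite /b' /update eqxx; congr (_ :: _); rewrite -bc; apply/eq_in_map => z zls.
have zs : z \in catrev sts ls by rewrite catrevE mem_cat zls orbT.
by rewrite [RHS]bb.
Qed.

Lemma noncrossing_cat d b u v : noncrossing d b u -> noncrossing d b v ->
  noncrossing d b (u ++ v).
Proof.
move=> nc ncv; elim: nc => [|u1 u2 p q _ IH dp dq ltq bq bp] //=.
by rewrite -catA /=; apply: noncrossing_ins; rewrite // catA.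
Qed.

Lemma noncrossing_flip d b ls : noncrossing d b ls -> uniq ls ->
  {in ls, forall z, b (d z) = ~~ b z}.
Proof.
elim=> [|{ls}u v p q nc IH dp dq _ bq bp] //.
rewrite uniq_cat_cons2 => /and4P[_ qs ps Uuv] z.
rewrite !(mem_cat, inE) => /or4P[zu|/eqP->|/eqP->|zv].
- by rewrite IH // mem_cat zu.
- by rewrite dq bq (negbTE bp).
- by rewrite dp bq bp.
by rewrite IH // mem_cat zv orbT.
Qed.

End Ranks.

(** * Contraction of a matching along nested pairs *)

Section Contraction.
Variables (K : fieldType) (C : tensor_category K) (m : nat) (delta : 'I_m -> K).
Variables (X : 'I_m -> C).
Variable X' : forall j, dual_data (X j) (delta j).
Variables (P : eqType) (lt : P -> letter m).
Implicit Types (d : P -> P) (b : P -> bool) (p q x y z w : P).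
Implicit Types (u v lp : seq P) (mp : seq (P * P)).
Local Notation sem := (matching_functional X' lt).

Definition full_row u mp v := u ++ map fst mp ++ rev (map snd mp) ++ v.

(* The graph with edges d and mp on [full_row u mp v] has the open components
   {z, d' z}, for z in u ++ v, and one closed component for each point of lp;
   [r z] is a representative of the component of z. *)
Record components d u mp v d' (r : P -> P) lp : Prop := Components {
  comp_edge : {in full_row u mp v, forall z, r (d z) = r z};
  comp_glue : {in mp, forall e, r e.1 = r e.2};
  comp_open : {in u ++ v &, forall z w, r z = r w -> w = z \/ w = d' z};
  comp_range : {in full_row u mp v, forall z, r z \in (u ++ v) ++ lp};
  comp_range_open : {in u ++ v, forall z, r z \in u ++ v};
  comp_loops_uniq : uniq lp;
  comp_loops : {in lp, forall p, p \in map snd mp /\ r p = p};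
  comp_sound : forall E : P -> P -> Prop,
    (forall x, E x x) -> (forall x y, E x y -> E y x) ->
    (forall x y z, E x y -> E y z -> E x z) ->
    {in full_row u mp v, forall z, E z (d z)} -> {in mp, forall e, E e.1 e.2} ->
    {in full_row u mp v, forall z, E z (r z)} /\ {in u ++ v, forall z, E z (d' z)}
}.

(** Innermost pair first; the induction carries the components of the glued graph along with the
    scalar. The clause [comp_sound], over all equivalence relations, says that nothing is identified
    beyond what the edges force. *)
Lemma plugs_matching d b u mp v :
    noncrossing lt d b (full_row u mp v) -> uniq (full_row u mp v) ->
    {in mp, forall e, lt e.1 = flip (lt e.2)} ->
  exists d' b' r lp,
    [/\ noncrossing lt d' b' (u ++ v),
        plugs (size u) (size mp) (sem b (full_row u mp v)) =
          fscale (\prod_(p <- lp) delta (lt p).1) (sem b' (u ++ v))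
      & components d u mp v d' r lp].
Proof.
elim/last_ind: mp d b => [|mp [q p] IH] d b.
  rewrite /full_row /= => nc Uls _; have nm := noncrossing_mem nc Uls.
  have bd := noncrossing_flip nc Uls.
  (* Without gluing each arc is a component, represented by its right end. *)
  exists d, b, (fun z => if b z then z else d z), [::].
  split; rewrite ?big_nil ?fscale1 //; split=> //=.
  - move=> z zls; have [_ -> _] := nm z zls; rewrite bd //.
    by case: (b z).
  - move=> z w zls wls; have [_ ddz _] := nm z zls; have [_ ddw _] := nm w wls.
    case: (b z); case: (b w) => E; [by left | by right; rewrite E ddw | by right |].
    by left; rewrite -ddz E ddw.
  - move=> z zls; rewrite cats0; have [dz _ _] := nm z zls.
    by case: ifP.
  - by move=> z zls; have [dz _ _] := nm z zls; case: ifP.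
  move=> E Er Es Et Ed _; split=> // z zls; case: ifP => _ //.
  exact: Ed.
have FL : full_row u (rcons mp (q, p)) v =
    (u ++ map fst mp) ++ q :: p :: rev (map snd mp) ++ v.
  by rewrite /full_row !map_rcons rev_rcons cat_rcons /= -catA.
rewrite FL => nc Uls ltmp; have ltqp : lt q = flip (lt p).
  by apply: (ltmp (q, p)); rewrite mem_rcons inE eqxx.
have nm := noncrossing_mem nc Uls.
have [b1 nc1 sem1] := plug_matching X' nc Uls ltqp.
have F1 : (u ++ map fst mp) ++ rev (map snd mp) ++ v = full_row u mp v.
  by rewrite /full_row -!catA.
have := Uls; rewrite uniq_cat_cons2 F1 => /and4P[qp ql pl Ul].
rewrite F1 in nc1 sem1; set L := _ ++ q :: _ in FL nc Uls nm sem1 *.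
have inL z : (z \in L) = [|| z == q, z == p | z \in full_row u mp v].
  by rewrite -F1 !(mem_cat, inE); do !case: (_ \in _); rewrite ?orbT.
have subm : {subset mp <= rcons mp (q, p)}.
  by move=> e emp; rewrite mem_rcons inE emp orbT.
have [d' [b' [r [lp [nc' sem' [rE rG rO rR rRo lpU lpM rS]]]]]] :=
  IH _ _ nc1 Ul (sub_in1 subm ltmp).
have qL : q \in L by rewrite inL eqxx.
have pL : p \in L by rewrite inL eqxx orbT.
have [dpL ddp dpp] := nm p pL; have [dqL ddq dqq] := nm q qL.
have ne z : z \in full_row u mp v -> (z == p = false) * (z == q = false).
  by move=> zl; split; apply/eqP => E; rewrite -E zl in pl ql.
have sub_uv : {subset u ++ v <= full_row u mp v}.
  by move=> z; rewrite /full_row !mem_cat => /orP[]->; rewrite ?orbT.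
have snd_in : {subset map snd mp <= full_row u mp v}.
  by move=> z; rewrite /full_row !mem_cat mem_rev => ->; rewrite !orbT.
have fst_in : {subset map fst mp <= full_row u mp v}.
  by move=> z; rewrite /full_row !mem_cat => ->; rewrite !orbT.
(* If [p] and [q] are partners, gluing closes a loop, represented by [p]. Otherwise both join the
   component of [d p], which stays in the row and is already linked to [d q] by [rewire]. *)
pose r' z := if (z == p) || (z == q) then if d p == q then p else r (d p) else r z.
have r'E z : z \in full_row u mp v -> r' z = r z by move=> /ne zpq; rewrite /r' !zpq.
have r'q : r' q = r' p by rewrite /r' !eqxx orbT.
have dqp : d p == q -> d q = p by move=> /eqP <-.
have dp_in : d p != q -> d p \in full_row u mp v.
  by move=> dpq; move: dpL; rewrite inL (negbTE dpp) (negbTE dpq).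
have dq_in : d p != q -> d q \in full_row u mp v.
  move=> dpq; move: dqL; rewrite inL (negbTE dqq) /= => /predU1P[dqp'|//].
  by rewrite -dqp' ddq eqxx in dpq.
have r_dq : d p != q -> r (d q) = r (d p).
  by move=> dpq; rewrite -(rE _ (dp_in dpq)) /rewire eqxx.
exists d', b', r', (if d p == q then p :: lp else lp); split=> //.
  rewrite size_rcons /= -(size_map fst mp) -size_cat sem1.
  rewrite size_map in sem' *.
  have plugs_fscale c (G : functional X' _ _) n i :
      plugs i n (fscale c G) = fscale c (plugs i n G).
    by elim: n G => //= n IHn G; rewrite plug_fscale IHn.
  rewrite plugs_fscale sem' fscaleA; congr fscale.
  by case: ifP => _; rewrite ?big_cons ?mul1r.
split; rewrite ?FL.
- move=> z; rewrite inL => /or3P[/eqP->|/eqP->|zl].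
  + rewrite r'q; have [dpq|dpq] := boolP (d p == q); first by rewrite dqp.
    by rewrite (r'E (d q)) ?dq_in // r_dq // /r' eqxx /= (negbTE dpq).
  + have [dpq|dpq] := boolP (d p == q); first by rewrite (eqP dpq).
    by rewrite (r'E (d p)) ?dp_in // /r' eqxx /= (negbTE dpq).
  rewrite (r'E z zl); have [zdp|zdp] := eqVneq z (d p).
    rewrite zdp ddp /r' eqxx /=; case: ifP => // /eqP dpq.
    by have [_] := ne z zl; rewrite zdp dpq eqxx.
  have [zdq|zdq] := eqVneq z (d q).
    rewrite zdq ddq r'q /r' eqxx /=; case: ifP => [/eqP dpq|dpq].
      by have [] := ne z zl; rewrite zdq -dpq ddp eqxx.
    by rewrite r_dq // dpq.
  have dzl : d z \in full_row u mp v.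
    have zL : z \in L by rewrite inL zl !orbT.
    have [dz ddz _] := nm z zL; move: dz; rewrite inL => /or3P[/eqP E|/eqP E|//].
      by rewrite -E ddz eqxx in zdq.
    by rewrite -E ddz eqxx in zdp.
  by rewrite r'E // -(rE z zl) /rewire (negbTE zdp) (negbTE zdq).
- move=> e; rewrite mem_rcons inE => /predU1P[-> //|emp].
  rewrite !r'E ?rG //; first by apply/snd_in/map_f.
  exact/fst_in/map_f.
- by move=> z w zuv wuv; rewrite !r'E ?sub_uv //; apply: rO.
- have mem_lp z : z \in (u ++ v) ++ lp -> z \in (u ++ v) ++ (if d p == q then p :: lp else lp).
    by rewrite !(mem_cat) => /orP[->//|zlp]; case: ifP => _; rewrite ?inE zlp !orbT.
  move=> z; rewrite inL => /or3P[/eqP->|/eqP->|zl]; last by rewrite r'E //; apply/mem_lp/rR.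
    rewrite r'q /r' eqxx /=; have [dpq|dpq] := boolP (d p == q).
      by rewrite !(mem_cat, inE) eqxx !orbT.
    by have := mem_lp _ (rR _ (dp_in dpq)); rewrite (negbTE dpq).
  rewrite /r' eqxx /=; have [dpq|dpq] := boolP (d p == q).
    by rewrite !(mem_cat, inE) eqxx !orbT.
  by have := mem_lp _ (rR _ (dp_in dpq)); rewrite (negbTE dpq).
- by move=> z zuv; rewrite r'E ?sub_uv // rRo.
- case: ifP => // _; rewrite /= lpU andbT; apply: contra pl => /lpM[pm _].
  exact: snd_in.
- have old z : z \in lp -> z \in map snd (rcons mp (q, p)) /\ r' z = z.
    move=> /lpM[zm rz]; rewrite map_rcons mem_rcons inE zm orbT; split=> //.
    by rewrite r'E // snd_in.
  move=> z; case: ifP => [dpq|_ /old //]; rewrite inE => /predU1P[->|/old//].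
  by rewrite map_rcons mem_rcons inE eqxx /r' eqxx dpq.
move=> E Er Es Et Ed Em.
have Eqp : E q p by apply: (Em (q, p)); rewrite mem_rcons inE eqxx.
have [|e emp|S1 S2] := rS E Er Es Et; last 1 first.
- split=> // z; rewrite inL => /or3P[/eqP->|/eqP->|zl]; last by rewrite r'E //; apply: S1.
    rewrite r'q /r' eqxx /=; have [dpq|dpq] := boolP (d p == q) => //.
    by apply: Et Eqp (Et _ _ _ (Ed p pL) (S1 _ (dp_in dpq))).
  rewrite /r' eqxx /=; have [dpq|dpq] := boolP (d p == q) => //.
  exact: Et (Ed p pL) (S1 _ (dp_in dpq)).
- move=> z zl; have zL : z \in L by rewrite inL zl !orbT.
  rewrite /rewire; case: eqP => [->|_].
    by apply: Et (Es _ _ (Ed p pL)) (Et _ _ _ (Es _ _ Eqp) (Ed q qL)).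
  case: eqP => [->|_]; last exact: Ed.
  by apply: Et (Es _ _ (Ed q qL)) (Et _ _ _ Eqp (Ed p pL)).
by apply: Em; apply: subm.
Qed.

End Contraction.

(** * The boundary of a diagram as an alternating word *)

Section BoundaryWords.
Variables (m : nat) (hm : (0 < m)%N).

Fixpoint top_word n : seq (letter m) :=
  if n is n'.+1 then coloring hm n' :: top_word n' else [::].

Lemma size_top_word n : size (top_word n) = n.
Proof. by elim: n => //= n ->. Qed.

Lemma top_wordE n : top_word n = rev (map (coloring hm) (iota 0 n)).
Proof.
elim: n => // n IHn; rewrite [top_word _]/= IHn -[in RHS]addn1 iotaD map_cat rev_cat.
by rewrite add0n.
Qed.

(** Each complete block contains the color [j] once, whence the parity of [n %/ m]. The partial
    block contains it once its position is passed: [j], or [m - j.+1] in a starred block, which runs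
    backwards. *)
Lemma parity_top_word (j : 'I_m) n :
  parity j (top_word n) =
  odd (n %/ m) (+) ((if odd (n %/ m) then m - j.+1 else j) < n %% m)%N.
Proof.
elim: n => [|n IHn]; first by rewrite div0n mod0n.
rewrite [top_word _]/= parity_cons IHn {IHn}.
set q := (n %/ m)%N; set r := (n %% m)%N; set pos := (if _ then _ else _).
have rm : (r < m)%N by rewrite ltn_mod.
have -> : ((coloring hm n).1 == j) = (pos == r).
  rewrite /coloring /block_letter /= -/q /pos; case: (odd q); rewrite -val_eqE /=.
    by have := ltn_ord j; rewrite -/r; move: rm; clear; lia.
  by rewrite eq_sym.
have posm : (pos < m)%N.
  by rewrite /pos; have := ltn_ord j; case: (odd q) => //; clear; lia.
have nE : n = (q * m + r)%N by rewrite -divn_eq.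
have [r1|r1] := ltnP r.+1 m.
  have -> : (n.+1 %/ m = q)%N by rewrite nE -addnS divnMDl // divn_small // addn0.
  have -> : (n.+1 %% m = r.+1)%N by rewrite nE -addnS modnMDl modn_small.
  by rewrite -/pos addbCA ltnS; case: ltngtP.
have r1m : r.+1 = m by apply/eqP; rewrite eqn_leq r1 rm.
have -> : (n.+1 %/ m = q.+1)%N by rewrite nE -addnS r1m -mulSnr mulnK.
have -> : (n.+1 %% m = 0)%N by rewrite nE -addnS r1m -mulSnr modnMl.
rewrite ltn0 addbF /= addbCA.
suff -> : (pos == r) (+) (pos < r)%N = true by rewrite addbT.
by move: posm; rewrite -r1m ltnS; case: ltngtP.
Qed.

Lemma alternating_top_word n : alternating (top_word n).
Proof.
elim: n => //= n ->; rewrite andbT parity_top_word /coloring /block_letter /=.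
case: (odd _) => /=; last by rewrite ltnn.
have rm : (n %% m < m)%N by rewrite ltn_mod.
have -> : (m - (m - (n %% m).+1).+1 = n %% m)%N by move: rm; clear; lia.
by rewrite ltnn.
Qed.

Definition bent_word n := catrev (map (@flip m) (top_word n)) (top_word n).

Lemma alternating_bent_word n : alternating (bent_word n).
Proof. by apply: alternating_catrev_flip => //; apply: alternating_top_word. Qed.

Lemma parity_bent_word n j : parity j (bent_word n) = false.
Proof. by rewrite parity_catrev_flip addbb. Qed.

Section Points.
Variable n : nat.
Implicit Types (d x y : pairing n) (u v : point n).
Local Notation rk := (@boundary_rank n).

Definition point_letter u : letter m :=
  match u with inl i => coloring hm i | inr i => flip (coloring hm i) end.

(** The boundary in decreasing rank, which is the order in which the bent row is read. *)
Definition points : seq (point n) :=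
  [seq inr i | i <- enum 'I_n] ++ rev [seq inl i | i <- enum 'I_n].

Lemma map_points (T : Type) (F : point n -> T) (G H : nat -> T) :
    (forall i : 'I_n, F (inr i) = G i) -> (forall i : 'I_n, F (inl i) = H i) ->
  map F points = map G (iota 0 n) ++ rev (map H (iota 0 n)).
Proof.
move=> FG FH; rewrite /points map_cat map_rev -!map_comp -val_enum_ord -!map_comp.
by congr (_ ++ rev _); apply: eq_map => i /=.
Qed.

Lemma mem_points u : u \in points.
Proof.
rewrite mem_cat mem_rev; case: u => i.
  by rewrite orbC map_f // mem_enum.
by rewrite map_f // mem_enum.
Qed.

Lemma map_letter_points : map point_letter points = bent_word n.
Proof.
rewrite (map_points (G := fun i => flip (coloring hm i)) (H := coloring hm)) //.
rewrite /bent_word catrevE top_wordE; congr (_ ++ _).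
by rewrite -map_rev revK -map_comp.
Qed.

Lemma map_rank_points : map rk points = rev (iota 0 (n + n)).
Proof.
rewrite (map_points (G := (fun i => n + (n - i.+1))%N) (H := id)) // map_id.
rewrite iotaD rev_cat; congr (_ ++ _); apply: (@eq_from_nth _ 0%N).
  by rewrite size_rev size_map !size_iota.
move=> i; rewrite size_map size_iota => lt_in.
rewrite (nth_map 0%N) ?size_iota // nth_rev ?size_iota // !nth_iota //.
by move: lt_in; clear; lia.
Qed.

Lemma uniq_points : uniq points.
Proof. by apply: (@map_uniq _ _ rk); rewrite map_rank_points rev_uniq iota_uniq. Qed.

Lemma decreasing_points : pairwise (fun p q => rk q < rk p)%N points.
Proof.
rewrite -(pairwise_map rk (fun i j => j < i)%N) map_rank_points.
rewrite -sorted_pairwise; last by move=> i j k ji kj; apply: ltn_trans ji.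
by rewrite rev_sorted iota_ltn_sorted.
Qed.

Definition right_end d u : bool := (rk (d u) < rk u)%N.

Lemma point_letter_color u : (point_letter u).1 = point_color hm u.
Proof. by case: u. Qed.

Lemma diagram_noncrossing d : is_diagram hm d ->
  noncrossing point_letter d (right_end d) points.
Proof.
case/and3P=> /forallP inv /forallP col /forallP cr.
apply: (rank_noncrossing (rk := rk)).
- exact: uniq_points.
- exact: decreasing_points.
- by move=> u _; have /andP[/eqP-> ->] := inv u; rewrite mem_points.
- by move=> u v _ _; have /forallP := cr u; apply.
- by move=> u _; rewrite !point_letter_color; apply/eqP.
- by rewrite map_letter_points alternating_bent_word.
by [].
Qed.

Lemma noncrossing_right_end d b : noncrossing point_letter d b points ->
  b =1 right_end d.
Proof.
move=> nc u.
by have [-> //] := noncrossing_rank nc uniq_points decreasing_points; apply: mem_points.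
Qed.

Lemma noncrossing_diagram d b : noncrossing point_letter d b points ->
  is_diagram hm d.
Proof.
move=> nc; have [_ cr] := noncrossing_rank nc uniq_points decreasing_points.
have nm := noncrossing_mem nc uniq_points.
have col : {in points, forall u, (point_letter (d u)).1 = (point_letter u).1}.
  elim: nc => {nm cr} // u v p q _ IH dp dq ltq _ _ z; rewrite !(mem_cat, inE).
  case/or4P=> [zu|/eqP->|/eqP->|zv]; try by apply: IH; rewrite mem_cat ?zu ?zv ?orbT.
    by rewrite dq ltq.
  by rewrite dp ltq.
apply/and3P; split.
- by apply/forallP => u; have [_ -> ->] := nm u (mem_points u); rewrite eqxx.
- by apply/forallP => u; rewrite -!point_letter_color col ?mem_points.
by apply/forallP => u; apply/forallP => v; apply: cr; apply: mem_points.
Qed.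

Lemma diagram_invol d : is_diagram hm d -> involutive d.
Proof. by case/andP=> /forallP inv _ u; have /andP[/eqP] := inv u. Qed.

Lemma diagram_neq d u : is_diagram hm d -> d u != u.
Proof. by case/andP=> /forallP inv _; have /andP[] := inv u. Qed.

Lemma diagram_color d u : is_diagram hm d -> point_color hm (d u) = point_color hm u.
Proof. by case/and3P=> _ /forallP col _; apply/eqP. Qed.

Definition code d : seq bool := map (right_end d) points.

Lemma code_valid d : is_diagram hm d -> code d \in half_codes (bent_word n) [::].
Proof. by move=> /diagram_noncrossing /noncrossing_codes; rewrite map_letter_points. Qed.

Lemma code_inj x y : is_diagram hm x -> is_diagram hm y -> code x = code y -> x = y.
Proof.
move=> dx dy cxy; apply/ffunP => u.
apply: (noncrossing_unique (diagram_noncrossing dx) uniq_points decreasing_points).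
- by move=> v _; rewrite diagram_invol // diagram_neq // mem_points.
- by move=> v w _ _; case/and3P: dy => _ _ /forallP /(_ v) /forallP; apply.
- by move=> v vp; move/eq_in_map: cxy => ->.
exact: mem_points.
Qed.

Lemma code_onto c : c \in half_codes (bent_word n) [::] ->
  exists2 d, is_diagram hm d & code d = c.
Proof.
rewrite -map_letter_points => /(half_codes_noncrossing (sts := [::])) /(_ uniq_points).
case=> d [b [/= nc _ bc]]; pose d' : pairing n := [ffun u => d u].
have nc' : noncrossing point_letter d' b points.
  by apply: eq_noncrossing nc => // u _; rewrite ffunE.
exists d'; first exact: noncrossing_diagram nc'.
by rewrite -bc; apply: eq_map => u; rewrite (noncrossing_right_end nc').
Qed.

End Points.

End BoundaryWords.

(** * Stacking of diagrams *)

Section Stack.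
Variables (K : fieldType) (C : tensor_category K) (m : nat) (delta : 'I_m -> K).
Variables (hm : (0 < m)%N) (X : 'I_m -> C).
Variable X' : forall j, dual_data (X j) (delta j).
Variable n : nat.
Variables x y : pairing n.
Hypotheses (dx : is_diagram hm x) (dy : is_diagram hm y).
Local Notation P := (point n + point n)%type.
Local Notation lvl := (level_point n).
Local Notation con := (connect (strand x y)).
Implicit Types (z w : P) (u v : point n) (a b : lvl).

(* The boundary points of x (on the right) and of y (on the left), before the
   top points of x are glued to the bottom points of y. *)
Definition two_letters z : letter m :=
  match z with inl u => point_letter hm u | inr u => point_letter hm u end.
Definition two_pairing z : P :=
  match z with inl u => inl (y u) | inr u => inr (x u) end.
Definition two_ends z : bool :=
  match z with inl u => right_end y u | inr u => right_end x u end.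

Definition outer_right : seq P := [seq inr (inr i) | i <- enum 'I_n].
(** Reversed so that the pair of index 0, where the two bent rows touch, comes last and is
    contracted first. *)
Definition glued : seq (P * P) :=
  rev [seq (inr (inl i), inl (inr i)) | i <- enum 'I_n].
Definition outer_left : seq P := rev [seq inl (inl i) | i <- enum 'I_n].
Local Notation both := (full_row outer_right glued outer_left).

Lemma bothE : both = map inr (points n) ++ map inl (points n).
Proof.
rewrite /full_row /points /outer_right /glued /outer_left !map_cat !map_rev revK.
rewrite -!catA -!map_comp.
by [].
Qed.

Lemma mem_both z : z \in both.
Proof. by rewrite bothE mem_cat; case: z => u; rewrite map_f ?mem_points ?orbT. Qed.

Lemma uniq_both : uniq both.
Proof.
rewrite bothE cat_uniq !map_inj_uniq ?uniq_points ?andbT /=; try by move=> ? ? [].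
by apply/hasPn => _ /mapP[u _ ->]; apply/negP => /mapP[].
Qed.

Lemma noncrossing_both : noncrossing two_letters two_pairing two_ends both.
Proof.
rewrite bothE; apply: noncrossing_cat.
  by apply: noncrossing_map (diagram_noncrossing dx).
by apply: noncrossing_map (diagram_noncrossing dy).
Qed.

Lemma glued_letters :
  {in glued, forall e, two_letters e.1 = flip (two_letters e.2)}.
Proof. by move=> e; rewrite mem_rev => /mapP[i _ ->] /=; rewrite flipK. Qed.

Definition outer_point u : P :=
  match u with inl i => inl (inl i) | inr i => inr (inr i) end.

Lemma outerE : outer_right ++ outer_left = map outer_point (points n).
Proof. by rewrite /points map_cat map_rev -!(map_comp outer_point). Qed.

Lemma mem_outer u : outer_point u \in outer_right ++ outer_left.
Proof. by rewrite outerE map_f // mem_points. Qed.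

Definition level z : lvl :=
  match z with inl u => in_upper u | inr u => in_lower u end.
(** A middle point stands for two glued points; the bottom point of [y] is chosen. *)
Definition lift_level a : P :=
  match a with inl u => inl u | inr i => inr (inr i) end.

Lemma lift_levelK : cancel lift_level level. Proof. by case. Qed.
Lemma lift_level_outer u : lift_level (outer u) = outer_point u. Proof. by case: u. Qed.
Lemma level_outer u : level (outer_point u) = outer u. Proof. by case: u. Qed.

Lemma strandP a b : reflect
  ((exists u, a = in_upper u /\ b = in_upper (y u)) \/
   (exists u, a = in_lower u /\ b = in_lower (x u))) (strand x y a b).
Proof.
apply: (iffP orP) => -[].
- by case/existsP=> u /andP[/eqP-> /eqP->]; left; exists u.
- by case/existsP=> u /andP[/eqP-> /eqP->]; right; exists u.
- by case=> u [-> ->]; left; apply/existsP; exists u; rewrite !eqxx.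
- by case=> u [-> ->]; right; apply/existsP; exists u; rewrite !eqxx.
Qed.

Lemma strand_sym : connect_sym (strand x y).
Proof.
apply: sym_connect_sym => a b; apply/strandP/strandP.
all: case=> -[u [-> ->]]; [left; exists (y u) | right; exists (x u)].
all: by rewrite (diagram_invol dx, diagram_invol dy).
Qed.

Definition level_color a : 'I_m :=
  match a with
  | inl u => point_color hm u
  | inr i => (coloring hm i).1
  end.

Lemma connect_color a b : con a b -> level_color a = level_color b.
Proof.
case/connectP => s; elim: s a => [|c s IH] a /= => [_ -> //|].
case/andP=> /strandP ac /IH{}IH /IH <-; case: ac => -[u [-> ->]] /=.
  by rewrite diagram_color.
have lowE (v : point n) : level_color (in_lower v) = point_color hm v by case: v.
by rewrite !lowE diagram_color.
Qed.

(** The components of the glued graph are the connected components of [strand], so open ones give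
    the stacked diagram and closed ones the loops. *)
Lemma stack_matching :
  [/\ is_diagram hm (stack x y) &
  plugs n n (Fun (half_diagram X' (map two_letters (map inr (points n) ++ map inl (points n)))
                    (code x ++ code y) [::])) =
  fscale (loop_factor hm delta x y)
    (Fun (half_diagram X' (bent_word hm n) (code (stack x y)) [::]))].
Proof.
have [d' [b' [r [lp [nc' sem' [rE rG rO rR rRo lpU lpM rS]]]]]] :=
  plugs_matching X' noncrossing_both uniq_both glued_letters.
have nm := noncrossing_mem nc'.
have Uo : uniq (outer_right ++ outer_left).
  by rewrite outerE map_inj_uniq ?uniq_points // => -[i|i] [k|k] // [->].
(* [comp_sound] is applied to connectivity by strands. *)
have [Sr Sd] : {in both, forall z, con (level z) (level (r z))} /\
    {in outer_right ++ outer_left, forall z, con (level z) (level (d' z))}.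
  apply: (rS (fun z w => con (level z) (level w))) => [z|z w|z w w'|z _|e].
  - exact: connect0.
  - by rewrite strand_sym.
  - exact: connect_trans.
  - case: z => u /=; apply/connect1/strandP; [left|right]; by exists u.
  by rewrite mem_rev => /mapP[i _ ->]; apply: connect0.
have rglue i : r (inr (inl i)) = r (inl (inr i)).
  by apply: (rG (_, _)); rewrite mem_rev; apply/mapP; exists i; rewrite ?mem_enum.
have r_level z : r (lift_level (level z)) = r z by case: z => [u|[i|i]] //=; rewrite rglue.
have rstrand a b : strand x y a b -> r (lift_level a) = r (lift_level b).
  case/strandP=> -[u [-> ->]]; first by rewrite -(rE (inl u) (mem_both _)).
  rewrite -[in_lower u]/(level (inr u)) -[in_lower (x u)]/(level (inr (x u))).
  by rewrite !r_level -(rE (inr u) (mem_both _)).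
(* Thus [r] classifies components exactly: it is constant along strands, and each point is connected
   to its representative. *)
have rcon a b : con a b = (r (lift_level a) == r (lift_level b)).
  apply/idP/eqP => [/connectP[s]|rab].
    by elim: s a => [|c s IH] a /= => [_ -> //|/andP[/rstrand->] /IH].
  apply: (connect_trans (y := level (r (lift_level a)))).
    by have := Sr _ (mem_both (lift_level a)); rewrite lift_levelK.
  by rewrite rab strand_sym; have := Sr _ (mem_both (lift_level b)); rewrite lift_levelK.
have outerP z : z \in outer_right ++ outer_left -> exists u, z = outer_point u.
  by rewrite outerE => /mapP[u _ ->]; exists u.
have outer_inj : injective outer_point by move=> [i|i] [k|k] // [->].
have stackE u : outer_point (stack x y u) = d' (outer_point u).
  have [du ddu duu] := nm Uo _ (mem_outer u); have [v vE] := outerP _ du.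
  rewrite ffunE; case: pickP => [w /andP[wu]|/(_ v)] /=.
    rewrite rcon !lift_level_outer => /eqP /rO [||/outer_inj wu'|//]; rewrite ?mem_outer //.
    by rewrite wu' eqxx in wu.
  have := Sd _ (mem_outer u); rewrite vE !level_outer => ->; rewrite andbT => /eqP vu.
  by rewrite vE vu eqxx in duu.
pose back z : point n :=
  match z with inl (inl i) => inl i | inl (inr i) => inr i
             | inr (inl i) => inl i | inr (inr i) => inr i end.
have backK : cancel outer_point back by case.
have nc_st : noncrossing (@point_letter m hm n) (stack x y) (b' \o outer_point) (points n).
  have -> : points n = map back (outer_right ++ outer_left).
    by rewrite outerE -map_comp (eq_map backK) map_id.
  apply: noncrossing_map nc' => z /outerP[u ->]; rewrite /= backK.
  by split=> //; [rewrite -stackE backK | case: u].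
split; first exact: noncrossing_diagram nc_st.
have sz_out : size outer_right = n by rewrite size_map size_enum_ord.
have sz_gl : size glued = n by rewrite size_rev size_map size_enum_ord.
move: sem'; rewrite sz_out sz_gl {1}/matching_functional.
have -> : map two_letters both = map two_letters (map inr (points n) ++ map inl (points n)).
  by rewrite bothE.
have -> : map two_ends both = code x ++ code y.
  by rewrite bothE map_cat -!map_comp.
move=> ->; congr fscale; last first.
  rewrite /matching_functional outerE -!map_comp -map_letter_points.
  have -> : map (two_letters \o outer_point) (points n) =
      map (@point_letter m hm n) (points n).
    by apply: eq_map => -[].
  have -> // : map (b' \o outer_point) (points n) = code (stack x y).
  by apply: eq_map => u; rewrite (noncrossing_right_end nc_st).
pose mid (i : 'I_n) : P := inl (inr i).
have mid_inj : injective mid by move=> i k [].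
have lp_mid p : p \in lp -> exists i, p = mid i.
  case/lpM => pm _; move: pm; rewrite map_rev mem_rev -map_comp => /mapP[i _ ->].
  by exists i.
pose li := [seq i <- enum 'I_n | mid i \in lp].
have lpE : perm_eq lp (map mid li).
  apply: uniq_perm => //; first by rewrite map_inj_uniq // filter_uniq // enum_uniq.
  move=> p; apply/idP/mapP => [plp|[k]].
    have [i pE] := lp_mid p plp; exists i => //.
    by rewrite mem_filter -pE plp mem_enum.
  by rewrite mem_filter => /andP[ilp _] ->.
rewrite (perm_big _ lpE) big_map /=.
pose rt i := fingraph.root (strand x y) (middle i).
have con_rt i : con (middle i) (rt i) by apply: connect_root.
have no_outer i u : i \in li -> ~~ con (middle i) (outer u).
  rewrite mem_filter => /andP[ilp _]; apply/negP; rewrite rcon lift_level_outer => /eqP ri.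
  have [_ rmid] := lpM _ ilp; have := rRo _ (mem_outer u).
  rewrite -ri rmid => /outerP[[k|k]] //.
have rt_mid i : i \in li -> exists k, rt i = middle k.
  move=> ili; case E: (rt i) => [[k|k]|k].
  - by have /negP[] := no_outer i (inl k) ili; rewrite -[outer _]E.
  - by exists k.
  - by have /negP[] := no_outer i (inr k) ili; rewrite -[outer _]E.
(* [lp] and [is_loop] pick possibly different middle points on the same loops; [rho] passes to the
   root, bijectively and without change of color. *)
pose rho i := if rt i is inl (inr k) then k else i.
have rhoE i : i \in li -> rt i = middle (rho i).
  by rewrite /rho => /rt_mid[k ->].
rewrite /loop_factor -[RHS]big_filter.
transitivity (\prod_(i <- map rho li) delta (coloring hm i).1).
  rewrite big_map [LHS]big_seq [RHS]big_seq; apply: eq_bigr => i ili.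
  by have := connect_color (con_rt i); rewrite rhoE // => E; congr delta.
apply: perm_big; apply: uniq_perm.
- rewrite map_inj_in_uniq; first exact: filter_uniq (enum_uniq _).
  move=> i k ili kli rik.
  have : con (middle i) (middle k).
    apply: connect_trans (con_rt i) _; rewrite rhoE // rik -rhoE //.
    by rewrite strand_sym con_rt.
  rewrite rcon => /eqP; move: ili kli; rewrite !mem_filter => /andP[ilp _] /andP[klp _].
  by rewrite /= -!/(mid _); have [_ ->] := lpM _ ilp; have [_ ->] := lpM _ klp => /mid_inj.
- by rewrite filter_uniq // /index_enum -enumT enum_uniq.
move=> k; rewrite mem_filter mem_index_enum andbT; apply/mapP/idP => [[i ili ->]|].
  apply/andP; split; rewrite -rhoE //; last first.
    apply/forallP => u; apply: contra (no_outer i u ili).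
    exact: connect_trans (con_rt i).
  by rewrite /rt root_root //; apply: strand_sym.
case/andP=> /eqP rk /forallP nok.
have := rR _ (mem_both (mid k)); rewrite mem_cat => /orP[/outerP[u ru]|].
  by have /negP[] := nok u; have := Sr _ (mem_both (mid k)); rewrite ru level_outer.
move=> rlp; have [i iE] := lp_mid _ rlp.
have ili : i \in li by rewrite mem_filter -iE rlp mem_enum.
exists i => //; suff [] : middle k = middle (rho i) by [].
rewrite -rhoE // -{1}rk /rt.
apply/eqP; rewrite (root_connect strand_sym) rcon /= -/(mid k) -/(mid i) iE.
by rewrite iE in rlp; have [_ ->] := lpM _ rlp.
Qed.

End Stack.

(** * Reading a diagram *)

Section Reading.
Variables (K : fieldType) (C : tensor_category K) (m : nat) (delta : 'I_m -> K).
Variables (hm : (0 < m)%N) (X : 'I_m -> C).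
Variable X' : forall j, dual_data (X j) (delta j).
Local Notation L := (letter_obj X').
Local Notation row := (row X').
Local Notation W := (W_factor hm X').
Local Notation half_diagram := (half_diagram X').
Local Notation top_word := (top_word hm).
Local Notation capL Z a b := (capZ Z (cap X' a b)).
Local Notation cupL Z a b := (cupZ Z (cup X' a b)).

(* [tprod W n] and [row 𝟙 (top_word n)] are the same object, but only
   propositionally. *)
Fixpoint to_tprod n : hom (row 𝟙 (top_word n)) (tprod W n) :=
  if n is n'.+1 then to_tprod n' ⊠ idm _ else idm _.

Fixpoint of_tprod n : hom (tprod W n) (row 𝟙 (top_word n)) :=
  if n is n'.+1 then of_tprod n' ⊠ idm _ else idm _.

Lemma to_tprodK n : of_tprod n ∘ to_tprod n = idm _.
Proof. by elim: n => [|n IHn] /=; rewrite ?comp1m // -whisk_comp IHn tmor1. Qed.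

Lemma of_tprodK n : to_tprod n ∘ of_tprod n = idm _.
Proof. by elim: n => [|n IHn] /=; rewrite ?comp1m // -whisk_comp IHn tmor1. Qed.

Fixpoint row_code (closes : nat -> bool) n : seq bool :=
  if n is n'.+1 then closes n' :: row_code closes n' else [::].

Lemma row_codeE closes n : row_code closes n = rev (map closes (iota 0 n)).
Proof.
elim: n => // n IHn; rewrite [row_code _ _]/= IHn -[in RHS]addn1 iotaD map_cat rev_cat.
by rewrite add0n.
Qed.

(** Both recursions peel off the last letter. With [v] general, the induction reaches the open
    strings present before that letter: one more if it closes an arc, one fewer if not. *)
Lemma read_topE closes n v : row_code closes n \in half_codes (top_word n) v ->
  read_top hm X' closes n =
  @TopReading _ _ _ _ hm _ X' n v
    (half_diagram (top_word n) (row_code closes n) v ∘ of_tprod n).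
Proof.
elim: n v => [|n IHn] v.
  by case: v => [|b v] //= _; rewrite comp1m.
rewrite [row_code _ _]/= [top_word _]/=; case E: (closes n).
  rewrite mem_half_codes_true => /IHn {}IHn; rewrite [LHS]/= IHn E /= whisk_comp !compA.
  by rewrite /capZ -lock.
rewrite mem_half_codes_false; case: v => [|b v] // /andP[/eqP[eb] /IHn {}IHn].
subst b.
rewrite [LHS]/= IHn E /= open_stringE; congr existT.
exact: whisk_comp.
Qed.

Lemma half_diagram_flip a s c v :
  half_diagram (flip a :: s) (true :: c) v =
  capL (row 𝟙 v) a (flip a) ∘ (half_diagram s c (a :: v) ⊠ idm _).
Proof. by case: a => j []. Qed.

(** Bending exchanges left and right ends of target arcs and turns the lower ends of through strings
    into right ends, whence [negb]. The bent word starts with the leftmost target letter, so its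
    reading follows [read_bottom] and leaves the through strings [v] to be met by [rest]. *)
Lemma read_bottomE closes n rest c :
    catrev (row_code (negb \o closes) n) c \in
      half_codes (catrev (map (@flip m) (top_word n)) rest) [::] ->
  exists v (g : hom (row 𝟙 v) (tprod W n)),
    [/\ read_bottom hm X' closes n = @BottomReading _ _ _ _ hm _ X' n v g,
        c \in half_codes rest v &
        half_diagram (catrev (map (@flip m) (top_word n)) rest)
          (catrev (row_code (negb \o closes) n) c) [::] =
        bend (Y := 𝟙) (of_tprod n ∘ g ∘ half_diagram rest c v)].
Proof.
elim: n rest c => [|n IHn] rest c.
  by move=> cin; exists [::], (idm 𝟙); split=> //=; rewrite !comp1m.
move=> /(IHn (flip (coloring hm n) :: rest) ((negb \o closes) n :: c)).
case=> v [g [rg cin hd]] {IHn}.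
have -> : half_diagram (catrev (map (@flip m) (top_word n.+1)) rest)
    (catrev (row_code (negb \o closes) n.+1) c) [::] = 
  half_diagram (catrev (map (@flip m) (top_word n)) (flip (coloring hm n) :: rest))
    (catrev (row_code (negb \o closes) n) ((negb \o closes) n :: c)) [::] by [].
rewrite {}hd [read_bottom _ _ _ _]/= rg; move: cin.
rewrite -[(negb \o closes) n]/(~~ closes n).
set w := coloring hm n; case: (closes n); rewrite [~~ _]/=.
  rewrite mem_half_codes_false; case: v g {rg} => [|a v] g //.
  case/andP=> /eqP[ea] cin; subst a.
  exists v, ((g ⊠ idm (L w)) ∘ cupL (row 𝟙 v) (flip w) w); split=> //.
    by rewrite /cupZ -lock !compA.
  apply: (congr1 (@bend _ _ _ _ _ X' 𝟙 𝟙 (top_word n) (flip w :: rest))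
    (y := capL (row 𝟙 (top_word n)) w (flip w) ∘ (((of_tprod n ⊠ idm (L w)) ∘
      ((g ⊠ idm (L w)) ∘ cupL (row 𝟙 v) (flip w) w) ∘ half_diagram rest c v) ⊠ idm _))).
  rewrite half_diagram_false.
  rewrite !whisk_comp !compA capZ_natural (compE2 _ (capZ_natural _ _)) !compA.
  by rewrite (compE2 _ (zigzag_right X' _ (opp_flipr w))) compm1.
rewrite mem_half_codes_true flipK => cin.
exists (w :: v), (g ⊠ idm (L w)); split=> //.
apply: (congr1 (@bend _ _ _ _ _ X' 𝟙 𝟙 (top_word n) (flip w :: rest))
  (y := capL (row 𝟙 (top_word n)) w (flip w) ∘ (((of_tprod n ⊠ idm (L w)) ∘
    (g ⊠ idm (L w)) ∘ half_diagram rest c (w :: v)) ⊠ idm _))).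
rewrite half_diagram_flip.
by rewrite !whisk_comp !compA capZ_natural (compE2 _ (capZ_natural _ _)) !compA.
Qed.

Section Diagrams.
Variable n : nat.
Implicit Types d x y : pairing n.
Local Notation bent_word := (bent_word hm).
Local Notation read := (read hm X').

Lemma right_end_top d (i : 'I_n) : right_end d (inl i) = closes_top d i.
Proof.
rewrite /closes_top; apply/idP/existsP => [lt1|[k /existsP[l /and3P[kl /eqP li /eqP dl]]]].
  move: lt1; rewrite /right_end /=; case E: (d (inl i)) => [k|k] /=.
    by move=> ki; exists k; apply/existsP; exists i; rewrite ki eqxx E eqxx.
  by have := ltn_ord i; clear; lia.
by rewrite /right_end -(val_inj li) dl.
Qed.

Lemma right_end_bottom d (i : 'I_n) : is_diagram hm d ->
  right_end d (inr i) = ~~ closes_bottom d i.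
Proof.
move=> dd; rewrite /right_end; apply/idP/negP => [lt1|nex].
  case/existsP=> k /existsP[l /and3P[kl /eqP/val_inj li /eqP dl]]; subst l.
  by move: lt1; rewrite dl /=; have := ltn_ord i; move: kl; clear; lia.
case E: (d (inr i)) => [k|k] /=; first by have := ltn_ord k; clear; lia.
have ki : (k == i :> nat) = false.
  by apply/eqP => /val_inj ki; have := diagram_neq (inr i) dd; rewrite E ki eqxx.
have ki' : (k < i)%N = false.
  apply/negP => lt_ki; case: nex; apply/existsP; exists k; apply/existsP; exists i.
  by rewrite lt_ki eqxx E eqxx.
by have := ltn_ord i; have := ltn_ord k; move: ki ki'; clear; lia.
Qed.

Lemma codeE d : is_diagram hm d ->
  code d = catrev (row_code (negb \o closes_bottom d) n) (row_code (closes_top d) n).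
Proof.
move=> dd; rewrite /code (map_points (G := negb \o closes_bottom d) (H := closes_top d)).
- by rewrite !row_codeE catrevE revK.
- by move=> i; rewrite right_end_bottom.
exact: right_end_top.
Qed.

Definition row_read d : hom (row 𝟙 (top_word n)) (row 𝟙 (top_word n)) :=
  of_tprod n ∘ read d ∘ to_tprod n.

Lemma diagram_reading d : is_diagram hm d ->
  exists v (g : hom (row 𝟙 v) (tprod W n)),
    let f := half_diagram (top_word n) (row_code (closes_top d) n) v in
    [/\ read_bottom hm X' (closes_bottom d) n = @BottomReading _ _ _ _ hm _ X' n v g,
        row_code (closes_top d) n \in half_codes (top_word n) v,
        row_read d = of_tprod n ∘ g ∘ f &
        half_diagram (bent_word n) (code d) [::] = bend (Y := 𝟙) (row_read d)].
Proof.
move=> dd; have := code_valid dd; rewrite codeE // => cin.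
have [v [g [rg tin hd]]] := read_bottomE cin.
have E : row_read d =
    of_tprod n ∘ g ∘ half_diagram (top_word n) (row_code (closes_top d) n) v.
  rewrite /row_read /Defs.read (read_topE tin) rg /=.
  case: eqP => // e; rewrite (eq_axiomK e) /= !compA.
  by rewrite (compE2 _ (to_tprodK n)) compm1.
by exists v, g; split; rewrite ?hd ?E.
Qed.

Lemma half_diagram_bend d : is_diagram hm d ->
  half_diagram (bent_word n) (code d) [::] = bend (Y := 𝟙) (row_read d).
Proof. by case/diagram_reading => v [g []]. Qed.

(** The juxtaposition of the two bent diagrams is contracted in two ways: [stack_matching] gives the
    stacked diagram with its loops, while [half_diagram_cat] and [plugs_unbend] give the bent
    composite. Bending is injective. *)
Lemma read_stack x y : is_diagram hm x -> is_diagram hm y ->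
  read x ∘ read y = loop_factor hm delta x y *: read (stack x y).
Proof.
move=> dx dy; have [ds plg] := stack_matching X' dx dy.
have [v [g [rg tin Ex hx]]] := diagram_reading dx.
have hy := half_diagram_bend dy.
have hs := half_diagram_bend ds.
pose rest := top_word n ++ bent_word n.
have wE : map (@two_letters m hm n) (map inr (points n) ++ map inl (points n)) =
    catrev (map (@flip m) (top_word n)) rest.
  rewrite map_cat -!map_comp /rest catrevE catA -catrevE -/(bent_word n).
  by congr (_ ++ _); rewrite -map_letter_points; apply: eq_map.
have cE : code x ++ code y = catrev (row_code (negb \o closes_bottom x) n)
    (row_code (closes_top x) n ++ code y).
  by rewrite (codeE dx) !catrevE catA.
have cin : catrev (row_code (negb \o closes_bottom x) n)
    (row_code (closes_top x) n ++ code y) \in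
    half_codes (catrev (map (@flip m) (top_word n)) rest) [::].
  rewrite -cE -wE -bothE; have -> : code x ++ code y =
      map (two_ends x y) (full_row (outer_right n) (glued n) (outer_left n)).
    by rewrite bothE map_cat -!map_comp.
  exact: noncrossing_codes (noncrossing_both dx dy).
move: plg; rewrite wE cE.
(* The target row of [x] is read in the same way whatever follows, so [v'] and [g'] agree with [v]
   and [g]. *)
have [v' [g' [rg' _ ->]]] := read_bottomE cin.
move: rg'; rewrite rg => e; have ev : v = v' := congr1 (@projT1 _ _) e; subst v'.
have <- : g = g' by have := projT2_eq e; rewrite (eq_axiomK (projT1_eq e)).
rewrite /rest (half_diagram_cat X' _ _ tin) hy !compA -Ex.
set by_ := bend (row_read y).
pose G := Fun (row_map X' by_ (top_word n) ∘ row_cat X' 𝟙 (top_word n) (bent_word n)).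
have -> : Fun (bend (Y := 𝟙) (row_read x ∘ row_map X' by_ (top_word n) ∘
    row_cat X' 𝟙 (top_word n) (bent_word n))) = fbend (Y := 𝟙) (post (row_read x) G).
  by rewrite /fbend /post /G /= compA.
have plugs_post i k F : plugs i k (post (row_read x) F) = post (row_read x) (plugs i k F).
  by elim: k F => //= k IHk F; rewrite plug_post IHk.
have := plugs_fbend 0 n (post (row_read x) G); rewrite size_top_word addn0 => ->.
have := plugs_unbend (w := top_word n) (s := top_word n) by_.
rewrite size_top_word {2}/by_ bendK => plG.
rewrite plugs_post plG hs => /Fun_inj /=.
rewrite -bendZ => /(can_inj (@bendK _ _ _ _ _ _ _ _ _ _)) E.
apply: (can_inj (f := fun f => of_tprod n ∘ f ∘ to_tprod n)
  (g := fun h => to_tprod n ∘ h ∘ of_tprod n)) => [f|].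
  rewrite !compA of_tprodK comp1m (compE2 _ (of_tprodK n)) compm1 //.
rewrite compZr compZl -/(row_read _) -E /row_read !compA.
by rewrite (compE2 _ (of_tprodK n)) compm1.
Qed.

End Diagrams.

End Reading.

(** * Identity diagrams and added strings *)

Section AddString.
Variables (m : nat) (hm : (0 < m)%N).

Lemma id_diagram n : is_diagram hm (id_pairing n).
Proof.
apply/and3P; split; apply/forallP => u; rewrite !ffunE.
- by case: u => i; rewrite /= eqxx.
- by case: u.
apply/forallP => v; rewrite !ffunE; apply/negP => /and3P[].
case: u v => i [k|k] /=; have := ltn_ord i; have := ltn_ord k; clear; lia.
Qed.

Variable n : nat.
Implicit Types (d : pairing n) (u v : point n).

Lemma widen_lift (i : 'I_n) : widen_ord (leqnSn n) i = lift ord_max i.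
Proof. by apply/val_inj; rewrite /= /bump leqNgt ltn_ord. Qed.

Lemma narrow_widen u : narrow_point (widen_point u) = Some u.
Proof. by case: u => i; rewrite /= widen_lift liftK. Qed.

Lemma widen_inj : injective (@widen_point n).
Proof. by move=> u v uv; have := narrow_widen u; rewrite uv narrow_widen => -[]. Qed.

Lemma add_string_widen d u : add_string d (widen_point u) = widen_point (d u).
Proof. by rewrite ffunE narrow_widen. Qed.

Lemma add_string_inl d : add_string d (inl ord_max) = inr ord_max.
Proof. by rewrite ffunE /= unlift_none /= ffunE. Qed.

Lemma add_string_inr d : add_string d (inr ord_max) = inl ord_max.
Proof. by rewrite ffunE /= unlift_none /= ffunE. Qed.

Variant point_spec : point n.+1 -> Type :=
| PointWiden (u : point n) : point_spec (widen_point u)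
| PointInl : point_spec (inl ord_max)
| PointInr : point_spec (inr ord_max).

Lemma pointP (u : point n.+1) : point_spec u.
Proof.
case: u => i; case: (unliftP ord_max i) => [k ->|->]; try by constructor.
  by rewrite -widen_lift; exact: (PointWiden (inl k)).
by rewrite -widen_lift; exact: (PointWiden (inr k)).
Qed.

(** The ends of the added string have the ranks [n] and [n.+1], so later ranks move up by two. *)
Definition skip_two k := (if k < n then k else k.+2)%N.

Lemma skip_two_lt i k : (skip_two i < skip_two k)%N = (i < k)%N.
Proof. by rewrite /skip_two; do 2! case: ifP; clear; lia. Qed.

Lemma skip_two_cases k : (skip_two k < n)%N \/ (n.+1 < skip_two k)%N.
Proof. by rewrite /skip_two; case: ifP; clear; lia. Qed.

Lemma rank_widen u : boundary_rank (widen_point u) = skip_two (boundary_rank u).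
Proof.
rewrite /skip_two; case: u => i /=; first by rewrite ltn_ord.
by have := ltn_ord i; case: ifP; clear; lia.
Qed.

Lemma widen_color u : point_color hm (widen_point u) = point_color hm u.
Proof. by case: u. Qed.

Lemma add_string_diagram d : is_diagram hm d -> is_diagram hm (add_string d).
Proof.
case/and3P=> /forallP inv /forallP col /forallP cr; apply/and3P; split.
- apply/forallP => u; case: (pointP u) => [{}u||].
  + have /andP[/eqP ddu du] := inv u.
    by rewrite !add_string_widen ddu eqxx (inj_eq widen_inj).
  + by rewrite add_string_inl add_string_inr eqxx.
  + by rewrite add_string_inr add_string_inl eqxx.
- apply/forallP => u; case: (pointP u) => [{}u||].
  + by rewrite add_string_widen !widen_color.
  + by rewrite add_string_inl.
  + by rewrite add_string_inr.
apply/forallP => u; apply/forallP => v; case: (pointP u) => [{}u||].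
- rewrite add_string_widen rank_widen; case: (pointP v) => [w||].
  + by rewrite add_string_widen !rank_widen !skip_two_lt; have /forallP := cr u.
  + rewrite add_string_inl rank_widen /=.
    by have := skip_two_cases (boundary_rank (d u)); clear; lia.
  rewrite add_string_inr rank_widen /=.
  by have := skip_two_cases (boundary_rank u); clear; lia.
- by rewrite add_string_inl /=; move: (boundary_rank v); clear=> k; lia.
by rewrite add_string_inr /=; move: (boundary_rank v); clear=> k; lia.
Qed.

Lemma closes_top_add d i : (i < n)%N -> closes_top (add_string d) i = closes_top d i.
Proof.
move=> lt_in; apply/existsP/existsP => -[k /existsP[l /and3P[kl /eqP li /eqP dl]]].
  have E : inl l = widen_point (inl (Ordinal lt_in)) :> point n.+1.
    by congr inl; apply/val_inj; exact: li.
  move: dl; rewrite E add_string_widen; case Ed: (d _) => [k'|//] /= [kk'].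
  exists k'; apply/existsP; exists (Ordinal lt_in); rewrite Ed !eqxx !andbT.
  by move: kl; rewrite li -kk'.
exists (widen_ord (leqnSn n) k); apply/existsP; exists (widen_ord (leqnSn n) l).
by apply/and3P; split; [exact: kl | exact/eqP/li | rewrite (add_string_widen d (inl l)) dl].
Qed.

Lemma closes_bottom_add d i : (i < n)%N ->
  closes_bottom (add_string d) i = closes_bottom d i.
Proof.
move=> lt_in; apply/existsP/existsP => -[k /existsP[l /and3P[kl /eqP li /eqP dl]]].
  have E : inr l = widen_point (inr (Ordinal lt_in)) :> point n.+1.
    by congr inr; apply/val_inj; exact: li.
  move: dl; rewrite E add_string_widen; case Ed: (d _) => [//|k'] /= [kk'].
  exists k'; apply/existsP; exists (Ordinal lt_in); rewrite Ed !eqxx !andbT.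
  by move: kl; rewrite li -kk'.
exists (widen_ord (leqnSn n) k); apply/existsP; exists (widen_ord (leqnSn n) l).
by apply/and3P; split; [exact: kl | exact/eqP/li | rewrite (add_string_widen d (inr l)) dl].
Qed.

Lemma closes_top_last d : closes_top (add_string d) n = false.
Proof.
apply/existsP => -[k /existsP[l /and3P[_ /eqP ln /eqP]]].
have -> : l = ord_max by apply/val_inj.
by rewrite add_string_inl.
Qed.

Lemma closes_bottom_last d : closes_bottom (add_string d) n = false.
Proof.
apply/existsP => -[k /existsP[l /and3P[_ /eqP ln /eqP]]].
have -> : l = ord_max by apply/val_inj.
by rewrite add_string_inr.
Qed.

End AddString.

Lemma bijective_of (A B : Type) (f : A -> B) : injective f ->
  (forall y, exists x, f x = y) -> bijective f.
Proof.
move=> fI /choice[g gK]; exists g => // x.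
by apply: fI; rewrite gK.
Qed.

(** * The map [phi] at each level *)

Section Phi.
Variables (K : fieldType) (C : tensor_category K) (m : nat) (delta : 'I_m -> K).
Variables (hm : (0 < m)%N) (X : 'I_m -> C).
Variable X' : forall j, dual_data (X j) (delta j).
Local Notation W := (W_factor hm X').
Local Notation read := (read hm X').

Lemma eq_read_top c c' n : (forall i, (i < n)%N -> c i = c' i) ->
  read_top hm X' c n = read_top hm X' c' n.
Proof.
elim: n => //= n IHn cc'; rewrite IHn ?cc' // => i lt_in.
by apply: cc'; apply: ltnW.
Qed.

Lemma eq_read_bottom c c' n : (forall i, (i < n)%N -> c i = c' i) ->
  read_bottom hm X' c n = read_bottom hm X' c' n.
Proof.
elim: n => //= n IHn cc'; rewrite IHn ?cc' // => i lt_in.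
by apply: cc'; apply: ltnW.
Qed.

Lemma read_add_string n (d : pairing n) : read (add_string d) = read d ⊠ idm (W n).
Proof.
rewrite /Defs.read /= closes_top_last closes_bottom_last.
rewrite (eq_read_top (fun i lt_in => closes_top_add d lt_in)).
rewrite (eq_read_bottom (fun i lt_in => closes_bottom_add d lt_in)).
case: (read_top _ _ _ _) => s f; case: (read_bottom _ _ _ _) => s' g /=.
have [e|ne] := eqVneq s s'; last first.
  have ne' : coloring hm n :: s <> coloring hm n :: s' by case=> /eqP; apply/negP.
  case: (s =P s') => [e|_]; first by rewrite e eqxx in ne.
  by case: (coloring hm n :: s =P coloring hm n :: s') => [//|_]; rewrite tmor0m.
subst s'; case: (coloring hm n :: s =P coloring hm n :: s) => // e; rewrite (eq_axiomK e) /=.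
by case: (s =P s) => // {}e; rewrite (eq_axiomK e) /= whisk_comp.
Qed.

Lemma read_id n : read (id_pairing n) = idm (tprod W n).
Proof.
have ct i : closes_top (id_pairing n) i = false.
  by apply/existsP => -[k /existsP[l /and3P[_ _]]]; rewrite ffunE.
have cb i : closes_bottom (id_pairing n) i = false.
  by apply/existsP => -[k /existsP[l /and3P[_ _]]]; rewrite ffunE.
have tE k : read_top hm X' (closes_top (id_pairing n)) k =
    @TopReading _ _ _ _ hm _ X' k (top_word hm k) (of_tprod hm X' k).
  by elim: k => //= k ->; rewrite ct.
have bE k : read_bottom hm X' (closes_bottom (id_pairing n)) k =
    @BottomReading _ _ _ _ hm _ X' k (top_word hm k) (to_tprod hm X' k).
  by elim: k => //= k ->; rewrite cb.
rewrite /Defs.read tE bE /=; case: eqP => // e; rewrite (eq_axiomK e) /=.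
exact: of_tprodK.
Qed.

Local Notation phi := (@Defs.phi K C m delta hm X X' _).
Local Notation phi_at n := (@Defs.phi K C m delta hm X X' n).

Lemma phiE n (a : diag_tower hm delta n) :
  phi a = \sum_(x : diagram hm n) a x *: read (val x).
Proof. by []. Qed.

Lemma phi_linear n : linear (phi_at n).
Proof.
move=> k a b; rewrite /Defs.phi scaler_sumr -big_split; apply: eq_bigr => x _.
by rewrite !ffunE scalerDl scalerA.
Qed.

HB.instance Definition _ n := GRing.isLinear.Build K _ _ _ (phi_at n) (@phi_linear n).

Lemma phi_vec n (d : pairing n) : is_diagram hm d ->
  phi (diag_vec K hm d) = read d.
Proof.
move=> dd; rewrite /Defs.phi (bigD1 (Sub d dd)) //= ffunE SubK eqxx scale1r.
rewrite big1 ?addr0 // => x; rewrite -val_eqE SubK => /negbTE xd.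
by rewrite ffunE xd scale0r.
Qed.

Lemma phi_tower_morphism : tower_morphism (@Defs.phi K C m delta hm X X').
Proof.
move=> n; split.
- exact: phi_linear.
- by rewrite /= phi_vec ?id_diagram // read_id.
- move=> a b; rewrite /= /diag_mul linear_sum /=.
  rewrite (phiE a) comp_suml; apply: eq_bigr => x _.
  rewrite linear_sum /= compZl (phiE b) comp_sumr scaler_sumr; apply: eq_bigr => y _.
  rewrite linearZ /= phi_vec ?compZr ?read_stack ?(valP x) ?(valP y) //.
    by rewrite !scalerA.
  by have [] := stack_matching X' (valP x) (valP y).
move=> a; rewrite /= /diag_inc linear_sum /= (phiE a) tmor_suml.
apply: eq_bigr => x _; rewrite linearZ /= phi_vec ?read_add_string ?tmorZl //.
by apply: add_string_diagram; apply: valP.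
Qed.

Section Bijective.
Variable n : nat.
Local Notation bent := (bent_word hm n).
Local Notation hd c := (half_diagram X' bent c [::]).
Hypothesis span : forall f, exists x : seq bool -> K,
  f = \sum_(c <- half_codes bent [::]) x c *: hd c.
Hypothesis free : forall x : seq bool -> K,
  \sum_(c <- half_codes bent [::]) x c *: hd c = 0 ->
  forall c, c \in half_codes bent [::] -> x c = 0.

Lemma bend_phi (a : diag_tower hm delta n) :
  bend (w := top_word hm n) (s := top_word hm n) (Y := 𝟙)
    (of_tprod hm X' n ∘ phi a ∘ to_tprod hm X' n) =
  \sum_(x : diagram hm n) a x *: hd (code (val x)).
Proof.
rewrite /Defs.phi comp_sumr comp_suml bend_sum; apply: eq_bigr => x _.
by rewrite compZr compZl bendZ (half_diagram_bend X' (valP x)).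
Qed.

Lemma perm_codes :
  perm_eq [seq code (val x) | x <- index_enum (diagram hm n)] (half_codes bent [::]).
Proof.
apply: uniq_perm; last 1 first.
- move=> c; apply/mapP/idP => [[x _ ->]|/code_onto[d dd <-]].
    exact: code_valid (valP x).
  by exists (Sub d dd); rewrite ?mem_index_enum ?SubK.
- rewrite map_inj_uniq ?index_enum_uniq // => x y.
  by move=> /(code_inj (valP x) (valP y)) /val_inj.
exact: half_codes_uniq.
Qed.

Lemma phi_bijective : bijective (phi_at n).
Proof.
apply: bijective_of => [a b ab|f].
  apply/eqP; rewrite -subr_eq0; apply/eqP/ffunP => x; rewrite [RHS]ffunE.
  set ab' := a - b.
  have ab0 : phi ab' = 0 by rewrite linearB /= ab subrr.
  (* Coefficients on diagrams become coefficients on codes. A code determines its diagram, and the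
     default 0 occurs only off the valid codes. *)
  pose y c := if [pick d : diagram hm n | code (val d) == c] is Some d then ab' d else 0.
  have yE d : y (code (val d)) = ab' d.
    rewrite /y; case: pickP => [e /eqP|/(_ d)]; last by rewrite eqxx.
    by move=> /(code_inj (valP e) (valP d)) /val_inj->.
  rewrite -yE; apply: free; last exact: code_valid (valP x).
  rewrite -(perm_big _ perm_codes) big_map.
  under eq_bigr do rewrite yE.
  by rewrite -bend_phi ab0 compm0 comp0m bend0.
pose g := bend (w := top_word hm n) (s := top_word hm n) (Y := 𝟙)
    (of_tprod hm X' n ∘ f ∘ to_tprod hm X' n).
have [x gx] := span g.
exists [ffun d : diagram hm n => (x (code (val d)) : K^o)].
apply: (can_inj (f := fun f => of_tprod hm X' n ∘ f ∘ to_tprod hm X' n)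
  (g := fun h => to_tprod hm X' n ∘ h ∘ of_tprod hm X' n)) => [h|].
  by rewrite !compA of_tprodK comp1m (compE2 _ (of_tprodK hm X' n)) compm1.
apply: (can_inj (@bendK _ _ _ _ _ X' 𝟙 𝟙 _ _)); rewrite bend_phi -/g gx.
rewrite -(perm_big _ perm_codes) big_map.
by apply: eq_bigr => d _; rewrite ffunE.
Qed.

End Bijective.
End Phi.

(** * Isomorphisms, direct sums and duals of simple objects *)

Section Isomorphisms.
Variables (K : fieldType) (C : tensor_category K).
Implicit Types x y z : C.

Lemma isomorphic_refl x : isomorphic x x.
Proof. exact: inhabits (iso_refl x). Qed.

Lemma isomorphic_sym x y : isomorphic x y -> isomorphic y x.
Proof. by case=> f; exact: inhabits (iso_sym f). Qed.

Lemma isomorphic_trans y x z : isomorphic x y -> isomorphic y z -> isomorphic x z.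
Proof. by case=> f [g]; exact: inhabits (iso_trans f g). Qed.

Lemma isomorphic_tensor x y x' y' : isomorphic x y -> isomorphic x' y' ->
  isomorphic (x ⊗ x') (y ⊗ y').
Proof. by case=> f [g]; exact: inhabits (iso_tensor f g). Qed.

Lemma isomorphic_asc x y z : isomorphic ((x ⊗ y) ⊗ z) (x ⊗ (y ⊗ z)).
Proof. exact: inhabits (iso_asc x y z). Qed.

Lemma isomorphic_run x : isomorphic (x ⊗ 𝟙) x.
Proof. exact: inhabits (iso_sym (iso_runV x)). Qed.

Lemma isomorphic_lun x : isomorphic (𝟙 ⊗ x) x.
Proof. exact: inhabits (Iso (lunK x) (lunVK x)). Qed.

Lemma simple_isomorphic x y : isomorphic x y -> simple x -> simple y.
Proof.
case=> [[f g gf fg]] [x0 xP]; split=> [|h].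
  apply: contraNneq x0 => y0.
  by rewrite -gf -[f]comp1m y0 comp0m compm0.
have [c hc] := xP (g ∘ h ∘ f); exists c.
rewrite -[h]comp1m -[h]compm1 -fg !compA -(compA f g h) -(compA f _ f) hc.
by rewrite compZr compm1 compZl.
Qed.

Definition direct_sum2 x y z : Prop :=
  exists (i1 : hom x z) (p1 : hom z x) (i2 : hom y z) (p2 : hom z y),
    [/\ p1 ∘ i1 = idm x, p2 ∘ i2 = idm y, p1 ∘ i2 = 0, p2 ∘ i1 = 0
      & i1 ∘ p1 + i2 ∘ p2 = idm z].

Lemma direct_sum_pair (s : 'I_2 -> C) z :
  direct_sum s z -> direct_sum2 (s ord0) (s ord_max) z.
Proof.
case=> i [p [pi pi0 sum1]].
exists (i ord0), (p ord0), (i ord_max), (p ord_max); split; rewrite ?pi ?pi0 //.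
by rewrite -sum1 big_ord_recl big_ord1; congr (_ + i _ ∘ p _); apply/val_inj.
Qed.

Lemma direct_sum2_sym x y z : direct_sum2 x y z -> direct_sum2 y x z.
Proof.
case=> i1 [p1 [i2 [p2 [? ? ? ? sum1]]]]; exists i2, p2, i1, p1; split=> //.
by rewrite addrC.
Qed.

Lemma direct_sum2_tensor w x y z : direct_sum2 x y z ->
  direct_sum2 (w ⊗ x) (w ⊗ y) (w ⊗ z).
Proof.
case=> i1 [p1 [i2 [p2 [e1 e2 e3 e4 e5]]]].
exists (idm w ⊠ i1), (idm w ⊠ p1), (idm w ⊠ i2), (idm w ⊠ p2).
by split; rewrite -!lwhisk_comp ?e1 ?e2 ?e3 ?e4 ?tmor1 ?tmorm0 // -tmorDr e5 tmor1.
Qed.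

Lemma direct_sum2_iso x y z z' : isomorphic z z' -> direct_sum2 x y z ->
  direct_sum2 x y z'.
Proof.
case=> [[f g gf fg]] [i1 [p1 [i2 [p2 [e1 e2 e3 e4 e5]]]]].
exists (f ∘ i1), (p1 ∘ g), (f ∘ i2), (p2 ∘ g).
split; rewrite ?compA ?(compE2 _ gf) ?compm1 ?e1 ?e2 ?e3 ?e4 //.
by rewrite -compDl -!(compA f) -compDr e5 compm1.
Qed.

Lemma direct_sum2_isor x y y' z : isomorphic y y' -> direct_sum2 x y z ->
  direct_sum2 x y' z.
Proof.
case=> [[f g gf fg]] [i1 [p1 [i2 [p2 [e1 e2 e3 e4 e5]]]]].
exists i1, p1, (i2 ∘ g), (f ∘ p2).
split; rewrite ?compA ?e1 ?e2 ?e3 ?e4 ?(compE2 _ e2) ?(compE2 _ e4) ?compm1 ?comp0m ?compm0 //.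
by rewrite (compE2 _ gf) compm1.
Qed.

(* The endomorphisms of a dual are the mates of those of the object. *)
Lemma simple_dual (a b : C) (ev : hom (a ⊗ b) 𝟙) (coev : hom 𝟙 (b ⊗ a)) :
  hooks ev coev -> simple a -> simple b.
Proof.
case=> hl hr [a0 aP]; split=> [|f].
  apply: contraNneq a0 => b0.
  have c0 : coev = 0 by rewrite -[coev]comp1m -tmor1 b0 tmor0m comp0m.
  by rewrite -hl c0 tmorm0 !(compm0, comp0m).
(* With [ev'] in place of [ev], the first hook becomes the mate of [f], an endomorphism of [a],
   hence a scalar. *)
pose ev' := ev ∘ (idm a ⊠ f).
have [c gc] := aP (lun a ∘ (ev' ⊠ idm a) ∘ ascV a b a ∘ (idm a ⊠ coev) ∘ runV a).
exists c; apply: lwhisk1_inj => /=.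
pose u := cupZ 𝟙 coev; set h := idm 𝟙 ⊠ f.
have capE : capZ (𝟙 ⊗ b) ev' = capZ (𝟙 ⊗ b) ev ∘ (idm _ ⊠ f).
  rewrite /capZ -!lock /ev' lwhisk_comp !compA.
  by rewrite -(tmor1 (𝟙 ⊗ b) a) (compE2 _ (asc_natural _ _ _)) !compA.
have capu : capZ (𝟙 ⊗ b) ev ∘ (u ⊠ idm b) = idm _ by rewrite hook_right hr tmor1.
have hE : capZ (𝟙 ⊗ b) ev' ∘ (u ⊠ idm b) = h.
  by rewrite capE (compE2 _ (esym (exchange u f))) !compA capu comp1m.
have hu : (h ⊠ idm a) ∘ u = c *: u.
  have := hook_left (𝟙 ⊗ b) ev' coev; rewrite gc tmorZr tmor1 => mE.
  rewrite -hE whisk_comp (compE2 _ (cupZ_natural u coev)) compA mE.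
  by rewrite compZl comp1m.
have <- : capZ (𝟙 ⊗ b) ev ∘ (((h ⊠ idm a) ∘ u) ⊠ idm b) = h.
  by rewrite whisk_comp compA capZ_natural (compE2 _ capu) compm1.
by rewrite hu tmorZl compZr capu tmorZr tmor1.
Qed.

(** Bending one leg of [d] gives a morphism from [b] to [a]. By Schur it would vanish for
    non-isomorphic simple objects, and unbending would give [d = 0]. *)
Lemma dual_isomorphic (a b : C) (ev : hom (a ⊗ b) 𝟙) (coev : hom 𝟙 (b ⊗ a))
    (d : hom 𝟙 (a ⊗ a)) :
  semisimple C -> hooks ev coev -> simple a -> d != 0 -> isomorphic b a.
Proof.
case=> _ _ _ schur hk sa d0; have sb := simple_dual hk sa.
apply: contrapT => /(schur _ _ sb sa) hom0; case/negP: d0; apply/eqP.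
pose h := capZ a ev ∘ (d ⊠ idm b).
have h0 : h = 0 by rewrite -[h]compm1 -(lunK b) compA (hom0 (h ∘ lunV b)) comp0m.
have [hl _] := hk.
have := hook_left a ev coev; rewrite hl tmor1 => E.
rewrite -[d]comp1m -E -compA -(cupZ_natural d coev) compA -whisk_comp -/h h0.
by rewrite tmor0m comp0m.
Qed.

End Isomorphisms.

Section FullSubcategory.
Variables (K : fieldType) (C : tensor_category K) (P : C -> Prop).
Hypotheses (P1 : P 𝟙) (PM : forall x y, P x -> P y -> P (x ⊗ y)).
Local Notation D := (full_subcat P1 PM).

Lemma isomorphic_full (x y : D) : isomorphic x y -> isomorphic (sval x) (sval y).
Proof. by case=> [[f g gf fg]]; exact: inhabits (@Iso K C (sval x) (sval y) f g gf fg). Qed.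

Lemma direct_sum_full n (s : 'I_n -> D) (z : D) :
  direct_sum s z -> direct_sum (fun k => sval (s k)) (sval z).
Proof. by []. Qed.

End FullSubcategory.

(** * Fusion in the free product *)

Section FreeProduct.
Variables (K : fieldType) (m : nat) (t : 'I_m -> K) (C : tensor_category K).
Variables (F : free_product t C) (delta : 'I_m -> K).
Variable X' : forall j, dual_data (fp_gen F j) (delta j).
Local Notation L := (letter_obj X').
Implicit Types (w r : seq ('I_m * nat)) (v : seq (letter m)) (a : letter m).

Definition irr j k : C := sval (fp_spec F j k).

Lemma irr0 j : isomorphic (irr j 0) 𝟙.
Proof. exact: isomorphic_full (TL_unit (fp_factor F j)). Qed.

Lemma irr_fusion j k : direct_sum2 (irr j k) (irr j k.+2) (irr j k.+1 ⊗ irr j 1).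
Proof.
exact: (direct_sum_pair (direct_sum_full (TL_fusionr (fp_factor F j) k))).
Qed.

Lemma unit_simple : simple (𝟙 : C).
Proof. exact: (fp_simple F (w := [::])). Qed.

Lemma gen_simple j : simple (irr j 1).
Proof.
have := fp_simple F (w := [:: (j, 1%N)]) isT; apply: simple_isomorphic.
exact: isomorphic_run.
Qed.

(** The chosen dual is identified with the generator through the Kazhdan-Wenzl morphism [d], which
    is non-zero since it has a left inverse. Starred letters therefore obey the same fusion
    rules. *)
Lemma letter_isomorphic a : isomorphic (L a) (irr a.1 1).
Proof.
case: a => j [] /=; last exact: isomorphic_refl.
have [d [d' [dd _ _ _]]] := TL_kw (fp_factor F j).
have := @dual_isomorphic K C (irr j 1) (dual (X' j)) (eps (X' j)) (teps' (X' j)) d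
  (fp_semisimple F) (dual_hooks (X' j)) (gen_simple j).
apply.
apply/eqP => d0; case: unit_simple => /eqP id0 _; apply: id0.
have <- : @comp K C _ _ _ (d' : hom (irr j 1 ⊗ irr j 1) 𝟙) d = idm (𝟙 : C) := dd.
by rewrite (d0 : (d : hom (𝟙 : C) (irr j 1 ⊗ irr j 1)) = 0) compm0.
Qed.

(** Bracketed like a row, unlike [fp_word], so that tensoring with a letter on the right touches the
    head only. *)
Fixpoint word_obj w : C := if w is s :: w' then word_obj w' ⊗ irr s.1 s.2 else 𝟙.

Lemma word_obj_fp_word w : isomorphic (word_obj w) (fp_word F (rev w)).
Proof.
suff E r : isomorphic (fp_word F (rev w ++ r)) (word_obj w ⊗ fp_word F r).
  apply: isomorphic_sym; have := E [::]; rewrite cats0 => /isomorphic_trans; apply.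
  exact: isomorphic_run.
elim: w r => [|s w IHw] r; first exact/isomorphic_sym/isomorphic_lun.
rewrite rev_cons cat_rcons; apply: isomorphic_trans (IHw _) _.
exact/isomorphic_sym/isomorphic_asc.
Qed.

Lemma reduced_rev w : reduced (rev w) = reduced w.
Proof.
rewrite /reduced all_rev rev_sorted; congr (_ && _).
by apply: eq_sorted => s s'; rewrite eq_sym.
Qed.

Lemma word_obj_simple w : reduced w -> simple (word_obj w).
Proof.
rewrite -reduced_rev => /(fp_simple F); apply: simple_isomorphic.
exact/isomorphic_sym/word_obj_fp_word.
Qed.

Lemma word_obj_inj w r : reduced w -> reduced r ->
  isomorphic (word_obj w) (word_obj r) -> w = r.
Proof.
rewrite -reduced_rev -[reduced r]reduced_rev => rw rr wr.
apply: (can_inj revK); apply: (fp_inj rw rr).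
apply: isomorphic_trans (isomorphic_sym (word_obj_fp_word w)) _.
exact: isomorphic_trans wr (word_obj_fp_word r).
Qed.

(* The reduced word of the leading simple summand of a row of letters. *)
Fixpoint blocks v : seq ('I_m * nat) :=
  if v is a :: v' then
    match blocks v' with
    | (j, k) :: w => if j == a.1 then (j, k.+1) :: w else (a.1, 1%N) :: (j, k) :: w
    | [::] => [:: (a.1, 1%N)]
    end
  else [::].

Lemma blocks_head a v : exists k w, blocks (a :: v) = (a.1, k.+1) :: w.
Proof.
rewrite /=; case: (blocks v) => [|[j k] w]; first by exists 0%N, [::].
by case: eqP => [->|_]; [exists k, w | exists 0%N, ((j, k) :: w)].
Qed.

Lemma blocks_reduced v : reduced (blocks v).
Proof.
elim: v => // a v; rewrite /reduced /=; case: (blocks v) => [|[j k] w] //=.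
case/andP=> /andP[k0 w0] srt; case: eqP => [_|ja] /=.
  by rewrite w0; case: w srt {w0}.
by rewrite k0 w0 srt !andbT /=; apply/eqP => aj; case: ja.
Qed.

(** The total degree of a reduced word recovers the number of letters, so words of different lengths
    have non-isomorphic leading summands. *)
Lemma blocks_size v : sumn (map snd (blocks v)) = size v.
Proof.
elim: v => //= a v <-; case: (blocks v) => [|[j k] w] //=.
by case: ifP.
Qed.

Definition top_obj v : C := word_obj (blocks v).

Lemma top_obj_simple v : simple (top_obj v).
Proof. exact/word_obj_simple/blocks_reduced. Qed.

Lemma top_obj_zero v v' : size v != size v' ->
  forall f : hom (top_obj v) (top_obj v'), f = 0.
Proof.
move=> vv'; have [_ _ _ schur] := fp_semisimple F.
apply: schur; try exact: top_obj_simple.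
move=> /(word_obj_inj (blocks_reduced v) (blocks_reduced v')) bb.
by rewrite -!blocks_size bb eqxx in vv'.
Qed.

(** The fusion hypothesis of the basis theorem for one word, letter and projection, so that
    projections can be chosen separately. *)
Definition fusion_at v a (th : hom (top_obj v ⊗ L a) (top_obj (a :: v))) : Prop :=
  let other := exists i1, th ∘ i1 = idm _ /\ i1 ∘ th = idm _ in
  if v is b :: v' then
    if b.1 == a.1 then
      exists (i1 : hom (top_obj (a :: v)) (top_obj v ⊗ L a))
        (kappa : hom (top_obj v ⊗ L a) (top_obj v'))
        (i2 : hom (top_obj v') (top_obj v ⊗ L a)),
      [/\ th ∘ i1 = idm _, kappa ∘ i2 = idm _, th ∘ i2 = 0,
          kappa ∘ i1 = 0 & i1 ∘ th + i2 ∘ kappa = idm _]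
    else other
  else other.

(** A letter acts on the last block. A new color opens a block of degree 1; the same color sends
    degree [k.+1] to [k.+2] and [k], the lower one giving the leading summand of the word without
    its last letter. *)
Lemma top_obj_fusion v a : exists th, @fusion_at v a th.
Proof.
have other : blocks (a :: v) = (a.1, 1%N) :: blocks v ->
    exists th : hom (top_obj v ⊗ L a) (top_obj (a :: v)),
    exists i1, th ∘ i1 = idm _ /\ i1 ∘ th = idm _.
  rewrite /top_obj => ->; have [f] := letter_isomorphic a.
  have [g1 g2 g21 g12] := iso_tensor (iso_refl (word_obj (blocks v))) f.
  by exists g1, g2.
case: v other => [|b v] other; first exact: other.
rewrite /fusion_at; case: eqP => ba; last first.
  apply: other; have [k [w E]] := blocks_head b v.
  by rewrite [blocks (a :: _)]/= -/(blocks (b :: v)) E; case: eqP.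
(* Lowering a block of degree 1 leaves degree 0, which is no block but a copy of the unit: hence an
   isomorphism instead of an equality. *)
have [k [w [E1 E2]]] : exists k w, blocks (b :: v) = (a.1, k.+1) :: w /\
    isomorphic (word_obj w ⊗ irr a.1 k) (top_obj v).
  rewrite /top_obj /= -ba; case: (blocks v) => [|[j k] w].
    exists 0%N, [::]; split=> //=; apply: isomorphic_trans (isomorphic_run _).
    exact: isomorphic_tensor (isomorphic_refl _) (irr0 _).
  case: eqP => [->|_]; first by exists k, w; split=> //; apply: isomorphic_refl.
  exists 0%N, ((j, k) :: w); split=> //.
  apply: isomorphic_trans (isomorphic_run _).
  exact: isomorphic_tensor (isomorphic_refl _) (irr0 _).
have E3 : blocks [:: a, b & v] = (a.1, k.+2) :: w.
  by rewrite [LHS]/= -/(blocks (b :: v)) E1 eqxx.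
have : direct_sum2 (top_obj [:: a, b & v]) (top_obj v) (top_obj (b :: v) ⊗ L a).
  rewrite {1 3}/top_obj E1 E3 /=; apply: direct_sum2_isor E2 _.
  apply: direct_sum2_sym; apply: direct_sum2_iso (direct_sum2_tensor _ (irr_fusion _ _)).
  apply: isomorphic_trans (isomorphic_sym (isomorphic_asc _ _ _)) _.
  exact: isomorphic_tensor (isomorphic_refl _) (isomorphic_sym (letter_isomorphic a)).
by case=> i1 [th [i2 [ka E]]]; exists th, i1, ka, i2.
Qed.

Definition theta_of v a : hom (top_obj v ⊗ L a) (top_obj (a :: v)) :=
  projT1 (cid (top_obj_fusion v a)).

Lemma bent_basis (s : seq (letter m)) : alternating s -> (forall j, parity j s = false) ->
  (forall f, exists x : seq bool -> K,
     f = \sum_(c <- half_codes s [::]) x c *: half_diagram X' s c [::]) /\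
  (forall x : seq bool -> K,
     \sum_(c <- half_codes s [::]) x c *: half_diagram X' s c [::] = 0 ->
     forall c, c \in half_codes s [::] -> x c = 0).
Proof.
move=> alt_s par_s.
have fus v a : @fusion_at v a (theta_of v a) by exact: projT2 (cid (top_obj_fusion v a)).
have := half_diagram_basis (theta := theta_of) (iso_refl (𝟙 : C)) top_obj_simple
  top_obj_zero fus (v := [::]) alt_s isT par_s.
case=> span free; split=> [f|x sum0].
  have [x fx] := span f; exists x; rewrite fx; apply: eq_bigr => c _.
  by rewrite comp1m.
apply: free; rewrite -[RHS]sum0; apply: eq_bigr => c _.
by rewrite comp1m.
Qed.

Lemma genX_simple (hm : (0 < m)%N) : simple (genX hm X').
Proof.
pose wd := fix wd n :=
  if n is n'.+1 then ((block_letter hm false n').1, 1%N) :: wd n' else [::].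
have E n : isomorphic (word_obj (wd n)) (tprod (fun i => L (block_letter hm false i)) n).
  elim: n => [|n IHn]; first exact: isomorphic_refl.
  exact: isomorphic_tensor IHn
    (isomorphic_sym (letter_isomorphic (block_letter hm false n))).
apply: simple_isomorphic (E m) _; apply: word_obj_simple.
suff : forall n, (n <= m)%N -> reduced (wd n) by apply.
elim=> // n IHn lt_nm; have := IHn (ltnW lt_nm); rewrite /reduced /=.
case: n lt_nm {IHn} => //= n lt_nm /andP[-> ->]; rewrite andbT -val_eqE /=.
by rewrite !modn_small // ?(ltnW lt_nm) // neq_ltn ltnSn orbT.
Qed.

End FreeProduct.

(** * Isomorphisms of inductive limits *)

Section Germs.
Variables (K : fieldType) (A : tower K).
Implicit Types (g h : germ A) (N M : nat).
Local Notation Germ a := (Tagged (fun n => A n) a : germ A).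

Lemma lift_to_tag n (a : A n) : lift_to n (Germ a) = a.
Proof.
by case: n a => [|n] a /=; rewrite (untagE _ _ (erefl (tag (Germ a)))).
Qed.

Lemma lift_to_lift N M g : (tag g <= N)%N -> (N <= M)%N ->
  lift_to M (Germ (lift_to N g)) = lift_to M g.
Proof.
move=> gN NM; apply: (lift_to_eq (N := N)) => //.
exact: lift_to_tag.
Qed.

Lemma pi_eqP g h : \pi_(lim A) g = \pi_(lim A) h <->
  exists N, [/\ (tag g <= N)%N, (tag h <= N)%N & lift_to N g = lift_to N h].
Proof. by split=> [/eqmodP/asboolP//|gh]; apply/eqmodP/asboolP. Qed.

Lemma repr_lift g : exists N, [/\ (tag (repr (\pi_(lim A) g)) <= N)%N, (tag g <= N)%N &
  lift_to N (repr (\pi_(lim A) g)) = lift_to N g].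
Proof. by apply/pi_eqP; rewrite reprK. Qed.

Section Operation.
Variable op : forall n, A n -> A n -> A n.
Hypothesis op_inc : forall n (a b : A n), tow_inc (op a b) = op (tow_inc a) (tow_inc b).

Lemma lift_to_op n (a b : A n) M : (n <= M)%N ->
  lift_to M (Germ (op a b)) = op (lift_to M (Germ a)) (lift_to M (Germ b)).
Proof.
elim: M => [|M IHM]; first by rewrite leqn0 => /eqP n0; subst n; rewrite !lift_to_tag.
rewrite leq_eqVlt => /orP[/eqP n0|]; first by subst n; rewrite !lift_to_tag.
by rewrite ltnS => nM; rewrite !lift_toS // IHM.
Qed.

(** [lim_op] uses chosen representatives at the least level containing both; compatibility with the
    inclusions allows any representatives and any common level. *)
Lemma lim_op_pi g h N : (tag g <= N)%N -> (tag h <= N)%N ->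
  lim_op op (\pi_(lim A) g) (\pi_(lim A) h) = in_lim (op (lift_to N g) (lift_to N h)).
Proof.
move=> gN hN; rewrite /lim_op.
have [N1 [r1 g1 e1]] := repr_lift g; have [N2 [r2 h2 e2]] := repr_lift h.
set g' := repr _ in r1 e1 *; set h' := repr _ in r2 e2 *.
set N' := maxn _ _; pose M := maxn (maxn N N') (maxn N1 N2).
have [NM N'M N1M N2M] : [/\ N <= M, N' <= M, N1 <= M & N2 <= M]%N.
  rewrite /M; split.
  - exact: leq_trans (leq_maxl N N') (leq_maxl _ _).
  - exact: leq_trans (leq_maxr N N') (leq_maxl _ _).
  - exact: leq_trans (leq_maxl N1 N2) (leq_maxr _ _).
  - exact: leq_trans (leq_maxr N1 N2) (leq_maxr _ _).
have [g'N h'N] : (tag g' <= N')%N /\ (tag h' <= N')%N.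
  by split; [apply: leq_maxl | apply: leq_maxr].
apply/pi_eqP; exists M; split => //=.
rewrite !lift_to_op // !lift_to_lift //.
by rewrite (lift_to_eq N1M r1 g1 e1) (lift_to_eq N2M r2 h2 e2).
Qed.

End Operation.

Lemma lim_scale_pi (c : K) g :
  (forall n (a : A n), tow_inc (c *: a) = c *: tow_inc a) ->
  lim_scale c (\pi_(lim A) g) = in_lim (c *: tagged g).
Proof.
move=> inc; have liftZ n (a : A n) M : (n <= M)%N ->
    lift_to M (Germ (c *: a)) = c *: lift_to M (Germ a).
  elim: M => [|M IHM]; first by rewrite leqn0 => /eqP n0; subst n; rewrite !lift_to_tag.
  rewrite leq_eqVlt => /orP[/eqP n0|]; first by subst n; rewrite !lift_to_tag.
  by rewrite ltnS => nM; rewrite !lift_toS // IHM.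
rewrite /lim_scale; have [N [r1 g1 e1]] := repr_lift g.
apply/pi_eqP; exists N; split=> //; rewrite !liftZ //.
by move: e1; case: (repr _) => n a /= ->; case: g {r1 g1}.
Qed.

End Germs.

Section LimitIsomorphism.
Variables (K : fieldType) (A B : tower K) (f : forall n, A n -> B n).
Hypothesis f_mor : tower_morphism f.
Hypothesis f_bij : forall n, bijective (@f n).
Hypothesis B_inc : forall n, linear (fun b : B n => tow_inc b).
Hypothesis B_mul : forall n (a b : B n),
  tow_inc (tow_mul a b) = tow_mul (tow_inc a) (tow_inc b).

Let germ_map (g : germ A) : germ B := Tagged (fun n => B n) (f (tagged g)).

Lemma lift_germ_map N g : (tag g <= N)%N ->
  lift_to N (germ_map g) = f (lift_to N g).
Proof.
case: g => n a /=; elim: N => [|N IHN].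
  by rewrite leqn0 => /eqP n0; subst n; rewrite /germ_map !lift_to_tag.
rewrite leq_eqVlt => /orP[/eqP n0|]; first by subst n; rewrite /germ_map !lift_to_tag.
rewrite ltnS => nN; rewrite !lift_toS // IHN //.
by have [_ _ _ ->] := f_mor N.
Qed.

Lemma lim_map_pi g : lim_map f (\pi_(lim A) g) = \pi_(lim B) (germ_map g).
Proof.
have [N [r1 g1 e1]] := repr_lift g; apply/pi_eqP; exists N; split=> //.
by rewrite !lift_germ_map // e1.
Qed.

Lemma lim_map_op (opA : forall n, A n -> A n -> A n) (opB : forall n, B n -> B n -> B n)
    x y : (forall n (a b : A n), f (opA n a b) = opB n (f a) (f b)) ->
    (forall n (a b : B n), tow_inc (opB n a b) = opB _ (tow_inc a) (tow_inc b)) ->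
  lim_map f (lim_op opA x y) = lim_op opB (lim_map f x) (lim_map f y).
Proof.
move=> fop incop; rewrite {1}/lim_op; set N := maxn _ _.
have [xN yN] : (tag (repr x) <= N)%N /\ (tag (repr y) <= N)%N.
  by split; [apply: leq_maxl | apply: leq_maxr].
rewrite [LHS]lim_map_pi {1}/germ_map /= fop -!lift_germ_map //.
by rewrite -{2}[x]reprK -{2}[y]reprK !lim_map_pi 
  (lim_op_pi incop (g := germ_map (repr x)) (h := germ_map (repr y)) xN yN).
Qed.

Lemma limit_isomorphism_of : limit_isomorphism f.
Proof.
have inj n : injective (@f n) by apply: bij_inj.
split=> //; split.
- by move=> n a; apply: lim_map_pi.
- move=> x y; apply: lim_map_op => n a b.
    by have [lin _ _ _] := f_mor n; have := lin 1 a b; rewrite !scale1r.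
  by have := B_inc 1 a b; rewrite !scale1r.
- move=> c x; rewrite {1}/lim_scale [LHS]lim_map_pi.
  have -> : lim_map f x = \pi_(lim B) (germ_map (repr x)) by rewrite -{1}[x]reprK lim_map_pi.
  rewrite lim_scale_pi; last first.
    move=> n b; have := B_inc c b 0; rewrite addr0 => ->.
    have := B_inc 1 (0 : B n) 0; rewrite !scale1r addr0 => /addr_idem_eq0->.
    by rewrite addr0.
  rewrite /germ_map /=.
  set g := repr x; have [lin _ _ _] := f_mor (tag g).
  have := lin c (tagged g) 0; rewrite addr0 => ->.
  have := lin 1 (0 : A (tag g)) 0; rewrite !scale1r addr0 => /addr_idem_eq0->.
  by rewrite addr0.
- split=> [|x y].
    by rewrite [LHS]lim_map_pi /germ_map /=; have [_ -> _ _] := f_mor 0%N.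
  apply: lim_map_op => n a b; last exact: B_mul.
  by have [_ _ ->] := f_mor n.
apply: bijective_of => [x y|y].
  rewrite -[x]reprK -[y]reprK !lim_map_pi => /pi_eqP[N [xN yN]].
  rewrite !lift_germ_map // => /inj xy.
  by apply/pi_eqP; exists N.
have [h hK fK] := f_bij (tag (repr y)).
exists (in_lim (h (tagged (repr y)))); rewrite [LHS]lim_map_pi /germ_map /= fK.
by rewrite -[RHS]reprK; case: (repr y).
Qed.

End LimitIsomorphism.

(** * Rebracketing into blocks of [m] factors *)

Section EndTower.
Variables (K : fieldType) (C : tensor_category K).
Implicit Types y z : nat -> C.

Lemma end_tower_linear y n : linear (fun f : end_tower y n => tow_inc f).
Proof. by move=> c f g; apply: tmor_linearl. Qed.

Lemma end_tower_mul y n (f g : end_tower y n) :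
  tow_inc (tow_mul f g) = tow_mul (tow_inc f) (tow_inc g).
Proof. exact: whisk_comp. Qed.

Lemma tprod_cat_natural y n k (f : end_tower y n) :
  fwd (tprod_cat y n k) ∘ inc_by k f = (f ⊠ idm _) ∘ fwd (tprod_cat y n k).
Proof.
elim: k => [|k IHk]; first by rewrite /= runV_natural.
rewrite [inc_by _ _]/= /=.
rewrite (compE2 _ (esym (whisk_comp _ _ _))) IHk whisk_comp compA asc_natural.
by rewrite tmor1 compA.
Qed.

End EndTower.

Section Blocks.
Variables (K : fieldType) (C : tensor_category K) (m : nat) (delta : 'I_m -> K).
Variables (hm : (0 < m)%N) (X : 'I_m -> C).
Variable X' : forall j, dual_data (X j) (delta j).
Local Notation W := (W_factor hm X').
Local Notation phi := (@Defs.phi K C m delta hm X X').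
Local Notation FC_phi := (@Defs.FC_phi K C m delta hm X X').

Lemma phi_inc_by k n (a : diag_tower hm delta n) :
  phi (inc_by k a) = inc_by k (phi a).
Proof.
elim: k => //= k <-; have [_ _ _ inc] := phi_tower_morphism hm X' (k + n).
exact: inc.
Qed.

(** [FC_phi] is [phi] conjugated by rebracketing, which turns the addition of [m] strings, one at a
    time, into a single tensoring with the identity of a block. *)
Lemma FC_phi_tower_morphism : tower_morphism FC_phi.
Proof.
move=> k; have [lin one mul _] := phi_tower_morphism hm X' (k * m).
split.
- by move=> x a b; rewrite /Defs.FC_phi lin compDr compDl compZr compZl.
- by rewrite /Defs.FC_phi [phi _]one compm1 bwdK.
- move=> a b; rewrite /Defs.FC_phi [phi _]mul /= !compA.
  by rewrite (compE2 _ (fwdK _)) compm1.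
move=> a; rewrite /Defs.FC_phi [tow_inc a]/= phi_inc_by /=.
set c := tprod_block _ k; set e := iso_eq _; set d := tprod_cat _ _ _.
rewrite -(compA _ (fwd d)) (tprod_cat_natural m (phi a)) !compA -/d.
rewrite (compE2 _ (bwdK d)) compm1 -!tmor_comp compm1.
by rewrite bwdK.
Qed.

Lemma FC_phi_bijective : (forall n, bijective (@Defs.phi K C m delta hm X X' n)) ->
  forall k, bijective (@Defs.FC_phi K C m delta hm X X' k).
Proof.
move=> bij k; have [psi phiK psiK] := bij (k * m)%N.
rewrite /Defs.FC_phi; set c := tprod_block _ k.
exists (fun h => psi (bwd c ∘ h ∘ fwd c)) => [a|h].
  rewrite !compA fwdK comp1m (compE2 _ (fwdK c)) compm1; exact: phiK.
by rewrite psiK !compA bwdK comp1m (compE2 _ (bwdK c)) compm1.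
Qed.

End Blocks.

Theorem proposition4p4 (R : realType) (m : nat) (hm : (0 < m)%N)
  (t : 'I_m -> R[i])
  (ht0 : forall j, t j != 0)
  (ht : forall j (n : nat), (0 < n)%N -> \sum_(i < n.+1) t j ^+ (2 * i) != 0)
  (C : tensor_category R[i]) (F : free_product t C)
  (X' : forall j, dual_data (fp_gen F j) (t j + (t j)^-1)) :
  let delta j := t j + (t j)^-1 in
  [/\ limit_isomorphism (@phi R[i] C m delta hm (fp_gen F) X'),
      simple (genX hm X')
    & limit_isomorphism (@FC_phi R[i] C m delta hm (fp_gen F) X')].
Proof.
move=> delta.
have bij n : bijective (@phi R[i] C m delta hm (fp_gen F) X' n).
  have [span free] := bent_basis X' (alternating_bent_word hm n) (parity_bent_word hm n).
  exact: phi_bijective span free.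
split.
- apply: limit_isomorphism_of bij _ _; first exact: phi_tower_morphism.
    exact: end_tower_linear.
  exact: end_tower_mul.
- exact: genX_simple.
apply: limit_isomorphism_of (FC_phi_bijective bij) _ _; first exact: FC_phi_tower_morphism.
  exact: end_tower_linear.
exact: end_tower_mul.
Qed.
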